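(* Let $H$ be a real separable Hilbert space with norm $\|\cdot\|$, let $\Omega$ be a probability space, and let $G:\Omega\to H$ be a nonzero centered Gaussian random variable. Then \[\frac{2\sqrt3-3}{15}\ \le\ \mathbb{P}\Big(\|G\|>(\mathbb{E}\|G\|^2)^{\frac12}\Big)\ \le\ \frac12.\]
   Context: An $H$-valued random variable $G$ is centered Gaussian if for every $h\in H$ the real random variable $\langle G,h\rangle$ is centered Gaussian (possibly degenerate, i.e. zero). Nonzero means that $G$ is not almost surely equal to $0$. *)

(* Defs.v *)
From HB Require Import structures.
From mathcomp Require Export all_boot all_order all_algebra.
From mathcomp Require Export all_classical all_reals all_analysis.

#[export] Set Implicit Arguments.
#[export] Unset Strict Implicit.
#[export] Unset Printing Implicit Defensive.

Export Order.TTheory GRing.Theory Num.Theory.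
Export numFieldNormedType.Exports.

Local Open Scope classical_set_scope.
Local Open Scope ring_scope.

Definition separable (T : topologicalType) : Prop :=
  exists2 D : set T, countable D & dense D.

Definition borel (H : ptopologicalType) := g_sigma_algebraType (@open H).

Section gaussian.
Context d (Omega : measurableType d) (R : realType) (P : probability Omega R).

(* In [normal_prob m s] the parameter [s] is the standard deviation, and
   [normal_prob 0 0] is not the Dirac mass at [0] but the uniform law on
   [0, 1]; this is why the degenerate law is a separate case. *)
Definition centered_gaussian (X : Omega -> R) : Prop :=
  measurable_fun [set: Omega] X /\
  ((forall A : set R, measurable A -> pushforward P X A = \d_(0 : R) A) \/
   exists2 s : R, 0 < s &
     forall A : set R, measurable A -> pushforward P X A = normal_prob 0 s A).

Definition hilbert_centered_gaussian (H : lmodType R) (ip : H -> H -> R)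
    (G : Omega -> H) : Prop :=
  forall h : H, centered_gaussian (fun w => ip (G w) h).

End gaussian.

(* Main.v *)
From HB Require Import structures.
Require Import Defs.
From mathcomp Require Import measurable_realfun ring lra.

(** Let [X = |G| ^ 2]. Expanding [G] in an orthonormal family obtained from a dense
    sequence, [X] is the increasing limit of [S n = \sum_(k < n) <G, e k> ^ 2] by
    Parseval's identity ([parseval]). The vector of the first [n] coordinates is
    Gaussian; in an orthonormal basis of eigenvectors of its covariance matrix
    ([symmetric_diagonalisation]) its coordinates are uncorrelated, and the Laplace
    transform of [S n] is that of [\sum_j l_j g_j ^ 2], where the [l_j >= 0] are the
    eigenvalues and the [g_j] are independent standard normal variables
    ([laplace_sum_squares]). As a law on the half-line is determined by its Laplace
    transform ([laplace_same_law]), [S n] has the law of that sum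
    ([gaussian_square_sum_law]). The event of the theorem is [E X < X], so both bounds
    concern the centred variable [Y = X - E X]; they are first obtained for [S n].

    Upper bound. The characteristic function of [\sum_j l_j (g_j ^ 2 - 1)] is
    [rho * exp (- i theta)], where
    [theta t = \sum_j (t l_j - atan (2 t l_j) / 2)] has a nonnegative increasing slope
    for [t >= 0], while [rho >= 0] decreases. A nonnegative decreasing weight makes the damped
    oscillating integral of [exp (- s t) * rho * sin theta] nonnegative, which is to say
    that [E (Y / (s ^ 2 + Y ^ 2)) <= 0] for every [s > 0]
    ([Rintegral_conjugate_Poisson_le0]). Integrating in [s] gives
    [E (atan (Y / s)) <= 0], and letting [s] tend to [0] gives
    [P (0 < Y) <= P (Y < 0)] ([probability_gt0_le_half]).

    Lower bound. Since [E (g ^ 2 - 1) ^ 4 = 15 (E (g ^ 2 - 1) ^ 2) ^ 2] for a standard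
    normal [g], independence gives [E Y ^ 4 <= 15 (E Y ^ 2) ^ 2]. A quartic polynomial
    that lies below the indicator of the positive half-line ([quartic_le_indic]),
    suitably scaled and integrated, turns this into the lower bound
    ([fourth_moment_lower_bound]).

    Passage to the limit. The lower bound for [S n] prevents the means of the [S n] from
    tending to infinity, because [X] is finite. As their fourth moments are then bounded
    too, [X] has a finite fourth moment, and dominated convergence carries the moment
    inequality and [E (Y / (s ^ 2 + Y ^ 2)) <= 0] over from [S n] to [X]. *)

Local Open Scope classical_set_scope.
Local Open Scope ring_scope.

(** * Integration on a probability space *)

Section real_integration.
Context d (T : measurableType d) (R : realType).
Variable P : {measure set T -> \bar R}.
Implicit Types f g : T -> R.

Lemma dominated_integrableR f g : measurable_fun [set: T] f ->
  P.-integrable [set: T] (EFin \o g) -> (forall x, `|f x| <= g x) ->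
  P.-integrable [set: T] (EFin \o f).
Proof.
move=> mf ig fg; apply: (le_integrable measurableT _ _ ig) => /=.
  exact/measurable_EFinP.
by move=> x _; rewrite lee_fin (le_trans (fg x))// ler_norm.
Qed.

Lemma integrableRZl (k : R) f : P.-integrable [set: T] (EFin \o f) ->
  P.-integrable [set: T] (EFin \o (fun x => k * f x)).
Proof.
move=> mf; rewrite (_ : _ \o _ = fun x => k%:E * (EFin \o f) x)%E//.
exact: integrableZl.
Qed.

Lemma integrableRD f g : P.-integrable [set: T] (EFin \o f) ->
  P.-integrable [set: T] (EFin \o g) ->
  P.-integrable [set: T] (EFin \o (fun x => f x + g x)).
Proof.
move=> mf mg; rewrite (_ : _ \o _ = ((EFin \o f) \+ (EFin \o g))%E)//.
exact: integrableD.
Qed.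

Lemma integrableRB f g : P.-integrable [set: T] (EFin \o f) ->
  P.-integrable [set: T] (EFin \o g) ->
  P.-integrable [set: T] (EFin \o (fun x => f x - g x)).
Proof.
move=> mf mg; rewrite (_ : _ \o _ = ((EFin \o f) \- (EFin \o g))%E)//.
exact: integrableB.
Qed.

Lemma integrable_measurableR f : P.-integrable [set: T] (EFin \o f) ->
  measurable_fun [set: T] f.
Proof. by move=> /measurable_int/measurable_EFinP. Qed.

Lemma EFin_Rintegral f : P.-integrable [set: T] (EFin \o f) ->
  (\int[P]_x f x)%:E = (\int[P]_x (f x)%:E)%E.
Proof. by move=> intf; rewrite /Rintegral fineK//; exact: integrable_fin_num. Qed.

Lemma integrable_sumR (I : Type) (r : seq I) (F : I -> T -> R) :
  (forall i, P.-integrable [set: T] (EFin \o F i)) ->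
  P.-integrable [set: T] (EFin \o (fun x => \sum_(i <- r) F i x)).
Proof.
move=> iF; elim: r => [|i r IH].
  by under eq_fun do rewrite big_nil; exact: integrable0.
by under eq_fun do rewrite big_cons; exact: integrableRD.
Qed.

Lemma Rintegral_sum (I : Type) (r : seq I) (F : I -> T -> R) :
  (forall i, P.-integrable [set: T] (EFin \o F i)) ->
  \int[P]_x (\sum_(i <- r) F i x) = \sum_(i <- r) \int[P]_x F i x.
Proof.
move=> iF; elim: r => [|i r IH].
  rewrite big_nil /Rintegral; under eq_integral do rewrite big_nil.
  by rewrite integral0.
under eq_Rintegral do rewrite big_cons.
by rewrite RintegralD// ?IH ?big_cons//; exact: integrable_sumR.
Qed.

Lemma Rintegral_dct (f_ : nat -> T -> R) f g :
  (forall n, measurable_fun [set: T] (f_ n)) -> measurable_fun [set: T] f ->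
  P.-integrable [set: T] (EFin \o g) -> (forall n x, `|f_ n x| <= g x) ->
  (forall x, f_ ^~ x @ \oo --> f x) ->
  (fun n => \int[P]_x f_ n x) @ \oo --> \int[P]_x f x.
Proof.
move=> mf_ mf ig fg ff.
have mE (h : T -> R) : measurable_fun [set: T] h -> measurable_fun [set: T] (EFin \o h).
  by move=> mh; exact/measurable_EFinP.
have ffE x : (fun n => (EFin \o f_ n) x) @ \oo --> (EFin \o f) x.
  by apply: cvg_EFin; [exact: nearW|exact: ff].
have [intf _ cvgint] := @dominated_convergence _ _ _ P _ measurableT
  (fun n => EFin \o f_ n) (EFin \o f) (EFin \o g)
  (fun n => mE _ (mf_ n)) (mE _ mf)
  (aeW _ (fun x _ => ffE x)) ig
  (aeW _ (fun x n _ => fg n x)).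
by apply: fine_cvg; rewrite fineK//; exact: integrable_fin_num.
Qed.

Lemma is_derive_Rintegral (f df : R -> T -> R) (G : T -> R) (a e : R) :
  0 < e ->
  (forall x, `|x - a| < e -> P.-integrable [set: T] (EFin \o f x)) ->
  (forall x y, `|x - a| < e -> is_derive x 1 (f ^~ y) (df x y)) ->
  (forall x y, `|x - a| < e -> `|df x y| <= G y) ->
  P.-integrable [set: T] (EFin \o G) ->
  is_derive a 1 (fun x => \int[P]_y f x y) (\int[P]_y df a y).
Proof.
move=> e0 intf derf dfG intG.
have aI : `]a - e, a + e[%classic a by rewrite /= in_itv/=; apply/andP; split; lra.
have xI x : `]a - e, a + e[%classic x -> `|x - a| < e.
  by rewrite /= in_itv/= ltr_norml => /andP[? ?]; apply/andP; split; lra.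
have G0 y : 0 <= G y.
  by apply: le_trans (dfG a y _); rewrite ?normr_ge0// subrr normr0.
have d1 x y : `|x - a| < e -> derive1 (f ^~ y) x = df x y.
  by move=> xa; rewrite derive1E; have [_ ->] := derf x y xa.
have intf' x : `]a - e, a + e[%classic x -> P.-integrable [set: T] (EFin \o f x).
  by move=> /xI; exact: intf.
have derf' x y : `]a - e, a + e[%classic x -> [set: T] y -> derivable (f ^~ y) x 1.
  by move=> /xI xa _; have [] := derf x y xa.
have Gub x y : `]a - e, a + e[%classic x -> [set: T] y ->
    `|derive1 (f ^~ y) x| <= G y.
  by move=> /xI xa _; rewrite d1//; exact: dfG.
apply: DeriveDef.
  exact: (derivable_under_integral measurableT aI intf' derf' G0 intG Gub).
rewrite -derive1E.
rewrite (differentiation_under_integral measurableT aI intf' derf' G0 intG Gub).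
by apply: eq_Rintegral => y _; rewrite -(d1 a y)// subrr normr0.
Qed.

End real_integration.

Section probability_integration.
Context d (T : measurableType d) (R : realType) (P : probability T R).
Implicit Types f : T -> R.

Lemma bounded_integrable f (M : R) : measurable_fun [set: T] f ->
  (forall x, `|f x| <= M) -> P.-integrable [set: T] (EFin \o f).
Proof.
move=> mf fM; apply: measurable_bounded_integrable => //=.
  by rewrite probability_setT ltry.
by exists M; split; [exact: num_real|move=> x Mx y _; exact/(le_trans (fM y))/ltW].
Qed.

Lemma Rintegral_cstT (c : R) : \int[P]_x c = c.
Proof. by rewrite Rintegral_cst//= probability_setT mulr1. Qed.

End probability_integration.

Section product_integration.
Context d1 (T1 : measurableType d1) d2 (T2 : measurableType d2) (R : realType).
Variables (P1 : probability T1 R) (P2 : probability T2 R).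

Lemma Rintegral_exchange (f : T1 * T2 -> R) (M : R) :
  measurable_fun [set: T1 * T2] f -> (forall z, `|f z| <= M) ->
  \int[P1]_x (\int[P2]_y f (x, y)) = \int[P2]_y (\int[P1]_x f (x, y)).
Proof.
move=> mf fM.
have intf := bounded_integrable (P1 \x P2)%E mf fM.
have m1 x : P2.-integrable [set: T2] (EFin \o (fun y => f (x, y))).
  apply: (@bounded_integrable _ _ _ _ _ M) => //.
  by apply: measurableT_comp => //; exact: measurable_pair1.
have m2 y : P1.-integrable [set: T1] (EFin \o (fun x => f (x, y))).
  apply: (@bounded_integrable _ _ _ _ _ M) => //.
  by apply: measurableT_comp => //; exact: measurable_pair2.
have := Fubini intf; rewrite /= => FE.
rewrite /Rintegral; congr fine.
under eq_integral => x _.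
  rewrite fineK; last exact: (integrable_fin_num measurableT (m1 x)).
  over.
rewrite FE; apply: eq_integral => y _.
by rewrite fineK//; exact: (integrable_fin_num measurableT (m2 y)).
Qed.

Variables (u : T1 -> R) (v : T2 -> R).
Hypotheses (intu : P1.-integrable [set: T1] (EFin \o u))
  (intv : P2.-integrable [set: T2] (EFin \o v)).

Lemma integrable_prod_mul :
  (P1 \x P2)%E.-integrable [set: T1 * T2] (EFin \o (fun z => u z.1 * v z.2)).
Proof.
have mu := integrable_measurableR intu; have mv := integrable_measurableR intv.
have mf : measurable_fun [set: T1 * T2] (EFin \o (fun z => u z.1 * v z.2)).
  apply/measurable_EFinP; apply: measurable_funM.
    exact: measurableT_comp.
  exact: measurableT_comp.
apply/(integrable12ltyP _ _ mf) => /=.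
have mnv : measurable_fun [set: T2] (fun y => `|v y|%:E).
  by apply/measurable_EFinP; exact: measurableT_comp.
have mnu : measurable_fun [set: T1] (fun x => `|u x|%:E).
  by apply/measurable_EFinP; exact: measurableT_comp.
have inE x : (\int[P2]_y `|u x * v y|%:E = `|u x|%:E * \int[P2]_y `|v y|%:E)%E.
  under eq_integral do rewrite normrM EFinM.
  by rewrite ge0_integralZl//= => y _; rewrite lee_fin.
under eq_integral do rewrite inE.
have := integrable_fin_num measurableT (integrable_norm intv) => /= nv.
have := integrable_fin_num measurableT (integrable_norm intu) => /= nu.
rewrite ge0_integralZr//=; last by rewrite integral_ge0// => x _; rewrite lee_fin.
by rewrite -(fineK nv) -(fineK nu) -EFinM ltry.
Qed.

Lemma Rintegral_prod_mul :
  \int[(P1 \x P2)%E]_z (u z.1 * v z.2) = (\int[P1]_x u x) * (\int[P2]_y v y).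
Proof.
rewrite /Rintegral -(integral12_prod_meas1 integrable_prod_mul) /fubini_F /=.
under eq_integral => x _.
  under eq_integral do rewrite EFinM.
  rewrite integralZl// -EFin_Rintegral//.
  over.
by rewrite integralZr// -EFin_Rintegral.
Qed.

End product_integration.

(** * Calculus for the normal law *)

Section normal_integration.
Context {R : realType}.
Variable s : R.
Hypothesis s0 : 0 < s.
Local Notation mu := (@lebesgue_measure R).
Local Notation N := (normal_prob (0 : R) s).

(** The density of the normal law is also its Radon-Nikodym derivative, because both
    have the same integral over every measurable set. *)
Lemma ge0_integral_normal_prob (f : R -> \bar R) :
  (forall x, 0 <= f x)%E -> measurable_fun [set: R] f ->
  (\int[N]_x f x = \int[mu]_x (f x * (normal_pdf 0 s x)%:E))%E.
Proof.
move=> f0 mf.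
have NE := Radon_Nikodym_SigmaFinite.change_of_variables
  (normal_prob_dominates (0 : R) s) f0 measurableT mf.
rewrite -NE; apply: ae_eq_integral => //.
- apply: emeasurable_funM => //; apply: (measurable_int mu).
  exact: (Radon_Nikodym_SigmaFinite.f_integrable (normal_prob_dominates _ _)).
- apply: emeasurable_funM => //; apply/measurable_EFinP.
  exact: measurable_normal_pdf.
- apply: ae_eqe_mul2l => /=.
  apply: integral_ae_eq => //=.
  + exact: (Radon_Nikodym_SigmaFinite.f_integrable (normal_prob_dominates _ _)).
  + by apply/measurable_EFinP; exact: measurable_normal_pdf.
  + move=> E _ mE; rewrite -Radon_Nikodym_SigmaFinite.f_integral//.
    exact: normal_prob_dominates.
Qed.

Lemma integrable_normal_probP (f : R -> R) : measurable_fun [set: R] f ->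
  N.-integrable [set: R] (EFin \o f) <->
  mu.-integrable [set: R] (EFin \o (fun x => f x * normal_pdf 0 s x)).
Proof.
move=> mf.
have mfp : measurable_fun [set: R] (EFin \o (fun x => f x * normal_pdf 0 s x)).
  apply/measurable_EFinP; apply: measurable_funM => //.
  exact: measurable_normal_pdf.
have E : (\int[N]_x `|(f x)%:E| = \int[mu]_x `|(f x * normal_pdf 0 s x)%:E|)%E.
  rewrite ge0_integral_normal_prob//=; last first.
    by apply/measurable_EFinP; exact: measurableT_comp.
  apply: eq_integral => x _.
  by rewrite normrM EFinM (ger0_norm (normal_pdf_ge0 _ _ _)).
split=> /integrableP[_ h]; apply/integrableP; split => //.
- by rewrite /= -E.
- exact/measurable_EFinP.
- by rewrite /= E.
Qed.

Lemma Rintegral_normal_prob (f : R -> R) : N.-integrable [set: R] (EFin \o f) ->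
  \int[N]_x f x = \int[mu]_x (f x * normal_pdf 0 s x).
Proof.
move=> intf; have mf := integrable_measurableR intf.
congr fine.
have intfp := (integrable_normal_probP mf).1 intf.
have p0 x : (0 <= (normal_pdf 0 s x)%:E)%E by rewrite lee_fin normal_pdf_ge0.
have mE : measurable_fun [set: R] (EFin \o f) by exact/measurable_EFinP.
rewrite integralE [RHS]integralE; congr (_ - _)%E.
  rewrite ge0_integral_normal_prob//; last exact: measurable_funepos.
  apply: eq_integral => x _; rewrite !funeposE.
  by rewrite muleC maxe_pMr// mule0 -EFinM mulrC.
rewrite ge0_integral_normal_prob//; last exact: measurable_funeneg.
apply: eq_integral => x _; rewrite !funenegE.
by rewrite muleC maxe_pMr// mule0 muleN -EFinM mulrC.
Qed.

Lemma normal_funE (x : R) :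
  normal_pdf 0 s x = normal_peak s * expR (- x ^+ 2 / (s ^+ 2 *+ 2)).
Proof. by rewrite normal_pdfE ?gt_eqF//= /normal_fun subr0. Qed.

(** With [n = k + 1], [1 + x ^ 2] is at most a multiple of [1 + c x ^ 2 / n], whose
    [n]-th power is at most [exp (c x ^ 2)]. *)
Lemma polynomial_le_expR (k : nat) (c : R) : 0 < c ->
  exists2 K : R, 0 <= K & forall x : R, (1 + x ^+ 2) ^+ k <= K * expR (c * x ^+ 2).
Proof.
move=> c0; pose M := Num.max 1 (k.+1%:R / c) : R.
have M1 : 1 <= M by rewrite le_max lexx.
have Mk : k.+1%:R / c <= M by rewrite le_max lexx orbT.
exists (M ^+ k.+1) => [|x]; first by rewrite exprn_ge0// (le_trans _ M1).
have x0 := sqr_ge0 x.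
have k0 : (0 : R) < k.+1%:R by rewrite ltr0n.
have cxk : 0 <= c * x ^+ 2 / k.+1%:R.
  exact: divr_ge0 (mulr_ge0 (ltW c0) x0) (ltW k0).
have H1 : 1 + x ^+ 2 <= M * (1 + c * x ^+ 2 / k.+1%:R).
  rewrite mulrDr mulr1 lerD//.
  apply: (@le_trans _ _ ((k.+1%:R / c) * (c * x ^+ 2 / k.+1%:R))); last first.
    by rewrite ler_wpM2r.
  rewrite le_eqVlt; apply/orP; left; apply/eqP.
  have := lt0r_neq0 k0; move: (k.+1%:R : R) => n n0; field.
  by rewrite n0 (gt_eqF c0).
apply: (@le_trans _ _ ((1 + x ^+ 2) ^+ k.+1)).
  by rewrite (exprS _ k) ler_peMl ?exprn_ge0//; lra.
apply: (@le_trans _ _ ((M * (1 + c * x ^+ 2 / k.+1%:R)) ^+ k.+1)).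
  have H0 : 0 <= 1 + x ^+ 2 by rewrite addr_ge0.
  by rewrite lerXn2r// nnegrE (le_trans H0).
rewrite exprMn ler_wpM2l ?exprn_ge0 ?(le_trans _ M1)//.
rewrite -[leRHS](_ : expR (k.+1%:R * (c * x ^+ 2 / k.+1%:R)) = _); last first.
  by congr expR; rewrite mulrC divfK// pnatr_eq0.
rewrite expRM_natl lerXn2r ?nnegrE ?expR_ge0 ?expR_ge1Dx//.
by rewrite addr_ge0.
Qed.

Definition poly_growth (f : R -> R) :=
  exists (C : R) (k : nat), 0 <= C /\ forall x, `|f x| <= C * (1 + x ^+ 2) ^+ k.

Lemma integrable_poly_growth (f : R -> R) : measurable_fun [set: R] f ->
  poly_growth f -> N.-integrable [set: R] (EFin \o f).
Proof.
move=> mf [C [k [C0 fC]]]; apply/integrable_normal_probP => //.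
have c0 : 0 < (4 * s ^+ 2)^-1 by rewrite invr_gt0 mulr_gt0// exprn_gt0.
have [K K0 HK] := polynomial_le_expR k c0.
have s20 : Num.sqrt 2 * s != 0 by rewrite mulf_neq0 ?gt_eqF// sqrtr_gt0.
pose c := C * K * normal_peak s / normal_peak (Num.sqrt 2 * s).
have int2 := integrableZl measurableT c (integrable_normal_pdf 0 (Num.sqrt 2 * s)).
apply: (le_integrable measurableT _ _ int2).
  apply/measurable_EFinP; apply: measurable_funM => //.
  exact: measurable_normal_pdf.
move=> x _; rewrite -EFinM /= !lee_fin !normrM.
rewrite (ger0_norm (normal_pdf_ge0 _ _ _)) (ger0_norm (normal_pdf_ge0 _ _ _)).
rewrite normal_funE (normal_pdfE _ s20) /normal_fun subr0 exprMn sqr_sqrtr//.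
rewrite (ger0_norm C0) (ger0_norm K0) (ger0_norm (normal_peak_ge0 s)).
rewrite (@ger0_norm _ (normal_peak _)^-1) ?invr_ge0 ?normal_peak_ge0//.
have -> : expR (- x ^+ 2 / ((2 * s ^+ 2) *+ 2)) =
    expR ((4 * s ^+ 2)^-1 * x ^+ 2) * expR (- x ^+ 2 / (s ^+ 2 *+ 2)).
  rewrite -expRD; congr expR; field.
  by rewrite gt_eqF.
have := normal_peak_gt0 s20; have := normal_peak_gt0 (lt0r_neq0 s0).
move: (normal_peak s) (normal_peak (_ * s)) => p q p0 q0.
have := fC x; have := HK x; have := expR_ge0 (- x ^+ 2 / (s ^+ 2 *+ 2)).
move: (expR (- x ^+ 2 / _)) (expR (_ * x ^+ 2)).
move=> e2 e1 e20 h1 h2.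
rewrite (_ : _ / q * _ = (C * (K * e1)) * (p * e2)); last first.
  by field; rewrite gt_eqF.
apply: ler_wpM2r; first by rewrite mulr_ge0// ltW.
by rewrite (le_trans h2)// ler_wpM2l.
Qed.

End normal_integration.

Section integral_derivative.
Context {R : realType}.
Local Notation mu := (@lebesgue_measure R).

(** The fundamental theorem of calculus on the whole line, for a primitive that
    vanishes at both ends. *)
Lemma Rintegral_derivative_eq0 (F f : R -> R) :
  continuous f -> (forall x : R, is_derive x 1 F (f x)) ->
  mu.-integrable [set: R] (EFin \o f) ->
  F x @[x --> +oo] --> 0 -> F x @[x --> -oo] --> 0 ->
  \int[mu]_x f x = 0.
Proof.
move=> cf dF intf Fy FNy.
pose f_ n := (f \_ `[(- n.+1%:R)%R, n.+1%:R]).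
have FTC n : \int[mu]_x f_ n x = F n.+1%:R - F (- n.+1%:R).
  rewrite -Rintegral_mkcond /Rintegral (@continuous_FTC2 _ f F)//.
  - by have : (0 : R) < n.+1%:R by []; lra.
  - exact: continuous_subspaceT.
  - split.
    + by move=> x _; have [] := dF x.
    + apply: cvg_at_right_filter; apply: differentiable_continuous.
      by apply/derivable1_diffP; have [] := dF (- n.+1%:R).
    + apply: cvg_at_left_filter; apply: differentiable_continuous.
      by apply/derivable1_diffP; have [] := dF (n.+1%:R).
  - by move=> x _; rewrite derive1E; have [_ ->] := dF x.
have mf := integrable_measurableR intf.
have c1 : (fun n => \int[mu]_x f_ n x) @ \oo --> \int[mu]_x f x.
  apply: (Rintegral_dct _ mf (integrable_norm intf)) => [n|n x|x].
  - apply/(measurable_restrictT _ _).1 => //; exact: measurable_funTS.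
  - by rewrite /f_ patchE; case: ifP => //= _; rewrite normr0.
  - apply: cvg_near_cst; near=> n; rewrite /f_ patchE mem_set//=.
    rewrite in_itv/= -ler_norml (le_trans (ltW (truncnS_gt _)))// ler_nat ltnS.
    by near: n; exact: nbhs_infty_ge.
have cy : (n.+1%:R : R) @[n --> \oo] --> +oo.
  apply/cvgryPge => A; near=> n; apply: (@le_trans _ _ n%:R).
    by near: n; exact: nbhs_infty_ger.
  by rewrite ler_nat.
have c2 : (fun n => \int[mu]_x f_ n x) @ \oo --> (0 - 0 : R).
  under eq_fun do rewrite FTC.
  apply: cvgB; first exact: (cvg_comp _ _ cy Fy).
  by apply: (cvg_comp _ _ _ FNy); exact/cvgNrNy.
by have := cvg_unique _ c1 c2; rewrite subrr; exact.
Unshelve. all: by end_near. Qed.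

End integral_derivative.

Section stein.
Context {R : realType}.
Variable s : R.
Hypothesis s0 : 0 < s.
Local Notation N := (normal_prob (0 : R) s).

Lemma is_derive_normal_pdf (x : R) :
  is_derive x 1 (normal_pdf 0 s) (- (x / s ^+ 2) * normal_pdf 0 s x).
Proof.
rewrite (_ : normal_pdf 0 s =
  fun x => normal_peak s * expR (- x ^+ 2 / (s ^+ 2 *+ 2))); last first.
  by apply/funext => y; rewrite normal_funE.
apply: is_derive_eq; rewrite /GRing.scale/=; field.
by rewrite gt_eqF.
Qed.

Lemma poly_growthXM (f : R -> R) : poly_growth f -> poly_growth (fun x => x * f x).
Proof.
move=> [C [k [C0 fC]]]; exists C, k.+1; split=> // x.
rewrite normrM exprS mulrCA.
have h : `|x| <= 1 + x ^+ 2.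
  rewrite -(real_normK (num_real x)).
  by have := sqr_ge0 (`|x| - 1); have := normr_ge0 x; nra.
exact: ler_pM.
Qed.

Lemma poly_growthD (f g : R -> R) : poly_growth f -> poly_growth g ->
  poly_growth (fun x => f x + g x).
Proof.
move=> [C [k [C0 fC]]] [D [l [D0 gD]]]; exists (C + D), (k + l)%N; split.
  exact: addr_ge0.
move=> x; have x1 : 1 <= 1 + x ^+ 2 by rewrite lerDl sqr_ge0.
rewrite (le_trans (ler_normD _ _))// mulrDl lerD//.
  by rewrite (le_trans (fC x))// ler_wpM2l// ler_weXn2l// leq_addr.
by rewrite (le_trans (gD x))// ler_wpM2l// ler_weXn2l// leq_addl.
Qed.

Lemma poly_growthZ (a : R) (f : R -> R) : poly_growth f ->
  poly_growth (fun x => a * f x).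
Proof.
move=> [C [k [C0 fC]]]; exists (`|a| * C), k; split; first exact: mulr_ge0.
by move=> x; rewrite normrM -mulrA ler_wpM2l.
Qed.

Lemma bounded_poly_growth (M : R) (f : R -> R) : (forall x, `|f x| <= M) ->
  poly_growth f.
Proof.
move=> fM; exists M, 0%N; split; first exact: le_trans (normr_ge0 _) (fM 0).
by move=> x; rewrite expr0 mulr1.
Qed.

Lemma poly_growth_normal_pdf_bound (F : R -> R) : poly_growth F ->
  exists2 D : R, 0 <= D & forall x, `|F x * normal_pdf 0 s x| <= D / (1 + x ^+ 2).
Proof.
move=> [C [k [C0 FC]]].
have c0 : 0 < (s ^+ 2 *+ 2)^-1 by rewrite invr_gt0 mulrn_wgt0// exprn_gt0.
have [K K0 HK] := polynomial_le_expR k.+1 c0.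
have p0 := normal_peak_ge0 s.
exists (C * K * normal_peak s) => [|x]; first by rewrite !mulr_ge0.
have x1 : 0 < 1 + x ^+ 2 by rewrite ltr_pwDl// sqr_ge0.
rewrite ler_pdivlMr// normrM (ger0_norm (normal_pdf_ge0 _ _ _)) normal_funE//.
have -> : expR (- x ^+ 2 / (s ^+ 2 *+ 2)) =
    (expR ((s ^+ 2 *+ 2)^-1 * x ^+ 2))^-1 by rewrite mulNr expRN mulrC.
have := HK x; have := expR_gt0 ((s ^+ 2 *+ 2)^-1 * x ^+ 2).
move: (expR _) => e e0; rewrite exprSr => He.
have -> : `|F x| * (normal_peak s / e) * (1 + x ^+ 2) =
    `|F x| * (1 + x ^+ 2) * normal_peak s / e by ring.
rewrite ler_pdivrMr// [leRHS]mulrAC; apply: ler_wpM2r => //.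
apply: (@le_trans _ _ (C * (1 + x ^+ 2) ^+ k * (1 + x ^+ 2))).
  by apply: ler_wpM2r; [exact: ltW|exact: FC].
by rewrite -!mulrA; apply: ler_wpM2l.
Qed.

(** Stein's identity: integration by parts against the Gaussian density. *)
Lemma stein_identity (F f : R -> R) : continuous f ->
  (forall x : R, is_derive x 1 F (f x)) -> poly_growth F -> poly_growth f ->
  \int[N]_x (x * F x) = s ^+ 2 * \int[N]_x f x.
Proof.
move=> cf dF gF gf.
have s20 : s ^+ 2 != 0 by rewrite gt_eqF// exprn_gt0.
have cF : continuous F.
  move=> x; apply: differentiable_continuous.
  by apply/derivable1_diffP; have [] := dF x.
pose g x := f x + (- (s ^+ 2)^-1) * (x * F x).
have cg : continuous g.
  move=> x; apply: cvgD; first exact: cf.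
  apply: cvgM; first exact: cvg_cst.
  by apply: cvgM; [exact: cvg_id|exact: cF].
have mg : measurable_fun [set: R] g by exact: continuous_measurable_fun.
have mf : measurable_fun [set: R] f by exact: continuous_measurable_fun.
have mxF : measurable_fun [set: R] (fun x => x * F x).
  by apply: measurable_funM => //; exact: continuous_measurable_fun.
have gg : poly_growth g by apply: poly_growthD => //; exact/poly_growthZ/poly_growthXM.
have intf := integrable_poly_growth s0 mf gf.
have intxF := integrable_poly_growth s0 mxF (poly_growthXM gF).
have intg := integrable_poly_growth s0 mg gg.
suff : \int[N]_x g x = 0.
  rewrite RintegralD//; last exact: integrableRZl.
  rewrite RintegralZl// => /eqP; rewrite mulNr subr_eq0 => /eqP ->.
  by rewrite mulrA divff// mul1r.
rewrite Rintegral_normal_prob//.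
have [D D0 HD] := poly_growth_normal_pdf_bound gF.
have Dlt (e x : R) : 0 < e -> D / e <= `|x| -> `|F x * normal_pdf 0 s x| < e.
  move=> e0; rewrite ler_pdivrMr// => h; apply: le_lt_trans (HD x) _.
  have x1 : 0 < 1 + x ^+ 2 by rewrite ltr_pwDl// sqr_ge0.
  rewrite ltr_pdivrMr//; apply: (le_lt_trans h); rewrite mulrC ltr_pM2l//.
  rewrite -(real_normK (num_real x)).
  by have := sqr_ge0 (`|x| - 1); have := normr_ge0 x; nra.
apply: (@Rintegral_derivative_eq0 _ (fun x => F x * normal_pdf 0 s x)).
- move=> x; apply: cvgM; first exact: cg.
  by apply: continuous_normal_pdf; rewrite gt_eqF.
- move=> x; have := is_derive_normal_pdf x; have := dF x => ? ?.
  apply: is_derive_eq; rewrite /g /GRing.scale/=; field.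
  by rewrite gt_eqF.
- by apply/integrable_normal_probP.
- apply/cvgr0Pnorm_lt => e e0; near=> x; apply: Dlt => //.
  rewrite (@le_trans _ _ x)// ?ler_norm//; near: x; exact: nbhs_pinfty_ge.
- apply/cvgr0Pnorm_lt => e e0; near=> x; apply: Dlt => //.
  rewrite (@le_trans _ _ (- x))//; last by rewrite -normrN ler_norm.
  rewrite lerNr; near: x; apply: nbhs_ninfty_le; exact: num_real.
Unshelve. all: by end_near. Qed.

End stein.

Section gaussian_transforms.
Context {R : realType}.

Lemma poly_growth_sqr1 : poly_growth (fun x : R => 1 + x ^+ 2).
Proof.
exists 1, 1%N; split=> // x; rewrite mul1r expr1 ger0_norm//.
by rewrite addr_ge0// sqr_ge0.
Qed.

Lemma poly_growthX k : poly_growth (fun x : R => x ^+ k).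
Proof.
elim: k => [|k IH]; first by apply: (@bounded_poly_growth _ 1) => x; rewrite expr0 normr1.
by under eq_fun do rewrite exprS; exact: poly_growthXM.
Qed.

Lemma cos_norm_le1 (x : R) : `|cos x| <= 1.
Proof. by rewrite ler_norml cos_geN1 cos_le1. Qed.

Lemma sin_norm_le1 (x : R) : `|sin x| <= 1.
Proof. by rewrite ler_norml sin_geN1 sin_le1. Qed.

Lemma measurable_cosR : measurable_fun [set: R] (@cos R).
Proof. apply: continuous_measurable_fun; exact: continuous_cos. Qed.

Lemma measurable_sinR : measurable_fun [set: R] (@sin R).
Proof. apply: continuous_measurable_fun; exact: continuous_sin. Qed.

(** By Stein's identity the characteristic function [phi] of the normal law solves
    [phi' = - s ^ 2 * t * phi]. *)
Lemma Rintegral_normal_cos (s t : R) : 0 < s ->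
  \int[normal_prob (0 : R) s]_x cos (t * x) = expR (- (s ^+ 2 * t ^+ 2 / 2)).
Proof.
move=> s0.
set N := normal_prob (0 : R) s.
pose phi (t : R) := \int[N]_x cos (t * x).
have dphi (a : R) : is_derive a 1 phi (- (s ^+ 2 * a * phi a)).
  have : is_derive a 1 phi (\int[N]_x (- (x * sin (a * x)))).
    apply: (@is_derive_Rintegral _ _ _ N (fun t x => cos (t * x))
      (fun t x => - (x * sin (t * x))) (fun x => 1 + x ^+ 2) a 1) => //.
    - move=> x _; apply: (@bounded_integrable _ _ _ _ _ 1).
        apply: measurableT_comp; [exact: measurable_cosR|exact: mulrl_measurable].
      by move=> y; exact: cos_norm_le1.
    - move=> x y _; apply: is_derive_eq; rewrite /GRing.scale/=; ring.
    - move=> x y _; rewrite normrN normrM.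
      rewrite (@le_trans _ _ `|y|)//.
        by rewrite ler_piMr// sin_norm_le1.
      rewrite -(real_normK (num_real y)).
      by have := sqr_ge0 (`|y| - 1); have := normr_ge0 y; nra.
    - apply: integrable_poly_growth => //; last exact: poly_growth_sqr1.
      by apply: measurable_funD => //; exact: measurable_funX.
  have E : \int[N]_x (x * sin (a * x)) = s ^+ 2 * \int[N]_x (a * cos (a * x)).
    apply: stein_identity => //.
    - move=> x; apply: cvgM; first exact: cvg_cst.
      apply: continuous_comp; last exact: continuous_cos.
      by apply: cvgM; [exact: cvg_cst|exact: cvg_id].
    - by move=> x; apply: is_derive_eq; rewrite /GRing.scale/=; ring.
    - by apply: (@bounded_poly_growth _ 1) => x; exact: sin_norm_le1.
    - apply: poly_growthZ.
      by apply: (@bounded_poly_growth _ 1) => x; exact: cos_norm_le1.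
  have intc : N.-integrable [set: R] (EFin \o (fun x => cos (a * x))).
    apply: (@bounded_integrable _ _ _ _ _ 1); last by move=> x; exact: cos_norm_le1.
    by apply: measurableT_comp; [exact: measurable_cosR|exact: mulrl_measurable].
  rewrite RintegralZl// in E.
  have -> : \int[N]_x (- (x * sin (a * x))) = - \int[N]_x (x * sin (a * x)).
    rewrite -mulN1r -RintegralZl//.
      by apply: eq_Rintegral => x _; rewrite mulN1r.
    apply: integrable_poly_growth => //.
      apply: measurable_funM => //.
      by apply: measurableT_comp; [exact: measurable_sinR|exact: mulrl_measurable].
    apply: poly_growthXM.
    by apply: (@bounded_poly_growth _ 1) => x; exact: sin_norm_le1.
  by rewrite E mulrA.
pose psi (t : R) := phi t * expR (s ^+ 2 * t ^+ 2 / 2).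
have psi1 : psi t = psi 0.
  apply: is_derive_0_is_cst => a; have := dphi a => ?.
  by apply: is_derive_eq; rewrite /GRing.scale/=; field.
have phi0 : phi 0 = 1.
  rewrite /phi; under eq_Rintegral do rewrite mul0r cos0.
  exact: Rintegral_cstT.
move: psi1; rewrite /psi phi0 expr0n/= mulr0 mul0r expR0 mulr1 => h.
have e0 := lt0r_neq0 (expR_gt0 (s ^+ 2 * t ^+ 2 / 2)).
by apply: (mulIf e0); rewrite -/(phi t) h expRN mulVf.
Qed.

(** The exponential factor turns the density of standard deviation [s] into that of
    standard deviation [s / q], up to the factor [q ^-1]. *)
Lemma Rintegral_normal_expR_sqr (s c : R) : 0 < s -> 0 <= c ->
  \int[normal_prob (0 : R) s]_x expR (- (c * x ^+ 2)) =
  (Num.sqrt (1 + 2 * c * s ^+ 2))^-1.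
Proof.
move=> s0 c0.
have q0 : 0 < 1 + 2 * c * s ^+ 2.
  by rewrite ltr_pwDl// !mulr_ge0// ltW.
rewrite Rintegral_normal_prob//; last first.
  apply: (@bounded_integrable _ _ _ _ _ 1).
    apply: measurableT_comp => //; apply: measurableT_comp => //.
    by apply: measurable_funM => //; exact: measurable_funX.
  move=> x; rewrite ger0_norm ?expR_ge0// -expR0 ler_expR oppr_le0.
  by rewrite mulr_ge0// sqr_ge0.
set q := Num.sqrt (1 + 2 * c * s ^+ 2).
have q'0 : 0 < q by rewrite sqrtr_gt0.
have qq : q ^+ 2 = 1 + 2 * c * s ^+ 2 by rewrite sqr_sqrtr// ltW.
have sq0 : 0 < s / q by rewrite divr_gt0.
have E x : expR (- (c * x ^+ 2)) * normal_pdf 0 s x = q^-1 * normal_pdf 0 (s / q) x.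
  rewrite !normal_funE// mulrCA -expRD.
  have -> : - (c * x ^+ 2) + - x ^+ 2 / (s ^+ 2 *+ 2) = - x ^+ 2 / ((s / q) ^+ 2 *+ 2).
    rewrite exprMn exprVn qq; field.
    by rewrite gt_eqF//= gt_eqF.
  rewrite mulrA; congr (_ * _).
  rewrite /normal_peak -invfM; congr (_^-1).
  have -> : s ^+ 2 * pi *+ 2 = q ^+ 2 * ((s / q) ^+ 2 * pi *+ 2) :> R.
    by rewrite exprMn exprVn; field; rewrite gt_eqF.
  by rewrite sqrtrM ?sqr_ge0// sqrtr_sqr gtr0_norm.
under eq_Rintegral do rewrite E.
rewrite RintegralZl//; last exact: integrable_normal_pdf.
by rewrite /Rintegral integral_normal_pdf/= mulr1.
Qed.

End gaussian_transforms.

(** * Weighted sums of squares of independent normal variables *)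

Section chi_square.
Context {R : realType}.
Local Notation N := (normal_prob (0 : R) 1).

Let intP (f : R -> R) : continuous f -> poly_growth f ->
  N.-integrable [set: R] (EFin \o f).
Proof.
by move=> cf; apply: integrable_poly_growth => //; exact: continuous_measurable_fun.
Qed.

Lemma integrable_normalX k : N.-integrable [set: R] (EFin \o (fun x => x ^+ k)).
Proof. by apply: intP; [exact: exprn_continuous|exact: poly_growthX]. Qed.

Lemma Rintegral_normalXSS k :
  \int[N]_x (x ^+ k.+2) = k.+1%:R * \int[N]_x (x ^+ k).
Proof.
under eq_Rintegral do rewrite exprS.
transitivity (1 ^+ 2 * \int[N]_x (k.+1%:R * x ^+ k)); last first.
  by rewrite expr1n mul1r RintegralZl//; exact: integrable_normalX.
apply: stein_identity => //.
- by move=> x; apply: cvgM; [exact: cvg_cst|exact: exprn_continuous].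
- move=> x; apply: DeriveDef; first exact: exprn_derivable.
  by rewrite exp_derive /GRing.scale/= mulr1.
- exact: poly_growthX.
- exact/poly_growthZ/poly_growthX.
Qed.

Lemma normal_moments :
  [/\ \int[N]_x (x ^+ 2) = 1, \int[N]_x (x ^+ 4) = 3, \int[N]_x (x ^+ 6) = 15 &
      \int[N]_x (x ^+ 8) = 105].
Proof.
have m0 : \int[N]_x (x ^+ 0) = 1.
  by under eq_Rintegral do rewrite expr0; exact: Rintegral_cstT.
by rewrite !Rintegral_normalXSS m0; split; ring.
Qed.

(** Moments of the centred square of a standard normal variable; the ratio
    60 / 2 ^ 2 = 15 is where the constant 15 of the lower bound comes from. *)
Lemma centered_square_moments :
  [/\ \int[N]_x (x ^+ 2 - 1) = 0, \int[N]_x (x ^+ 2 - 1) ^+ 2 = 2 &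
      \int[N]_x (x ^+ 2 - 1) ^+ 4 = 60].
Proof.
have [m2 m4 m6 m8] := normal_moments.
have iX := integrable_normalX.
have i1 : N.-integrable [set: R] (EFin \o cst 1).
  by apply: (@bounded_integrable _ _ _ _ _ 1) => // x; rewrite normr1.
have c1 : \int[N]_x 1 = 1 by exact: Rintegral_cstT.
have iZ c k : N.-integrable [set: R] (EFin \o (fun x => c * x ^+ k)).
  exact: integrableRZl.
split.
- by rewrite RintegralB// m2 c1 subrr.
- under eq_Rintegral => x _.
    rewrite (_ : _ ^+ 2 = x ^+ 4 + (- 2) * x ^+ 2 + 1); last by ring.
    over.
  have i42 := integrableRD (iX 4) (iZ (- 2) 2).
  rewrite RintegralD// RintegralD// RintegralZl//.
  by rewrite m4 m2 c1; ring.
- under eq_Rintegral => x _.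
    rewrite (_ : _ ^+ 4 = x ^+ 8 + (- 4) * x ^+ 6 + 6 * x ^+ 4 + (- 4) * x ^+ 2 + 1);
      last by ring.
    over.
  have i86 := integrableRD (iX 8) (iZ (- 4) 6).
  have i864 := integrableRD i86 (iZ 6 4).
  have i8642 := integrableRD i864 (iZ (- 4) 2).
  rewrite RintegralD// RintegralD// RintegralD// RintegralD// !RintegralZl//.
  by rewrite m8 m6 m4 m2 c1; ring.
Qed.

(** Phase and modulus of the characteristic function
    [(1 - 2 i t) ^ (- 1 / 2) exp (- i t)] of [g ^ 2 - 1], which is
    [chi_modulus t * exp (- i chi_phase t)]. *)
Definition chi_phase (t : R) : R := t - atan (2 * t) / 2.
Definition chi_modulus (t : R) : R := expR (- (ln (1 + 4 * t ^+ 2) / 4)).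

Lemma is_derive_chi_phase (t : R) :
  is_derive t 1 chi_phase (4 * t ^+ 2 / (1 + 4 * t ^+ 2)).
Proof.
apply: is_derive_eq; rewrite /GRing.scale/= exprMn.
have : 0 < 1 + 4 * t ^+ 2 by rewrite ltr_pwDl// mulr_ge0// sqr_ge0.
by move=> h; field; rewrite gt_eqF.
Qed.

Lemma is_derive_ln_sqr (t : R) :
  is_derive t 1 (fun t => ln (1 + 4 * t ^+ 2)) (8 * t / (1 + 4 * t ^+ 2)).
Proof.
have h : 0 < 1 + 4 * t ^+ 2 by rewrite ltr_pwDl// mulr_ge0// sqr_ge0.
have ? := is_derive1_ln h.
apply: (@is_derive_eq _ _ _ _ _ _ _ _ (is_derive1_comp _ _)).
by rewrite /GRing.scale/=; field; rewrite gt_eqF.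
Qed.

Lemma is_derive_chi_modulus (t : R) :
  is_derive t 1 chi_modulus (- (2 * t / (1 + 4 * t ^+ 2)) * chi_modulus t).
Proof.
have h : 0 < 1 + 4 * t ^+ 2 by rewrite ltr_pwDl// mulr_ge0// sqr_ge0.
have ? := is_derive_ln_sqr t.
by apply: is_derive_eq; rewrite /GRing.scale/= -/(chi_modulus t); field; rewrite gt_eqF.
Qed.

Let W (x : R) := x ^+ 2 - 1.
Let cW : continuous W.
Proof.
move=> x; apply: cvgB; [exact: exprn_continuous|exact: cvg_cst].
Qed.

Let ctW (t : R) : continuous (fun x => t * W x).
Proof. by move=> x; apply: cvgM; [exact: cvg_cst|exact: cW]. Qed.

Let ccos t : continuous (fun x => cos (t * W x)).
Proof. by move=> x; apply: continuous_comp; [exact: ctW|exact: continuous_cos]. Qed.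

Let csin t : continuous (fun x => sin (t * W x)).
Proof. by move=> x; apply: continuous_comp; [exact: ctW|exact: continuous_sin]. Qed.

Let gcos t : poly_growth (fun x => cos (t * W x)).
Proof. by apply: (@bounded_poly_growth _ 1) => x; exact: cos_norm_le1. Qed.

Let gsin t : poly_growth (fun x => sin (t * W x)).
Proof. by apply: (@bounded_poly_growth _ 1) => x; exact: sin_norm_le1. Qed.

Let WG x : `|W x| <= 1 + x ^+ 2.
Proof. by rewrite /W ler_norml; have := sqr_ge0 x => ?; apply/andP; split; lra. Qed.

Let intG : N.-integrable [set: R] (EFin \o (fun x => 1 + x ^+ 2)).
Proof.
apply: integrableRD; last exact: integrable_normalX.
by apply: (@bounded_integrable _ _ _ _ _ 1) => // x; rewrite normr1.
Qed.

(** The derivatives of the real part [c] and of the imaginary part [d] involve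
    [E (g ^ 2 cos)] and [E (g ^ 2 sin)], and Stein's identity expresses these two
    linearly through each other, [c] and [d]. Solving for them gives a linear
    differential equation, along which [u + i v], the quotient of the characteristic
    function by its claimed value, is constant. *)
Lemma chi_square_cf (t : R) :
  \int[N]_x cos (t * (x ^+ 2 - 1)) = chi_modulus t * cos (chi_phase t) /\
  \int[N]_x sin (t * (x ^+ 2 - 1)) = - (chi_modulus t * sin (chi_phase t)).
Proof.
pose c t := \int[N]_x cos (t * W x); pose d t := \int[N]_x sin (t * W x).
pose A t := \int[N]_x (x * (x * cos (t * W x))).
pose B t := \int[N]_x (x * (x * sin (t * W x))).
have ic t' : N.-integrable [set: R] (EFin \o (fun x => cos (t' * W x))) by exact: intP.
have is_ t' : N.-integrable [set: R] (EFin \o (fun x => sin (t' * W x))) by exact: intP.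
have cxc t' : continuous (fun x : R => x * (x * cos (t' * W x))).
  by move=> x; apply: cvgM; [exact: cvg_id|apply: cvgM; [exact: cvg_id|exact: ccos]].
have cxs t' : continuous (fun x : R => x * (x * sin (t' * W x))).
  by move=> x; apply: cvgM; [exact: cvg_id|apply: cvgM; [exact: cvg_id|exact: csin]].
have gxc t' : poly_growth (fun x => x * (x * cos (t' * W x))).
  exact/poly_growthXM/poly_growthXM.
have gxs t' : poly_growth (fun x => x * (x * sin (t' * W x))).
  exact/poly_growthXM/poly_growthXM.
have iA t' := intP (cxc t') (gxc t').
have iB t' := intP (cxs t') (gxs t').
have dc (t' : R) : is_derive t' 1 c (d t' - B t').
  rewrite (_ : d t' - B t' = \int[N]_x (- (W x * sin (t' * W x)))); last first.
    rewrite -RintegralB//; apply: eq_Rintegral => x _; rewrite /W; ring.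
  apply: (@is_derive_Rintegral _ _ _ N (fun t x => cos (t * W x))
    (fun t x => - (W x * sin (t * W x))) (fun x => 1 + x ^+ 2) t' 1) => //.
  - by move=> x y _; apply: is_derive_eq; rewrite /GRing.scale/=; ring.
  - move=> x y _; rewrite normrN normrM (le_trans _ (WG y))// ler_piMr//.
    exact: sin_norm_le1.
have dd (t' : R) : is_derive t' 1 d (A t' - c t').
  rewrite (_ : A t' - c t' = \int[N]_x (W x * cos (t' * W x))); last first.
    rewrite -RintegralB//; apply: eq_Rintegral => x _; rewrite /W; ring.
  apply: (@is_derive_Rintegral _ _ _ N (fun t x => sin (t * W x))
    (fun t x => W x * cos (t * W x)) (fun x => 1 + x ^+ 2) t' 1) => //.
  - by move=> x y _; apply: is_derive_eq; rewrite /GRing.scale/=; ring.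
  - move=> x y _; rewrite normrM (le_trans _ (WG y))// ler_piMr//.
    exact: cos_norm_le1.
have AE t' : A t' = c t' - 2 * t' * B t'.
  transitivity (1 ^+ 2 *
    \int[N]_x (cos (t' * W x) + (- (2 * t')) * (x * (x * sin (t' * W x))))).
    apply: stein_identity => //.
    - move=> x; apply: cvgD; first exact: ccos.
      by apply: cvgM; [exact: cvg_cst|exact: cxs].
    - by move=> x; apply: is_derive_eq; rewrite /W /GRing.scale/=; ring.
    - exact: poly_growthXM.
    - by apply: poly_growthD => //; exact: poly_growthZ.
  rewrite expr1n mul1r RintegralD//; last exact: integrableRZl.
  by rewrite RintegralZl// mulNr.
have BE t' : B t' = d t' + 2 * t' * A t'.
  transitivity (1 ^+ 2 *
    \int[N]_x (sin (t' * W x) + (2 * t') * (x * (x * cos (t' * W x))))).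
    apply: stein_identity => //.
    - move=> x; apply: cvgD; first exact: csin.
      by apply: cvgM; [exact: cvg_cst|exact: cxc].
    - by move=> x; apply: is_derive_eq; rewrite /W /GRing.scale/=; ring.
    - exact: poly_growthXM.
    - by apply: poly_growthD => //; exact: poly_growthZ.
  rewrite expr1n mul1r RintegralD//; last exact: integrableRZl.
  by rewrite RintegralZl.
pose q (t : R) := expR (ln (1 + 4 * t ^+ 2) / 4).
pose u (t : R) := (c t * cos (chi_phase t) - d t * sin (chi_phase t)) * q t.
pose v (t : R) := (c t * sin (chi_phase t) + d t * cos (chi_phase t)) * q t.
have q0 (t' : R) : 0 < 1 + 4 * t' ^+ 2 by rewrite ltr_pwDl// mulr_ge0// sqr_ge0.
have AS t' : A t' = (c t' - 2 * t' * d t') / (1 + 4 * t' ^+ 2).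
  apply: (canRL (mulfK (lt0r_neq0 (q0 t')))); have := AE t'; rewrite BE; lra.
have BS t' : B t' = (d t' + 2 * t' * c t') / (1 + 4 * t' ^+ 2).
  apply: (canRL (mulfK (lt0r_neq0 (q0 t')))); have := BE t'; rewrite AE; lra.
have uE : u t = u 0.
  apply: is_derive_0_is_cst => a; have ? := dc a; have ? := dd a.
  have ? := is_derive_chi_phase a; have ? := is_derive_ln_sqr a.
  apply: is_derive_eq; rewrite /GRing.scale/= -/(q a) AS BS; field.
  by rewrite gt_eqF.
have vE : v t = v 0.
  apply: is_derive_0_is_cst => a; have ? := dc a; have ? := dd a.
  have ? := is_derive_chi_phase a; have ? := is_derive_ln_sqr a.
  apply: is_derive_eq; rewrite /GRing.scale/= -/(q a) AS BS; field.
  by rewrite gt_eqF.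
have c0 : c 0 = 1.
  by rewrite /c; under eq_Rintegral do rewrite mul0r cos0; exact: Rintegral_cstT.
have d0 : d 0 = 0.
  by rewrite /d; under eq_Rintegral do rewrite mul0r sin0; exact: Rintegral_cstT.
have p0 : chi_phase 0 = 0 by rewrite /chi_phase mulr0 atan0 mul0r subr0.
have q00 : q 0 = 1 by rewrite /q expr0n/= mulr0 addr0 ln1 mul0r expR0.
rewrite /u c0 d0 p0 q00 cos0 sin0 in uE; rewrite /v c0 d0 p0 q00 cos0 sin0 in vE.
have qr : q t * chi_modulus t = 1 by rewrite /q /chi_modulus -expRD subrr expR0.
have cs := cos2Dsin2 (chi_phase t).
rewrite -/(c t) -/(d t).
move: uE vE qr cs; rewrite -/(c t) -/(d t).
move: (cos _) (sin _) (q t) (chi_modulus t) (c t) (d t) => C S Q r c' d' uE vE qr cs.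
have {}uE : c' * C - d' * S = r.
  rewrite -[LHS]mulr1 -qr mulrA uE; ring.
have {}vE : c' * S + d' * C = 0.
  by rewrite -[LHS]mulr1 -qr mulrA vE; ring.
split.
- transitivity (c' * (C ^+ 2 + S ^+ 2)); first by rewrite cs mulr1.
  by rewrite -uE; transitivity (c' * (C ^+ 2 + S ^+ 2) - S * (c' * S + d' * C));
    [rewrite vE; ring|ring].
- transitivity (d' * (C ^+ 2 + S ^+ 2)); first by rewrite cs mulr1.
  by rewrite -uE; transitivity (d' * (C ^+ 2 + S ^+ 2) - C * (c' * S + d' * C));
    [rewrite vE; ring|ring].
Qed.

End chi_square.

Section weighted_chi_square.
Context {R : realType}.
Implicit Type ls : seq R.

Definition wcs_mean ls : R := \sum_(l <- ls) l.
Definition wcs_var ls : R := 2 * \sum_(l <- ls) l ^+ 2.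
Definition wcs_phase ls (t : R) : R := \sum_(l <- ls) chi_phase (t * l).
Definition wcs_modulus ls (t : R) : R := \prod_(l <- ls) chi_modulus (t * l).
Definition wcs_laplace ls (c : R) : R := \prod_(l <- ls) (Num.sqrt (1 + 2 * c * l))^-1.

(** Properties of the law of [\sum_j l_j g_j ^ 2], where the [g_j] are independent
    standard normal variables. The [g_j] do not appear, so that these properties pass
    to every nonnegative random variable with the same law. *)
Record weighted_chi_square ls d (T : measurableType d) (P : probability T R)
    (X : T -> R) : Prop := WeightedChiSquare {
  wcs_measurable : measurable_fun [set: T] X ;
  wcs_ge0 : forall w, 0 <= X w ;
  wcs_laplaceE : forall c : R, 0 <= c ->
    \int[P]_w expR (- (c * X w)) = wcs_laplace ls c ;
  wcs_cosE : forall t, \int[P]_w cos (t * (X w - wcs_mean ls)) =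
    wcs_modulus ls t * cos (wcs_phase ls t) ;
  wcs_sinE : forall t, \int[P]_w sin (t * (X w - wcs_mean ls)) =
    - (wcs_modulus ls t * sin (wcs_phase ls t)) ;
  wcs_integrable4 :
    P.-integrable [set: T] (EFin \o (fun w => (X w - wcs_mean ls) ^+ 4)) ;
  wcs_moment1 : \int[P]_w (X w - wcs_mean ls) = 0 ;
  wcs_moment2 : \int[P]_w (X w - wcs_mean ls) ^+ 2 = wcs_var ls ;
  wcs_moment4 : \int[P]_w (X w - wcs_mean ls) ^+ 4 <= 15 * wcs_var ls ^+ 2 }.

Lemma integrable_lower_power d (T : measurableType d) (P : probability T R)
    (Y : T -> R) (k : nat) : (k <= 4)%N -> measurable_fun [set: T] Y ->
  P.-integrable [set: T] (EFin \o (fun w => Y w ^+ 4)) ->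
  P.-integrable [set: T] (EFin \o (fun w => Y w ^+ k)).
Proof.
move=> k4 mY iY.
apply: (@dominated_integrableR _ _ _ _ _ (fun w => 1 + Y w ^+ 4)).
- exact: measurable_funX.
- apply: integrableRD => //; apply: (@bounded_integrable _ _ _ _ _ 1) => // x.
  by rewrite normr1.
- move=> w; rewrite normrX; have -> : Y w ^+ 4 = `|Y w| ^+ 4.
    by rewrite -normrX ger0_norm// -[4%N]/(2 * 2)%N exprM sqr_ge0.
  have := normr_ge0 (Y w); move: `|Y w| => y y0.
  have [y1|/ltW y1] := leP y 1.
    by rewrite (@le_trans _ _ 1)// ?exprn_ile1// lerDl exprn_ge0.
  by rewrite (@le_trans _ _ (y ^+ 4))// ?ler_weXn2l// lerDr.
Qed.

Lemma weighted_chi_square_nil d (T : measurableType d) (P : probability T R) :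
  weighted_chi_square [::] P (fun=> 0).
Proof.
have m0 : wcs_mean [::] = 0 by rewrite /wcs_mean big_nil.
have v0 : wcs_var [::] = 0 by rewrite /wcs_var big_nil mulr0.
split => //.
- move=> c c0; rewrite /wcs_laplace big_nil.
  under eq_Rintegral do rewrite mulr0 oppr0 expR0.
  exact: Rintegral_cstT.
- move=> t; rewrite /wcs_modulus /wcs_phase !big_nil m0 cos0 mulr1.
  under eq_Rintegral do rewrite subr0 mulr0 cos0.
  exact: Rintegral_cstT.
- move=> t; under eq_Rintegral do rewrite m0 subr0 mulr0 sin0.
  by rewrite Rintegral_cstT /wcs_phase big_nil sin0 mulr0 oppr0.
- rewrite m0; apply: (@bounded_integrable _ _ _ _ _ 0) => // x.
  by rewrite subr0 expr0n/= normr0.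
- by under eq_Rintegral do rewrite m0 subr0; exact: Rintegral_cstT.
- by under eq_Rintegral do rewrite m0 subr0 expr0n/=; rewrite v0; exact: Rintegral_cstT.
- under eq_Rintegral do rewrite m0 subr0 expr0n/=.
  by rewrite Rintegral_cstT v0 expr0n/= mulr0.
Qed.

(** An independent summand multiplies the transforms. For the fourth moment, with
    variances [a] and [b], the mixed term is [6 a b], and
    [15 a ^ 2 + 6 a b + 15 b ^ 2 <= 15 (a + b) ^ 2]. *)
Lemma weighted_chi_square_cons (l : R) ls d (T : measurableType d)
    (P : probability T R) (X : T -> R) : 0 <= l ->
  weighted_chi_square ls P X ->
  weighted_chi_square (l :: ls) (P \x normal_prob (0 : R) 1)%E
    (fun z => X z.1 + l * z.2 ^+ 2).
Proof.
move=> l0 [mX X0 lapX cosX sinX i4X e1X e2X e4X].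
set N := normal_prob (0 : R) 1.
pose m := wcs_mean ls.
have mE : wcs_mean (l :: ls) = m + l by rewrite /wcs_mean big_cons addrC.
have vE : wcs_var (l :: ls) = wcs_var ls + 2 * l ^+ 2.
  by rewrite /wcs_var big_cons; ring.
pose A w := X w - m; pose B (y : R) := l * (y ^+ 2 - 1).
have mA : measurable_fun [set: T] A by exact: measurable_funB.
have mB : measurable_fun [set: R] B.
  by apply: measurable_funM => //; apply: measurable_funB => //; exact: measurable_funX.
have ABE z : X z.1 + l * z.2 ^+ 2 - wcs_mean (l :: ls) = A z.1 + B z.2.
  by rewrite mE /A /B; ring.
have iA k : (k <= 4)%N -> P.-integrable [set: T] (EFin \o (fun w => A w ^+ k)).
  by move=> k4; exact: integrable_lower_power.
have i4W : N.-integrable [set: R] (EFin \o (fun y : R => (y ^+ 2 - 1) ^+ 4)).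
  apply: integrable_poly_growth => //.
    by apply: measurable_funX; apply: measurable_funB => //; exact: measurable_funX.
  exists 1, 4%N; split=> // x; rewrite mul1r normrX lerXn2r// ?nnegrE//.
    by rewrite addr_ge0// sqr_ge0.
  by rewrite ler_norml; have := sqr_ge0 x => ?; apply/andP; split; lra.
have iB k : (k <= 4)%N -> N.-integrable [set: R] (EFin \o (fun y => B y ^+ k)).
  move=> k4; apply: integrable_lower_power => //.
  under eq_fun do rewrite exprMn.
  exact: integrableRZl.
have [w1 w2 w4] := @centered_square_moments R.
have mW : measurable_fun [set: R] (fun y : R => y ^+ 2 - 1).
  by apply: measurable_funB => //; exact: measurable_funX.
have iW k : (k <= 4)%N -> N.-integrable [set: R] (EFin \o (fun y : R => (y ^+ 2 - 1) ^+ k)).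
  by move=> k4; exact: integrable_lower_power.
have EB1 : \int[N]_y B y ^+ 1 = 0.
  under eq_Rintegral do rewrite expr1.
  by rewrite RintegralZl// ?w1 ?mulr0//; exact: (iW 1%N).
have EB2 : \int[N]_y B y ^+ 2 = 2 * l ^+ 2.
  under eq_Rintegral do rewrite exprMn.
  by rewrite RintegralZl// ?w2 1?mulrC//; exact: (iW 2%N).
have EB4 : \int[N]_y B y ^+ 4 = 60 * l ^+ 4.
  under eq_Rintegral do rewrite exprMn.
  by rewrite RintegralZl// ?w4 1?mulrC//; exact: (iW 4%N).
have EA1 : \int[P]_w A w ^+ 1 = 0 by under eq_Rintegral do rewrite expr1.
have EA0 : \int[P]_w A w ^+ 0 = 1.
  by under eq_Rintegral do rewrite expr0; exact: Rintegral_cstT.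
have EB0 : \int[N]_y B y ^+ 0 = 1.
  by under eq_Rintegral do rewrite expr0; exact: Rintegral_cstT.
have iAB i j : (i <= 4)%N -> (j <= 4)%N ->
    (P \x N)%E.-integrable [set: T * R] (EFin \o (fun z => A z.1 ^+ i * B z.2 ^+ j)).
  by move=> i4 j4; exact: (integrable_prod_mul (iA _ i4) (iB _ j4)).
have EAB i j : (i <= 4)%N -> (j <= 4)%N ->
    \int[(P \x N)%E]_z (A z.1 ^+ i * B z.2 ^+ j) =
    \int[P]_w A w ^+ i * \int[N]_y B y ^+ j.
  by move=> i4 j4; exact: (Rintegral_prod_mul (iA _ i4) (iB _ j4)).
have iABZ c i j : (i <= 4)%N -> (j <= 4)%N ->
    (P \x N)%E.-integrable [set: T * R]
      (EFin \o (fun z => c * (A z.1 ^+ i * B z.2 ^+ j))).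
  by move=> i4 j4; apply: integrableRZl; exact: iAB.
have iAct t : P.-integrable [set: T] (EFin \o (fun w => cos (t * A w))).
  apply: (@bounded_integrable _ _ _ _ _ 1); last by move=> x; exact: cos_norm_le1.
  by apply: measurableT_comp; [exact: measurable_cosR|exact: measurable_funM].
have iAst t : P.-integrable [set: T] (EFin \o (fun w => sin (t * A w))).
  apply: (@bounded_integrable _ _ _ _ _ 1); last by move=> x; exact: sin_norm_le1.
  by apply: measurableT_comp; [exact: measurable_sinR|exact: measurable_funM].
have iBct t : N.-integrable [set: R] (EFin \o (fun w => cos (t * B w))).
  apply: (@bounded_integrable _ _ _ _ _ 1); last by move=> x; exact: cos_norm_le1.
  by apply: measurableT_comp; [exact: measurable_cosR|exact: measurable_funM].
have iBst t : N.-integrable [set: R] (EFin \o (fun w => sin (t * B w))).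
  apply: (@bounded_integrable _ _ _ _ _ 1); last by move=> x; exact: sin_norm_le1.
  by apply: measurableT_comp; [exact: measurable_sinR|exact: measurable_funM].
have cosB t : \int[N]_y cos (t * B y) = chi_modulus (t * l) * cos (chi_phase (t * l)).
  by rewrite -(chi_square_cf _).1; apply: eq_Rintegral => y _; rewrite mulrA.
have sinB t : \int[N]_y sin (t * B y) = - (chi_modulus (t * l) * sin (chi_phase (t * l))).
  by rewrite -(chi_square_cf _).2; apply: eq_Rintegral => y _; rewrite mulrA.
have m1 : measurable_fun [set: T * R] (X \o fst) by exact: measurableT_comp.
have phE t : wcs_phase (l :: ls) t = wcs_phase ls t + chi_phase (t * l).
  by rewrite /wcs_phase big_cons addrC.
have moE t : wcs_modulus (l :: ls) t = wcs_modulus ls t * chi_modulus (t * l).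
  by rewrite /wcs_modulus big_cons mulrC.
have i2 := integrableRD (iAB 4%N 0%N isT isT) (iABZ 4 3%N 1%N isT isT).
have i3 := integrableRD i2 (iABZ 6 2%N 2%N isT isT).
have i4 := integrableRD i3 (iABZ 4 1%N 3%N isT isT).
have i5 := integrableRD i4 (iAB 0%N 4%N isT isT).
split.
- apply: measurable_funD => //.
  by apply: measurable_funM => //; apply: measurable_funX; exact: measurable_snd.
- by move=> w; rewrite addr_ge0// mulr_ge0// sqr_ge0.
- move=> c c0.
  have iu : P.-integrable [set: T] (EFin \o (fun w => expR (- (c * X w)))).
    apply: (@bounded_integrable _ _ _ _ _ 1).
      by apply: measurableT_comp => //; apply: measurableT_comp => //; exact: measurable_funM.
    move=> x; rewrite ger0_norm ?expR_ge0// -expR0 ler_expR oppr_le0.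
    by rewrite mulr_ge0.
  have iv : N.-integrable [set: R] (EFin \o (fun y => expR (- ((c * l) * y ^+ 2)))).
    apply: (@bounded_integrable _ _ _ _ _ 1).
      apply: measurableT_comp => //; apply: measurableT_comp => //.
      by apply: measurable_funM => //; exact: measurable_funX.
    move=> x; rewrite ger0_norm ?expR_ge0// -expR0 ler_expR oppr_le0.
    by rewrite mulr_ge0 ?sqr_ge0 ?mulr_ge0.
  under eq_Rintegral => z _.
    rewrite (_ : - _ = - (c * X z.1) + - ((c * l) * z.2 ^+ 2)); last by ring.
    rewrite expRD; over.
  rewrite (Rintegral_prod_mul iu iv) lapX// Rintegral_normal_expR_sqr ?mulr_ge0//.
  by rewrite /wcs_laplace big_cons mulrC expr1n mulr1 mulrA.
- move=> t; under eq_Rintegral do rewrite ABE mulrDr cosD.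
  have icc := integrable_prod_mul (iAct t) (iBct t).
  have iss := integrable_prod_mul (iAst t) (iBst t).
  rewrite RintegralB// (Rintegral_prod_mul (iAct t) (iBct t)).
  rewrite (Rintegral_prod_mul (iAst t) (iBst t)) cosX sinX cosB sinB phE moE cosD; ring.
- move=> t; under eq_Rintegral do rewrite ABE mulrDr sinD.
  have isc := integrable_prod_mul (iAst t) (iBct t).
  have ics := integrable_prod_mul (iAct t) (iBst t).
  rewrite RintegralD// (Rintegral_prod_mul (iAst t) (iBct t)).
  rewrite (Rintegral_prod_mul (iAct t) (iBst t)) cosX sinX cosB sinB phE moE sinD; ring.
- rewrite (_ : _ \o _ = EFin \o (fun z => A z.1 ^+ 4 * B z.2 ^+ 0 +
      4 * (A z.1 ^+ 3 * B z.2 ^+ 1) + 6 * (A z.1 ^+ 2 * B z.2 ^+ 2) +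
      4 * (A z.1 ^+ 1 * B z.2 ^+ 3) + A z.1 ^+ 0 * B z.2 ^+ 4)); last first.
    by apply/funext => z /=; rewrite ABE; congr EFin; ring.
  exact: i5.
- under eq_Rintegral => z _.
    rewrite ABE (_ : _ + _ = A z.1 ^+ 1 * B z.2 ^+ 0 + A z.1 ^+ 0 * B z.2 ^+ 1);
      last by ring.
    over.
  by rewrite RintegralD ?iAB// !EAB// EA1 EB1 EA0 EB0; ring.
- under eq_Rintegral => z _.
    rewrite ABE (_ : _ ^+ 2 = A z.1 ^+ 2 * B z.2 ^+ 0 +
      2 * (A z.1 ^+ 1 * B z.2 ^+ 1) + A z.1 ^+ 0 * B z.2 ^+ 2); last by ring.
    over.
  have i2' := integrableRD (iAB 2%N 0%N isT isT) (iABZ 2 1%N 1%N isT isT).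
  rewrite (RintegralD measurableT i2') ?iAB// RintegralD ?iAB ?iABZ//.
  rewrite (RintegralZl 2 measurableT (iAB 1%N 1%N isT isT)).
  by rewrite !EAB// e2X EB0 EA1 EB1 EA0 EB2 vE; ring.
- under eq_Rintegral => z _.
    rewrite ABE (_ : _ ^+ 4 = A z.1 ^+ 4 * B z.2 ^+ 0 +
      4 * (A z.1 ^+ 3 * B z.2 ^+ 1) + 6 * (A z.1 ^+ 2 * B z.2 ^+ 2) +
      4 * (A z.1 ^+ 1 * B z.2 ^+ 3) + A z.1 ^+ 0 * B z.2 ^+ 4); last by ring.
    over.
  rewrite (RintegralD measurableT i4) ?iAB// (RintegralD measurableT i3) ?iABZ//.
  rewrite (RintegralD measurableT i2) ?iABZ// RintegralD ?iAB ?iABZ//.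
  rewrite (RintegralZl 4 measurableT (iAB 3%N 1%N isT isT)).
  rewrite (RintegralZl 6 measurableT (iAB 2%N 2%N isT isT)).
  rewrite (RintegralZl 4 measurableT (iAB 1%N 3%N isT isT)).
  rewrite !EAB// EB0 EB1 EA1 e2X EB2 EA0 EB4 vE.
  have v0 : 0 <= wcs_var ls.
    by rewrite mulr_ge0// sumr_ge0// => x _; rewrite sqr_ge0.
  have := e4X; rewrite -/(A _); have := sqr_ge0 l; move: (wcs_var ls) v0 => v v0.
  rewrite (_ : l ^+ 4 = (l ^+ 2) ^+ 2); last by rewrite -exprM.
  move: (l ^+ 2) => L L0; nra.
Qed.

Lemma weighted_chi_square_exists ls : (forall l, l \in ls -> 0 <= l) ->
  exists d (T : measurableType d) (P : probability T R) (X : T -> R),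
    weighted_chi_square ls P X.
Proof.
elim: ls => [|l ls IH] ls0.
  by exists _, _, (normal_prob (0 : R) 1), (fun=> 0); exact: weighted_chi_square_nil.
have [|d [T [P [X XE]]]] := IH.
  by move=> x xls; apply: ls0; rewrite inE xls orbT.
exists _, _, (P \x normal_prob (0 : R) 1)%E, (fun z => X z.1 + l * z.2 ^+ 2).
apply: weighted_chi_square_cons => //; first by apply: ls0; rewrite mem_head.
Qed.

End weighted_chi_square.

(** * A law on the half-line is determined by its Laplace transform *)

Section bernstein.
Context {R : realType}.

(** The Bernstein polynomial [\sum_k 'C(n, k) f k x ^ k (1 - x) ^ (n - k)], through
    the recursion obtained by conditioning a binomial variable on its last trial. *)
Fixpoint bernstein (n : nat) (f : nat -> R) : {poly R} :=
  if n is m.+1 then 'X * bernstein m (f \o S) + (1 - 'X) * bernstein m f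
  else (f 0%N)%:P.

Lemma bernsteinS n f x : (bernstein n.+1 f).[x] =
  x * (bernstein n (f \o S)).[x] + (1 - x) * (bernstein n f).[x].
Proof. by rewrite /= !hornerE. Qed.

Lemma bernstein_le n f g x : 0 <= x <= 1 -> (forall k, (k <= n)%N -> f k <= g k) ->
  (bernstein n f).[x] <= (bernstein n g).[x].
Proof.
move=> /andP[x0 x1]; elim: n f g => [|n IH] f g fg.
  by rewrite /= !hornerE; exact: fg.
rewrite !bernsteinS lerD// ler_wpM2l ?subr_ge0//.
  by apply: IH => k kn; exact: fg.
by apply: IH => k kn; apply: fg; exact: leqW.
Qed.

Lemma bernsteinD n f g x : (bernstein n (fun k => f k + g k)).[x] =
  (bernstein n f).[x] + (bernstein n g).[x].
Proof.
elim: n f g => [|n IH] f g; first by rewrite /= !hornerE.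
by rewrite !bernsteinS !(IH (f \o S) (g \o S)) IH; ring.
Qed.

Lemma bernsteinZ n c f x : (bernstein n (fun k => c * f k)).[x] =
  c * (bernstein n f).[x].
Proof.
elim: n f => [|n IH] f; first by rewrite /= !hornerE.
by rewrite !bernsteinS !(IH (f \o S)) IH; ring.
Qed.

Lemma bernstein_cst n c x : (bernstein n (fun=> c)).[x] = c.
Proof.
elim: n => [|n IH]; first by rewrite /= hornerE.
by rewrite bernsteinS !IH; ring.
Qed.

(** The variance [n x (1 - x)] of a binomial variable. The shift [a] is there for the
    induction, since conditioning on the last trial moves the centre. *)
Lemma bernstein_variance n x a : (bernstein n (fun k => (k%:R - n%:R * x + a) ^+ 2)).[x]
  = n%:R * (x * (1 - x)) + a ^+ 2.
Proof.
elim: n a => [|n IH] a; first by rewrite /= !hornerE; ring.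
rewrite bernsteinS.
have -> : (fun k => (k%:R - n.+1%:R * x + a) ^+ 2) \o S =
    (fun k => (k%:R - n%:R * x + (a + 1 - x)) ^+ 2).
  by apply/funext => k /=; rewrite -!natr1; ring.
have -> : (fun k => (k%:R - n.+1%:R * x + a) ^+ 2) =
    (fun k => (k%:R - n%:R * x + (a - x)) ^+ 2).
  by apply/funext => k /=; rewrite -!natr1; ring.
by rewrite !IH -!natr1; ring.
Qed.

(** Chebyshev's inequality turned into uniform approximation: a Lipschitz function
    moves by at most [L * (e + u ^ 2 / e)] over a distance [u]. *)
Lemma bernstein_approx (h : R -> R) (L e : R) n x : 0 <= L -> 0 < e ->
  0 <= x <= 1 -> (forall u v, `|h u - h v| <= L * `|u - v|) ->
  `|(bernstein n.+1 (fun k => h (k%:R / n.+1%:R))).[x] - h x| <=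
  L * (e + (e * n.+1%:R)^-1).
Proof.
move=> L0 e0 x01 hL.
have n0 : 0 < n.+1%:R :> R by [].
pose c := L / (e * n.+1%:R ^+ 2).
have c0 : 0 <= c by rewrite divr_ge0// mulr_ge0 ?exprn_ge0// ltW.
have key k : `|h (k%:R / n.+1%:R) - h x| <= c * (k%:R - n.+1%:R * x + 0) ^+ 2 + L * e.
  apply: (le_trans (hL _ _)).
  have -> : k%:R / n.+1%:R - x = (k%:R - n.+1%:R * x) / n.+1%:R.
    by field; rewrite gt_eqF.
  rewrite addr0 /c.
  set u := (k%:R - n.+1%:R * x).
  have -> : L / (e * n.+1%:R ^+ 2) * u ^+ 2 + L * e =
      L * ((u / n.+1%:R) ^+ 2 / e + e).
    by field; rewrite !gt_eqF.
  apply: ler_wpM2l => //; move: (u / _) => v.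
  rewrite -(ler_pM2r e0) mulrDl divfK ?gt_eqF// -(real_normK (num_real v)).
  by have := sqr_ge0 (`|v| - e); have := normr_ge0 v; nra.
have up : (bernstein n.+1 (fun k => h (k%:R / n.+1%:R))).[x] - h x <=
    c * (n.+1%:R * (x * (1 - x))) + L * e.
  rewrite lerBlDr.
  have := @bernstein_le n.+1 _ (fun k => c * (k%:R - n.+1%:R * x + 0) ^+ 2 + (L * e + h x)) x x01.
  rewrite bernsteinD bernsteinZ bernstein_cst bernstein_variance expr0n addr0 addrA; apply.
  move=> k _; have := key k; rewrite ler_norml => /andP[_]; lra.
have lo : - (c * (n.+1%:R * (x * (1 - x))) + L * e) <=
    (bernstein n.+1 (fun k => h (k%:R / n.+1%:R))).[x] - h x.
  rewrite lerBrDr.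
  have := @bernstein_le n.+1 (fun k => (- c) * (k%:R - n.+1%:R * x + 0) ^+ 2 +
    (- (L * e) + h x)) (fun k => h (k%:R / n.+1%:R)) x x01.
  rewrite bernsteinD bernsteinZ bernstein_cst bernstein_variance expr0n addr0 addrA.
  rewrite mulNr opprD; apply.
  by move=> k _; have := key k; rewrite ler_norml => /andP[+ _]; lra.
have bd : c * (n.+1%:R * (x * (1 - x))) + L * e <= L * (e + (e * n.+1%:R)^-1).
  have -> : c * (n.+1%:R * (x * (1 - x))) = L * (e * n.+1%:R)^-1 * (x * (1 - x)).
    by rewrite /c; field; rewrite !gt_eqF.
  have q0 : 0 <= L * (e * n.+1%:R)^-1 by rewrite mulr_ge0// invr_ge0 mulr_ge0// ltW.
  have : L * (e * n.+1%:R)^-1 * (x * (1 - x)) <= L * (e * n.+1%:R)^-1.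
    by rewrite ler_piMr//; case/andP: x01 => ? ?; nra.
  by move=> hq; rewrite [leRHS]mulrDr addrC lerD2l.
by rewrite ler_norml (le_trans _ lo) ?lerN2// (le_trans up bd).
Qed.

End bernstein.

Section laplace_uniqueness.
Context {R : realType}.

Definition same_law d1 (T1 : measurableType d1) (P1 : probability T1 R)
    (X1 : T1 -> R) d2 (T2 : measurableType d2) (P2 : probability T2 R)
    (X2 : T2 -> R) : Prop :=
  forall A : set R, measurable A -> P1 (X1 @^-1` A) = P2 (X2 @^-1` A).

Section two_variables.
Context d1 (T1 : measurableType d1) (P1 : probability T1 R)
  d2 (T2 : measurableType d2) (P2 : probability T2 R).
Variables (X1 : T1 -> R) (X2 : T2 -> R).
Hypotheses (mX1 : measurable_fun [set: T1] X1) (mX2 : measurable_fun [set: T2] X2).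

Lemma same_law_tails : (forall a, P1 [set w | a < X1 w] = P2 [set w | a < X2 w]) ->
  same_law P1 X1 P2 X2.
Proof.
move=> tails A mA.
pose X1' : {mfun T1 >-> R} := HB.pack X1 (isMeasurableFun.Build _ _ _ _ _ mX1).
pose X2' : {mfun T2 >-> R} := HB.pack X2 (isMeasurableFun.Build _ _ _ _ _ mX2).
apply: (measure_unique (@RGenOInfty.G R) (fun k => `]- k%:R, +oo[%classic)
  _ _ _ _ (pushforward P1 X1') (pushforward P2 X2')) => //.
- exact: RGenOInfty.measurableE.
- move=> _ _ [x ->] [y ->]; exists (Num.max x y).
  apply/seteqP; split=> z /=; rewrite !in_itv/= !andbT gt_max.
    by move=> [-> ->].
  by move=> /andP[].
- by move=> k; exists (- k%:R).
- apply/seteqP; split=> // x _; exists (Num.truncn `|x|).+1 => //=.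
  rewrite in_itv/= andbT; have := truncnS_gt `|x|; have := ler_norm (- x).
  by rewrite normrN; lra.
- move=> _ [x ->]; rewrite /pushforward.
  have E d (T : measurableType d) (X : T -> R) :
      X @^-1` `]x, +oo[%classic = [set w | x < X w].
    by apply/seteqP; split=> w /=; rewrite in_itv/= andbT.
  by have := tails x; rewrite -!E.
- move=> k; rewrite /pushforward (le_lt_trans (probability_le1 _ _)) ?ltry//.
  by rewrite -[X in measurable X]setTI; exact: mX1.
Qed.

Lemma same_law_Rintegral (f : R -> R) : same_law P1 X1 P2 X2 ->
  measurable_fun [set: R] f ->
  P1.-integrable [set: T1] (EFin \o (f \o X1)) ->
  P2.-integrable [set: T2] (EFin \o (f \o X2)) /\
  \int[P1]_w f (X1 w) = \int[P2]_w f (X2 w).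
Proof.
move=> X12 mf if1.
pose X1' : {mfun T1 >-> R} := HB.pack X1 (isMeasurableFun.Build _ _ _ _ _ mX1).
pose X2' : {mfun T2 >-> R} := HB.pack X2 (isMeasurableFun.Build _ _ _ _ _ mX2).
have mfE : measurable_fun [set: R] (EFin \o f) by exact/measurable_EFinP.
have ge0E (g : R -> \bar R) : (forall x, 0 <= g x)%E -> measurable_fun [set: R] g ->
    (\int[P1]_w g (X1 w) = \int[P2]_w g (X2 w))%E.
  move=> g0 mg.
  transitivity (\int[pushforward P1 X1']_x g x)%E.
    by rewrite ge0_integral_pushforward.
  transitivity (\int[pushforward P2 X2']_x g x)%E.
    by apply: eq_measure_integral => A mA _; exact: X12.
  by rewrite ge0_integral_pushforward.
have if2 : P2.-integrable [set: T2] (EFin \o (f \o X2)).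
  apply/integrableP; split; first by apply/measurable_EFinP; exact: measurableT_comp.
  have /integrableP[_] := if1; rewrite /= (ge0E (fun x => `|(f x)%:E|%E))//.
  exact: measurableT_comp.
split=> //; congr fine.
rewrite integralE [RHS]integralE; congr (_ - _)%E.
  under eq_integral do rewrite funeposE.
  under [in RHS]eq_integral do rewrite funeposE.
  apply: (ge0E (fun x => maxe (f x)%:E 0)) => [x|].
    by rewrite le_max lexx orbT.
  by apply: measurable_maxe.
under eq_integral do rewrite funenegE.
under [in RHS]eq_integral do rewrite funenegE.
apply: (ge0E (fun x => maxe (- (f x)%:E)%E 0)) => [x|].
  by rewrite le_max lexx orbT.
by apply: measurable_maxe => //; exact: measurableT_comp.
Qed.

End two_variables.

Section from_laplace.
Context d1 (T1 : measurableType d1) (P1 : probability T1 R)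
  d2 (T2 : measurableType d2) (P2 : probability T2 R).
Variables (X1 : T1 -> R) (X2 : T2 -> R).
Hypotheses (mX1 : measurable_fun [set: T1] X1) (mX2 : measurable_fun [set: T2] X2).
Hypotheses (X10 : forall w, 0 <= X1 w) (X20 : forall w, 0 <= X2 w).

Let expX d (T : measurableType d) (X : T -> R) (X0 : forall w, 0 <= X w) w :
  0 <= expR (- X w) <= 1.
Proof. by rewrite expR_ge0 -[leRHS]expR0 ler_expR oppr_le0 X0. Qed.

Lemma integrable_poly_exp d (T : measurableType d) (P : probability T R)
    (X : T -> R) (p : {poly R}) : measurable_fun [set: T] X ->
  (forall w, 0 <= X w) ->
  P.-integrable [set: T] (EFin \o (fun w => p.[expR (- X w)])).
Proof.
move=> mX X0.
have mE : measurable_fun [set: T] (fun w => expR (- X w)).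
  by apply: measurableT_comp => //; exact: measurableT_comp.
elim/poly_ind: p => [|p c IH].
  under eq_fun do rewrite horner0.
  by apply: (@bounded_integrable _ _ _ _ _ 0) => // x; rewrite normr0.
under eq_fun do rewrite hornerMXaddC.
apply: integrableRD; last first.
  by apply: (@bounded_integrable _ _ _ _ _ `|c|).
apply: (@dominated_integrableR _ _ _ _ _ (fun w => `|p.[expR (- X w)]|)).
- by apply: measurable_funM => //; exact: integrable_measurableR IH.
- exact: integrable_norm IH.
- move=> w; rewrite normrM ler_piMr//.
  by have /andP[? ?] := expX X0 w; rewrite ger0_norm.
Qed.

Hypothesis laplaceE : forall n : nat,
  \int[P1]_w expR (- (n%:R * X1 w)) = \int[P2]_w expR (- (n%:R * X2 w)).

Let integral_poly_exp_Xn (p : {poly R}) n :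
  \int[P1]_w (p * 'X^n).[expR (- X1 w)] = \int[P2]_w (p * 'X^n).[expR (- X2 w)].
Proof.
elim/poly_ind: p n => [|p c IH] n.
  under eq_Rintegral do rewrite mul0r horner0.
  under [in RHS]eq_Rintegral do rewrite mul0r horner0.
  by rewrite !Rintegral_cstT.
have E x : ((p * 'X + c%:P) * 'X^n).[x] = (p * 'X^(n.+1)).[x] + c * x ^+ n.
  by rewrite !hornerE exprS; ring.
have XnE x : expR (- x) ^+ n = expR (- (n%:R * x)) :> R.
  by rewrite -expRM_natl mulrN.
under eq_Rintegral do rewrite E.
under [in RHS]eq_Rintegral do rewrite E.
have iX d (T : measurableType d) (P : probability T R) (X : T -> R) :
    measurable_fun [set: T] X -> (forall w, 0 <= X w) ->
    P.-integrable [set: T] (EFin \o (fun w => expR (- X w) ^+ n)).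
  move=> mX X0; have := integrable_poly_exp P ('X^n) mX X0.
  by under eq_fun do rewrite hornerXn.
rewrite !RintegralD//; try exact: integrable_poly_exp; try by apply: integrableRZl; exact: iX.
rewrite IH !RintegralZl; try exact: iX; try by [].
congr (_ + _ * _).
under eq_Rintegral do rewrite XnE.
by under [in RHS]eq_Rintegral do rewrite XnE.
Qed.

Lemma integral_poly_exp (p : {poly R}) :
  \int[P1]_w p.[expR (- X1 w)] = \int[P2]_w p.[expR (- X2 w)].
Proof. by have := integral_poly_exp_Xn p 0; rewrite expr0 mulr1. Qed.

Lemma integral_lipschitz_exp (h : R -> R) (L M : R) : 0 <= L ->
  measurable_fun [set: R] h -> (forall x, `|h x| <= M) ->
  (forall u v, `|h u - h v| <= L * `|u - v|) ->
  \int[P1]_w h (expR (- X1 w)) = \int[P2]_w h (expR (- X2 w)).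
Proof.
move=> L0 mh hM hL.
have mE d (T : measurableType d) (X : T -> R) : measurable_fun [set: T] X ->
    measurable_fun [set: T] (fun w => expR (- X w)).
  by move=> mX; apply: measurableT_comp => //; exact: measurableT_comp.
have bound (e : R) n d (T : measurableType d) (P : probability T R) (X : T -> R) :
    0 < e -> measurable_fun [set: T] X -> (forall w, 0 <= X w) ->
    `|\int[P]_w (bernstein n.+1 (fun k => h (k%:R / n.+1%:R))).[expR (- X w)]
      - \int[P]_w h (expR (- X w))| <= L * (e + (e * n.+1%:R)^-1).
  move=> e0 mX X0.
  have ih : P.-integrable [set: T] (EFin \o (fun w => h (expR (- X w)))).
    apply: (@bounded_integrable _ _ _ _ _ M) => [|x]; last exact: hM.
    by apply: measurableT_comp => //; exact: mE.
  have ip := integrable_poly_exp P (bernstein n.+1 (fun k => h (k%:R / n.+1%:R))) mX X0.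
  rewrite -RintegralB//; apply: (le_trans (le_normr_Rintegral measurableT (integrableRB ip ih))).
  rewrite -[leRHS](Rintegral_cstT P); apply: le_Rintegral => //.
  - exact: (integrable_norm (integrableRB ip ih)).
  - by apply: (@bounded_integrable _ _ _ _ _ `|L * (e + (e * n.+1%:R)^-1)|).
  - by move=> w _; apply: bernstein_approx => //; exact: expX.
have key (e : R) : 0 < e ->
    `|\int[P1]_w h (expR (- X1 w)) - \int[P2]_w h (expR (- X2 w))| <= 0 + (4 * L) * e.
  move=> e0; pose n := Num.truncn (e ^+ 2)^-1.
  have ne : (e * n.+1%:R)^-1 <= e.
    rewrite invfM ler_pdivrMr// -ler_pdivrMl//.
    by rewrite -invfM -expr2 ltW// truncnS_gt.
  have b1 := bound e n _ _ P1 _ e0 mX1 X10.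
  have := bound e n _ _ P2 _ e0 mX2 X20.
  rewrite -integral_poly_exp => b2.
  have LL : L * (e + (e * n.+1%:R)^-1) <= 2 * L * e.
    by move: ne; move: (e * n.+1%:R)^-1 => q ne; nra.
  move: b1 b2 LL; move: (L * (e + _)) (\int[P1]_w _) (\int[P2]_w _) (\int[P1]_w _).
  move=> U I1 I2 I3.
  by rewrite !ler_norml => /andP[? ?] /andP[? ?] ?; apply/andP; split; lra.
apply/eqP; rewrite -subr_eq0 -normr_le0; apply/ler_addgt0Pl => e e0.
have L1 : 0 < 4 * L + 1 by lra.
apply: (le_trans (key _ (divr_gt0 e0 L1))); rewrite add0r addr0.
by rewrite mulrCA ger_pMr// ler_pdivrMr//; lra.
Qed.

(** The variable [exp (- X)] takes its values in [0, 1], and the Laplace transform at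
    the integers gives its moments, hence the integrals of all polynomials in it. Bernstein
    approximation extends this to Lipschitz functions, and a monotone limit of these to
    the indicators of half-lines. *)
Lemma laplace_same_law : same_law P1 X1 P2 X2.
Proof.
apply: same_law_tails => // a.
pose b := expR (- a).
(* Lipschitz approximations of the indicator of y < b *)
pose h (k : nat) (y : R) : R := Num.min 1 (Num.max 0 (k%:R * (b - y))).
have h01 k y : 0 <= h k y <= 1.
  by rewrite /h ge_min lexx le_min ler01 le_max lexx.
have mh k : measurable_fun [set: R] (h k).
  apply: measurable_minr => //; apply: measurable_maxr => //.
  by apply: measurable_funM => //; exact: measurable_funB.
have hL k u v : `|h k u - h k v| <= k%:R * `|u - v|.
  rewrite -[k%:R in leRHS]ger0_norm// -normrM (distrC (h k u)).
  have -> : k%:R * (u - v) = k%:R * (b - v) - k%:R * (b - u) by ring.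
  rewrite /h; move: (k%:R * (b - v)) (k%:R * (b - u)) => s t.
  have st := ler_norm (s - t); have := ler_norm (t - s); rewrite (distrC t s) => ts.
  have clampP (r : R) : [\/ r <= 0 /\ Num.min 1 (Num.max 0 r) = 0,
      0 <= r /\ r <= 1 /\ Num.min 1 (Num.max 0 r) = r |
      1 <= r /\ Num.min 1 (Num.max 0 r) = 1].
    have [r0|/ltW r0] := leP r 0; first by constructor 1; rewrite min_r.
    have [r1|/ltW r1] := leP r 1; first by constructor 2.
    by constructor 3.
  rewrite ler_norml; move: st ts; move: `|s - t| => q st ts.
  case: (clampP s) => [[? ->]|[? [? ->]]|[? ->]];
    case: (clampP t) => [[? ->]|[? [? ->]]|[? ->]]; apply/andP; split; lra.
have mtail d (T : measurableType d) (X : T -> R) : measurable_fun [set: T] X ->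
    measurable [set w | a < X w].
  move=> mX; rewrite (_ : [set w | _] = X @^-1` `]a, +oo[%classic); last first.
    by apply/seteqP; split => w /=; rewrite in_itv/= andbT.
  by rewrite -[X in measurable X]setTI; exact: mX.
have limh d (T : measurableType d) (P : probability T R) (X : T -> R) :
    measurable_fun [set: T] X ->
    (fun k => \int[P]_w h k (expR (- X w))) @ \oo --> fine (P [set w | a < X w]).
  move=> mX.
  have mA := mtail _ _ _ mX.
  have -> : fine (P [set w | a < X w]) = \int[P]_w (\1_[set w | a < X w] w).
    by rewrite /Rintegral integral_indic// setIT.
  apply: (@Rintegral_dct _ _ _ _ _ _ (fun=> 1)).
  - move=> k; apply: measurableT_comp => //; apply: measurableT_comp => //.
    exact: measurableT_comp.
  - exact: measurable_indic.
  - by apply: (@bounded_integrable _ _ _ _ _ 1) => // x; rewrite normr1.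
  - by move=> k w; have /andP[? ?] := h01 k (expR (- X w)); rewrite ger0_norm.
  - move=> w; rewrite indicE; have [aX|Xa] := boolP (a < X w).
      rewrite mem_set//=.
      have yb : 0 < b - expR (- X w) by rewrite subr_gt0 ltr_expR ltrN2.
      apply: cvg_near_cst; near=> k.
      have kb : 1 <= k%:R * (b - expR (- X w)).
        rewrite -ler_pdivrMr// ?mul1r; near: k; exact: nbhs_infty_ger.
      by rewrite /h max_r ?min_l//; lra.
    rewrite memNset//=; last by apply/negP.
    apply: cvg_near_cst; near=> k; rewrite /h max_l ?min_r//.
    rewrite mulr_ge0_le0// subr_le0 ler_expR lerN2 leNgt.
    exact: Xa.
have hE k : \int[P1]_w h k (expR (- X1 w)) = \int[P2]_w h k (expR (- X2 w)).
  apply: (@integral_lipschitz_exp _ k%:R 1) => //.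
  by move=> x; have /andP[? ?] := h01 k x; rewrite ger0_norm.
have c1 := limh _ _ P1 _ mX1; have c2 := limh _ _ P2 _ mX2.
have {}c1 : (fun k => \int[P2]_w h k (expR (- X2 w))) @ \oo -->
    fine (P1 [set w | a < X1 w]) by under eq_fun do rewrite -hE.
have E := cvg_unique _ c1 c2.
have f1 := fin_num_measure P1 _ (mtail _ _ _ mX1).
have f2 := fin_num_measure P2 _ (mtail _ _ _ mX2).
by rewrite -(fineK f1) -(fineK f2) E.
Unshelve. all: by end_near. Qed.

End from_laplace.

End laplace_uniqueness.

(** * The median of a weighted chi-square variable is at most its mean *)

Section median.
Context {R : realType}.

Lemma is_derive_nonincreasing (f df : R -> R) (a b : R) : a <= b ->
  (forall x, a <= x <= b -> is_derive x 1 f (df x)) ->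
  (forall x, a < x < b -> df x <= 0) -> f b <= f a.
Proof.
rewrite le_eqVlt => /predU1P[-> //|ab] dF df0.
have [|||c] := @MVT R f df a b.
- exact: ab.
- by move=> x; rewrite in_itv/= => /andP[? ?]; apply: dF; rewrite !ltW.
- apply: continuous_in_subspaceT => x; rewrite inE/= in_itv/= => xab.
  apply: differentiable_continuous.
  by apply/derivable1_diffP; have [] := dF x xab.
rewrite in_itv/= => /df0 cab E; rewrite -subr_le0 E mulr_le0_ge0// subr_ge0 ltW//.
Qed.

Lemma oneBcos_le (x : R) : 0 <= x -> 1 - cos x <= x.
Proof.
move=> x0; rewrite lerBlDr -lerBlDl.
have := @is_derive_nonincreasing (fun x => - (cos x + x)) (fun x => - (- sin x + 1)) 0 x x0.
rewrite cos0 addr0 lerN2 => h; rewrite lerBlDl addrC; apply: h.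
- by move=> y _; have := sin_le1 y; lra.
Qed.

Lemma measurable_sgr : measurable_fun [set: R] (@Num.sg R).
Proof.
apply: nondecreasing_measurable => // x y xy.
by case: (sgrP x) => hx; case: (sgrP y) => hy; lra.
Qed.

Section damped_sine.
Context d (T : measurableType d) (P : probability T R) (Y : T -> R).
Hypothesis mY : measurable_fun [set: T] Y.
(* The characteristic function of [Y] is [rho * exp (- i theta)]; [D] is the slope of
   [theta], and [- E] the logarithmic derivative of [rho]. *)
Variables (rho theta D : R -> R) (E D' : R -> R).
Hypothesis sinY : forall t, \int[P]_w sin (t * Y w) = - (rho t * sin (theta t)).
Hypotheses (rho0 : forall t, 0 <= rho t) (rho1 : forall t, rho t <= 1).
Hypotheses (theta0 : theta 0 = 0) (dtheta : forall t : R, is_derive t 1 theta (D t)).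
Hypotheses (drho : forall t : R, is_derive t 1 rho (- E t * rho t))
  (E0 : forall t, 0 <= t -> 0 <= E t).
Hypotheses (dD : forall t : R, is_derive t 1 D (D' t))
  (D'0 : forall t, 0 <= t -> 0 <= D' t) (D0 : forall t, 0 < t -> 0 < D t).

(* The integral of [exp (- s u) * sin (u y)] over [0 <= u <= t]. *)
Let k (s t y : R) : R :=
  (y - expR (- (s * t)) * (s * sin (t * y) + y * cos (t * y))) / (s ^+ 2 + y ^+ 2).

Let K s t : R := \int[P]_w k s t (Y w).

Variable s : R.
Hypothesis s0 : 0 < s.

Let q0 y : 0 < s ^+ 2 + y ^+ 2.
Proof. by rewrite ltr_pwDl ?sqr_ge0// exprn_gt0. Qed.

Let exp1 t : 0 <= t -> 0 <= expR (- (s * t)) <= 1.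
Proof.
by move=> t0; rewrite expR_ge0 -[leRHS]expR0 ler_expR oppr_le0 mulr_ge0// ltW.
Qed.

Let y_bound y : `|y| / (s ^+ 2 + y ^+ 2) <= s^-1.
Proof.
rewrite ler_pdivrMr// ler_pdivlMl// -(real_normK (num_real y)).
by have := sqr_ge0 (s - `|y|); have := normr_ge0 y; nra.
Qed.

Let k_bound t y : 0 <= t -> `|k s t y| <= 3 * s^-1.
Proof.
move=> t0; rewrite /k normrM normfV (gtr0_norm (q0 y)).
have /andP[e0 e1] := exp1 t0.
have h1 : `|y - expR (- (s * t)) * (s * sin (t * y) + y * cos (t * y))| <= s + 2 * `|y|.
  rewrite (le_trans (ler_normB _ _))// normrM (ger0_norm e0).
  have : `|s * sin (t * y) + y * cos (t * y)| <= s + `|y|.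
    rewrite (le_trans (ler_normD _ _))// !normrM (gtr0_norm s0) lerD//.
      by rewrite ler_piMr ?sin_norm_le1// ltW.
    by rewrite ler_piMr ?cos_norm_le1.
  have := ler_piMl (normr_ge0 (s * sin (t * y) + y * cos (t * y))) e1.
  by lra.
have h2 := y_bound y.
have h3 : s / (s ^+ 2 + y ^+ 2) <= s^-1.
  by rewrite ler_pdivrMr// ler_pdivlMl// expr2 lerDl sqr_ge0.
apply: (@le_trans _ _ ((s + 2 * `|y|) / (s ^+ 2 + y ^+ 2))).
  by rewrite ler_wpM2r// invr_ge0 ltW.
rewrite mulrDl -mulrA; lra.
Qed.

Let mk t : measurable_fun [set: R] (k s t).
Proof.
apply: continuous_measurable_fun => y; apply: cvgM; last first.
  apply: cvgV; first by rewrite gt_eqF.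
  by apply: cvgD; [exact: cvg_cst|exact: exprn_continuous].
apply: cvgB; first exact: cvg_id.
apply: cvgM; first exact: cvg_cst.
have ct : {for y, continuous (fun y => t * y)}.
  by apply: cvgM; [exact: cvg_cst|exact: cvg_id].
apply: cvgD; apply: cvgM; [exact: cvg_cst| |exact: cvg_id|].
- by apply: continuous_comp; [exact: ct|exact: continuous_sin].
- by apply: continuous_comp; [exact: ct|exact: continuous_cos].
Qed.

Let ik t : 0 <= t -> P.-integrable [set: T] (EFin \o (fun w => k s t (Y w))).
Proof.
move=> t0; apply: (@bounded_integrable _ _ _ _ _ (3 * s^-1)) => [|x].
  by apply: measurableT_comp => //; exact: mk.
exact: k_bound.
Qed.

Let dk (t y : R) : is_derive t 1 ((k s) ^~ y) (expR (- (s * t)) * sin (t * y)).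
Proof.
rewrite /k; apply: is_derive_eq; rewrite /GRing.scale/=; field.
by rewrite gt_eqF.
Qed.

Let dK (t : R) : 0 < t -> is_derive t 1 (K s) (- (expR (- (s * t)) * (rho t * sin (theta t)))).
Proof.
move=> t0.
rewrite (_ : - _ = \int[P]_w (expR (- (s * t)) * sin (t * Y w))); last first.
  rewrite RintegralZl ?sinY ?mulrN//.
  apply: (@bounded_integrable _ _ _ _ _ 1); last by move=> x; exact: sin_norm_le1.
  by apply: measurableT_comp; [exact: measurable_sinR|exact: measurable_funM].
apply: (@is_derive_Rintegral _ _ _ P (fun t w => k s t (Y w))
  (fun t w => expR (- (s * t)) * sin (t * Y w)) (fun=> 1) t t) => //.
- by move=> x; rewrite ltr_norml => /andP[? _]; apply: ik; lra.
- move=> x y xt; rewrite normrM.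
  have x0 : 0 <= x by move: xt; rewrite ltr_norml => /andP[? ?]; lra.
  have /andP[e0 e1] := exp1 x0.
  by rewrite mulr_ile1 ?sin_norm_le1// ger0_norm.
- by apply: (@bounded_integrable _ _ _ _ _ 1) => // x; rewrite normr1.
Qed.

Let a t := expR (- (s * t)) * rho t / D t.

Let a_ge0 t : 0 < t -> 0 <= a t.
Proof. by move=> t0; rewrite divr_ge0 ?mulr_ge0 ?expR_ge0// ltW// D0. Qed.

Let da (t : R) : 0 < t -> is_derive t 1 a (- (s + E t + D' t / D t) * a t).
Proof.
move=> t0; have Dt := D0 t0.
have ? := drho t; have ? := dD t.
have ? : is_derive t 1 (fun t => (D t)^-1) (- (D t) ^- 2 * D' t).
  apply: is_derive_eq; first by apply: is_deriveV; rewrite gt_eqF.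
  by rewrite /GRing.scale.
by apply: is_derive_eq; rewrite /a /GRing.scale/=; field; rewrite gt_eqF.
Qed.

(* Integrating by parts against 1 - cos theta, whose derivative is
   theta' sin theta, and using that [a] decreases. *)
Let Psi t := K s t + a t * (1 - cos (theta t)).

Let Psi_nonincreasing u t : 0 < u -> u <= t -> Psi t <= Psi u.
Proof.
move=> u0 ut.
apply: (@is_derive_nonincreasing Psi
  (fun t => - (s + E t + D' t / D t) * a t * (1 - cos (theta t))) u t ut).
- move=> x /andP[ux xt]; have x0 : 0 < x by exact: lt_le_trans ux.
  have ? := dK x0; have ? := da x0; have ? := dtheta x.
  have Dx := D0 x0.
  apply: is_derive_eq; rewrite /a /GRing.scale/=; field.
  by rewrite gt_eqF.
- move=> x /andP[ux xt]; have x0 : 0 < x by exact: lt_trans ux.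
  have Dx := D0 x0.
  rewrite -mulrA mulNr oppr_le0 mulr_ge0//.
    by rewrite !addr_ge0 ?(ltW s0) ?E0 ?divr_ge0 ?D'0 ?(ltW Dx) ?(ltW x0).
  by rewrite mulr_ge0 ?a_ge0// subr_ge0 cos_le1.
Qed.

Let theta_bound u : 0 <= u -> 0 <= theta u <= u * D u.
Proof.
move=> u0; apply/andP; split.
  have := @is_derive_nonincreasing (fun t => - theta t) (fun t => - D t) 0 u u0.
  rewrite theta0 oppr0 oppr_le0; apply.
  by move=> x /andP[x0 _]; rewrite oppr_le0 ltW// D0.
have := @is_derive_nonincreasing (fun t => theta t - t * D t) (fun t => - (t * D' t)) 0 u u0.
rewrite theta0 mul0r subrr subr_le0; apply.
  move=> x _; have ? := dtheta x; have ? := dD x.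
  by apply: is_derive_eq; rewrite /GRing.scale/=; ring.
by move=> x /andP[x0 _]; rewrite oppr_le0 mulr_ge0 ?D'0// ltW.
Qed.

Let k_small u y : 0 <= u -> k s u y <= u.
Proof.
move=> u0.
have := @is_derive_nonincreasing (fun t => k s t y - t)
  (fun t => expR (- (s * t)) * sin (t * y) - 1) 0 u u0.
have -> : k s 0 y - 0 = 0.
  by rewrite /k mulr0 oppr0 expR0 !mul0r sin0 cos0; ring.
rewrite subr_le0; apply.
  by move=> x _; have ? := dk x y; apply: is_derive_eq.
move=> x /andP[x0 _]; rewrite subr_le0.
have /andP[e0 e1] := exp1 (ltW x0).
apply: (le_trans (ler_norm _)); rewrite normrM.
by rewrite mulr_ile1 ?sin_norm_le1// ger0_norm.
Qed.

Let Psi_small u : 0 < u -> Psi u <= 2 * u.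
Proof.
move=> u0; have Du := D0 u0.
have h1 : K s u <= u.
  rewrite -[leRHS](Rintegral_cstT P); apply: le_Rintegral => //.
  - by apply: ik; exact: ltW.
  - by apply: (@bounded_integrable _ _ _ _ _ `|u|).
  - by move=> w _; apply: k_small; exact: ltW.
have /andP[th0 th1] := theta_bound (ltW u0).
have h2 : a u * (1 - cos (theta u)) <= u.
  apply: (@le_trans _ _ ((D u)^-1 * (u * D u))); last first.
    by rewrite mulrC mulfK// gt_eqF.
  apply: ler_pM; rewrite ?a_ge0 ?subr_ge0 ?cos_le1//.
    rewrite /a ler_piMl ?invr_ge0 ?(ltW Du)//.
    have /andP[e0 e1] := exp1 (ltW u0).
    by rewrite mulr_ile1.
  exact: le_trans (oneBcos_le th0) th1.
by rewrite /Psi; lra.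
Qed.

Let K_le0 t : 0 < t -> K s t <= 0.
Proof.
move=> t0; apply: (@le_trans _ _ (Psi t)).
  by rewrite lerDl mulr_ge0 ?a_ge0// subr_ge0 cos_le1.
apply/ler_addgt0Pl => e e0; rewrite addr0.
pose u := Num.min t (e / 2).
have u0 : 0 < u by rewrite lt_min t0 divr_gt0.
have ut : u <= t by rewrite ge_min lexx.
have ue : u <= e / 2 by rewrite ge_min lexx orbT.
by have := Psi_nonincreasing u0 ut; have := Psi_small u0; lra.
Qed.

(** The function [y / (s ^ 2 + y ^ 2)] is the integral of [exp (- s t) * sin (t y)] over
    [t >= 0], so that its mean is minus the integral of
    [exp (- s t) * rho * sin theta]. Here [sin theta] is the derivative of
    [1 - cos theta >= 0] divided by [theta'], and the weight
    [a = exp (- s t) * rho / theta'] decreases, because [rho] decreases and [theta']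
    increases. Integration by parts shows that the latter integral is nonnegative. *)
Lemma Rintegral_conjugate_Poisson_le0 :
  \int[P]_w (Y w / (s ^+ 2 + Y w ^+ 2)) <= 0.
Proof.
have mq : measurable_fun [set: R] (fun y : R => y / (s ^+ 2 + y ^+ 2)).
  apply: continuous_measurable_fun => y; apply: cvgM; first exact: cvg_id.
  apply: cvgV; first by rewrite gt_eqF.
  by apply: cvgD; [exact: cvg_cst|exact: exprn_continuous].
have e0 : (fun n => expR (- (s * n.+1%:R))) @ \oo --> (0 : R).
  apply: (@squeeze_cvgr _ _ _ _ (fun=> 0) (fun n => s^-1 * harmonic n)).
  - near=> n; rewrite expR_ge0/= expRN -invfM lef_pV2 ?posrE ?expR_gt0 ?mulr_gt0//.
    by rewrite (le_trans _ (expR_ge1Dx _))// lerDr.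
  - exact: cvg_cst.
  - rewrite -[X in _ --> X](mulr0 s^-1); apply: cvgM; first exact: cvg_cst.
    exact: cvg_harmonic.
have c1 : (fun n => K s n.+1%:R) @ \oo --> \int[P]_w (Y w / (s ^+ 2 + Y w ^+ 2)).
  apply: (@Rintegral_dct _ _ _ _ (fun n w => k s n.+1%:R (Y w)) _ (fun=> 3 * s^-1)).
  - by move=> n; apply: measurableT_comp => //; exact: mk.
  - exact: (measurableT_comp mq mY).
  - by apply: (@bounded_integrable _ _ _ _ _ `|3 * s^-1|).
  - by move=> n w; exact: k_bound.
  - move=> w; move: (Y w) => y; apply/cvgrPdist_le => e e_gt0.
    pose C := (s + `|y|) / (s ^+ 2 + y ^+ 2).
    have C0 : 0 < C by rewrite divr_gt0// ltr_pwDl.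
    move/cvgrPdist_le : e0 => /(_ _ (divr_gt0 e_gt0 C0)); apply: filterS => n.
    rewrite sub0r normrN ger0_norm ?expR_ge0// ler_pdivlMr// => eC.
    rewrite (_ : _ - _ = expR (- (s * n.+1%:R)) *
      ((s * sin (n.+1%:R * y) + y * cos (n.+1%:R * y)) / (s ^+ 2 + y ^+ 2))); last first.
      by rewrite /k; field; rewrite gt_eqF.
    rewrite normrM ger0_norm ?expR_ge0//; apply: le_trans eC.
    rewrite ler_wpM2l ?expR_ge0// normrM normfV (gtr0_norm (q0 y)).
    rewrite ler_wpM2r ?invr_ge0 ?(ltW (q0 y))//.
    rewrite (le_trans (ler_normD _ _))// !normrM (gtr0_norm s0) lerD//.
      by rewrite ler_piMr ?sin_norm_le1// ltW.
    by rewrite ler_piMr ?cos_norm_le1.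
by apply: (cvgr_to_le c1); near=> n; exact: K_le0.
Unshelve. all: by end_near. Qed.

End damped_sine.

Section arctangent.
Context d (T : measurableType d) (P : probability T R) (Y : T -> R).
Hypothesis mY : measurable_fun [set: T] Y.
Hypothesis poisson : forall s : R, 0 < s ->
  \int[P]_w (Y w / (s ^+ 2 + Y w ^+ 2)) <= 0.

Let matan (c : R) : measurable_fun [set: T] (fun w => atan (Y w / c)).
Proof.
apply: measurableT_comp; last exact: measurable_funM.
by apply: continuous_measurable_fun => x; exact: continuous_atan.
Qed.

Let atan_bound (x : R) : `|atan x| <= pi / 2.
Proof. by rewrite ler_norml !ltW ?atan_gtNpi2 ?atan_ltpi2. Qed.

Let iatan (c : R) : P.-integrable [set: T] (EFin \o (fun w => atan (Y w / c))).
Proof. by apply: (@bounded_integrable _ _ _ _ _ (pi / 2)). Qed.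

Let H (s : R) : R := \int[P]_w atan (Y w / s).

Let dH (s : R) : 0 < s ->
  is_derive s 1 H (- \int[P]_w (Y w / (s ^+ 2 + Y w ^+ 2))).
Proof.
move=> s0.
have q0 (x y : R) : 0 < x -> 0 < x ^+ 2 + y ^+ 2.
  by move=> x0; rewrite ltr_pwDl ?sqr_ge0// exprn_gt0.
have bnd (x y : R) : 0 < x -> `|y / (x ^+ 2 + y ^+ 2)| <= x^-1.
  move=> x0; rewrite normrM normfV (gtr0_norm (q0 x y x0)).
  rewrite ler_pdivrMr ?q0// ler_pdivlMl// -(real_normK (num_real y)).
  by have := sqr_ge0 (x - `|y|); have := normr_ge0 y; nra.
rewrite (_ : - _ = \int[P]_w (- (Y w / (s ^+ 2 + Y w ^+ 2)))); last first.
  rewrite -mulN1r -RintegralZl//; first by apply: eq_Rintegral => w _; rewrite mulN1r.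
  apply: (@bounded_integrable _ _ _ _ _ s^-1); last by move=> w; exact: bnd.
  apply: (@measurableT_comp _ _ _ _ _ _ (fun y : R => y / (s ^+ 2 + y ^+ 2))) => //.
  apply: continuous_measurable_fun => y; apply: cvgM; first exact: cvg_id.
  apply: cvgV; first by rewrite gt_eqF// q0.
  by apply: cvgD; [exact: cvg_cst|exact: exprn_continuous].
apply: (@is_derive_Rintegral _ _ _ P (fun s w => atan (Y w / s))
  (fun s w => - (Y w / (s ^+ 2 + Y w ^+ 2))) (fun=> (s / 2)^-1) s (s / 2)).
- by rewrite divr_gt0.
- by move=> x _; exact: iatan.
- move=> x w; rewrite ltr_norml => /andP[? _]; have x0 : 0 < x by lra.
  have ? : is_derive x 1 (fun x : R => x^-1) (- x ^- 2).
    apply: is_derive_eq; first by apply: is_deriveV; rewrite gt_eqF.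
    by rewrite /GRing.scale/= mulr1.
  apply: is_derive_eq; rewrite /GRing.scale/=; field.
  by rewrite !gt_eqF//= q0.
- move=> x w; rewrite ltr_norml => /andP[? _]; have x0 : s / 2 < x by lra.
  have x00 : 0 < x by lra.
  rewrite normrN (le_trans (bnd _ _ x00))// lef_pV2 ?posrE ?divr_gt0//.
  exact: ltW.
- by apply: (@bounded_integrable _ _ _ _ _ `|(s / 2)^-1|).
Qed.

Let H_le0 s : 0 < s -> H s <= 0.
Proof.
move=> s0.
have c0 : (fun n => H (s + n%:R)) @ \oo --> \int[P]_w (fun=> 0 : R) w.
  apply: (@Rintegral_dct _ _ _ _ (fun n w => atan (Y w / (s + n%:R))) _ (fun=> pi / 2)) => //.
  - by apply: (@bounded_integrable _ _ _ _ _ `|pi / 2|).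
  - move=> w; rewrite -[X in _ --> X]atan0.
    apply: (@continuous_cvg _ _ _ _ _ _ (@atan R)); first exact: continuous_atan.
    rewrite -[X in _ --> X](mulr0 (Y w)); apply: cvgM; first exact: cvg_cst.
    apply/cvgr0Pnorm_le => e e0; near=> n.
    have sn : 0 < s + n%:R by rewrite ltr_pwDl.
    rewrite gtr0_norm ?invr_gt0// -[leRHS]invrK lef_pV2 ?posrE ?invr_gt0//.
    rewrite (@le_trans _ _ n%:R)//; first by near: n; exact: nbhs_infty_ger.
    by rewrite lerDr ltW.
rewrite Rintegral_cstT in c0.
apply: (cvgr_to_ge c0); near=> n.
have := @is_derive_nonincreasing (fun s => - H s)
  (fun s => \int[P]_w (Y w / (s ^+ 2 + Y w ^+ 2))) s (s + n%:R).
rewrite lerN2; apply; first by rewrite lerDl.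
  move=> x /andP[sx _]; have x0 : 0 < x by exact: lt_le_trans sx.
  by have ? := dH x0; apply: is_derive_eq; rewrite opprK.
by move=> x /andP[sx _]; apply: poisson; exact: lt_trans sx.
Unshelve. all: by end_near. Qed.

(** The derivative of [E (atan (Y / s))] in [s] is [- E (Y / (s ^ 2 + Y ^ 2)) >= 0], and
    [E (atan (Y / s))] tends to [0] at infinity, so that it is nonpositive. As [s] tends
    to [0] it becomes [pi / 2 * (P (0 < Y) - P (Y < 0))]. *)
Lemma probability_gt0_le_half : (P [set w | (0 < Y w)%R] <= (1 / 2 : R)%:E)%E.
Proof.
have c0 : (fun n => H (n.+1%:R)^-1) @ \oo --> \int[P]_w (Num.sg (Y w) * (pi / 2)).
  apply: (@Rintegral_dct _ _ _ _ (fun n w => atan (Y w / (n.+1%:R)^-1)) _ (fun=> pi / 2)) => //.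
  - apply: measurable_funM => //; apply: measurableT_comp => //.
    exact: measurable_sgr.
  - by apply: (@bounded_integrable _ _ _ _ _ `|pi / 2|).
  - move=> w; move: (Y w) => y.
    have cy z : 0 < z -> (fun n => atan (z * n.+1%:R)) @ \oo --> (pi / 2 : R).
      move=> z0; apply: (cvg_comp _ _ _ (@cvgy_atan R)).
      apply/cvgryPge => A; near=> n; rewrite -ler_pdivrMl//.
      apply: (@le_trans _ _ n%:R); last by rewrite ler_nat.
      by near: n; exact: nbhs_infty_ger.
    under eq_fun do rewrite invrK.
    case: (sgrP y) => [->|y0|y0].
    + by under eq_fun do rewrite mul0r atan0; rewrite mul0r; exact: cvg_cst.
    + by rewrite mul1r; exact: cy.
    + rewrite mulN1r.
      have -> : (fun n => atan (y * n.+1%:R)) = (fun n => - atan (- y * n.+1%:R)).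
        by apply/funext => n; rewrite mulNr atanN opprK.
      by apply: cvgN; apply: cy; rewrite oppr_gt0.
have mA : measurable [set w | 0 < Y w].
  rewrite (_ : [set w | _] = Y @^-1` `]0, +oo[%classic); last first.
    by apply/seteqP; split => w /=; rewrite in_itv/= andbT.
  by rewrite -[X in measurable X]setTI; exact: mY.
have pi0 : 0 < pi / 2 :> R by rewrite divr_gt0// pi_gt0.
have isg : P.-integrable [set: T] (EFin \o (fun w => Num.sg (Y w))).
  apply: (@bounded_integrable _ _ _ _ _ 1).
    by apply: measurableT_comp => //; exact: measurable_sgr.
  by move=> w; rewrite normr_sg; case: (_ != _).
have : \int[P]_w (Num.sg (Y w) * (pi / 2)) <= 0.
  by apply: (cvgr_to_le c0); near=> n; exact: H_le0.
rewrite RintegralZr// pmulr_lle0// => sg0.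
rewrite -(fineK (fin_num_measure P _ mA)) lee_fin.
have -> : fine (P [set w | 0 < Y w]) = \int[P]_w (\1_[set w | 0 < Y w] w).
  by rewrite /Rintegral integral_indic// setIT.
apply: (@le_trans _ _ (\int[P]_w ((1 / 2) * Num.sg (Y w) + 1 / 2))).
  apply: le_Rintegral => //.
  - apply: (@bounded_integrable _ _ _ _ _ 1); first exact: measurable_indic.
    by move=> w; rewrite indicE; case: (_ \in _); rewrite ?normr1 ?normr0.
  - apply: integrableRD; first exact: integrableRZl.
    by apply: (@bounded_integrable _ _ _ _ _ `|1 / 2|).
  - move=> w _; rewrite indicE; case: (sgrP (Y w)) => y0.
    + by rewrite memNset/= ?y0 ?ltxx//; lra.
    + by rewrite mem_set//=; lra.
    + by rewrite memNset/=; [lra|apply/negP; rewrite -leNgt ltW].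
rewrite RintegralD//; last 2 first.
- exact: integrableRZl.
- by apply: (@bounded_integrable _ _ _ _ _ `|1 / 2|).
by rewrite RintegralZl// Rintegral_cstT; lra.
Unshelve. all: by end_near. Qed.

End arctangent.

End median.

Section weighted_chi_square_median.
Context {R : realType}.
Implicit Type ls : seq R.

Let q0 (t l : R) : 0 < 1 + 4 * (t * l) ^+ 2.
Proof. by rewrite ltr_pwDl// mulr_ge0// sqr_ge0. Qed.

Let slope ls (t : R) : R :=
  \sum_(l <- ls) l * (4 * (t * l) ^+ 2 / (1 + 4 * (t * l) ^+ 2)).
Let slope' ls (t : R) : R :=
  \sum_(l <- ls) l * (8 * t * l ^+ 2 / (1 + 4 * (t * l) ^+ 2) ^+ 2).
Let decay ls (t : R) : R :=
  \sum_(l <- ls) l * (2 * (t * l) / (1 + 4 * (t * l) ^+ 2)).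

Let dphase ls (t : R) : is_derive t 1 (wcs_phase ls) (slope ls t).
Proof.
elim: ls => [|l ls IH].
  rewrite /slope big_nil (_ : wcs_phase [::] = (fun=> 0 : R)); last first.
    by apply/funext => x; rewrite /wcs_phase big_nil.
  exact: is_derive_cst.
rewrite (_ : wcs_phase (l :: ls) = fun t => chi_phase (t * l) + wcs_phase ls t); last first.
  by apply/funext => x; rewrite /wcs_phase big_cons.
have ? := is_derive_chi_phase (t * l).
by apply: is_derive_eq; rewrite /slope big_cons /GRing.scale/=; ring.
Qed.

Let dslope ls (t : R) : is_derive t 1 (slope ls) (slope' ls t).
Proof.
elim: ls => [|l ls IH].
  rewrite /slope' big_nil (_ : slope [::] = (fun=> 0 : R)); last first.
    by apply/funext => x; rewrite /slope big_nil.
  exact: is_derive_cst.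
rewrite (_ : slope (l :: ls) =
    fun t => l * (4 * (t * l) ^+ 2 * (1 + 4 * (t * l) ^+ 2)^-1) + slope ls t); last first.
  by apply/funext => x; rewrite /slope big_cons.
have ? : is_derive t 1 (fun t : R => (1 + 4 * (t * l) ^+ 2)^-1)
    (- (1 + 4 * (t * l) ^+ 2) ^- 2 * (8 * t * l ^+ 2)).
  apply: is_derive_eq; first by apply: is_deriveV; rewrite gt_eqF.
  by rewrite /GRing.scale/=; ring.
apply: is_derive_eq; rewrite /slope' big_cons /GRing.scale/=; field.
by rewrite gt_eqF.
Qed.

Let dmodulus ls (t : R) : is_derive t 1 (wcs_modulus ls) (- decay ls t * wcs_modulus ls t).
Proof.
elim: ls => [|l ls IH].
  rewrite /decay big_nil oppr0 mul0r (_ : wcs_modulus [::] = (fun=> 1 : R)); last first.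
    by apply/funext => x; rewrite /wcs_modulus big_nil.
  exact: is_derive_cst.
have E : wcs_modulus (l :: ls) = fun t => chi_modulus (t * l) * wcs_modulus ls t.
  by apply/funext => x; rewrite /wcs_modulus big_cons.
rewrite E.
have ? := is_derive_chi_modulus (t * l).
by apply: is_derive_eq; rewrite /decay big_cons /GRing.scale/=; ring.
Qed.

Let modulus01 ls t : 0 <= wcs_modulus ls t <= 1.
Proof.
rewrite /wcs_modulus; apply/andP; split.
  by apply: prodr_ge0 => l _; exact: expR_ge0.
apply: prodr_ile1 => l _; rewrite expR_ge0/= -[leRHS]expR0 ler_expR oppr_le0 divr_ge0//.
by rewrite ln_ge0// lerDl mulr_ge0// sqr_ge0.
Qed.

(** The slope of [wcs_phase] is [\sum_l 4 t ^ 2 l ^ 3 / (1 + 4 t ^ 2 l ^ 2)], which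
    increases with [t], and [wcs_modulus] decreases. *)
Lemma weighted_chi_square_Poisson_le0 ls d (T : measurableType d)
    (P : probability T R) (X : T -> R) (s : R) :
  (forall l, l \in ls -> 0 <= l) -> (exists2 l, l \in ls & 0 < l) ->
  weighted_chi_square ls P X -> 0 < s ->
  \int[P]_w ((X w - wcs_mean ls) / (s ^+ 2 + (X w - wcs_mean ls) ^+ 2)) <= 0.
Proof.
move=> ls0 [l0 l0ls l00] XE s0.
have mX := wcs_measurable XE.
have mY : measurable_fun [set: T] (fun w => X w - wcs_mean ls).
  exact: measurable_funB.
apply: (@Rintegral_conjugate_Poisson_le0 _ _ _ P (fun w => X w - wcs_mean ls) mY
  (wcs_modulus ls) (wcs_phase ls) (slope ls) (decay ls) (slope' ls)) => //.
- exact: wcs_sinE.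
- by move=> t; have /andP[] := modulus01 ls t.
- by move=> t; have /andP[] := modulus01 ls t.
- rewrite /wcs_phase big1// => l _.
  by rewrite /chi_phase mul0r mulr0 atan0 mul0r subr0.
- move=> t t0; rewrite /decay big_seq; apply: sumr_ge0 => l /ls0 l1.
  by rewrite mulr_ge0 ?divr_ge0 ?mulr_ge0// ltW.
- move=> t t0; rewrite /slope' big_seq; apply: sumr_ge0 => l /ls0 l1.
  by rewrite mulr_ge0// divr_ge0 ?mulr_ge0 ?sqr_ge0 ?exprn_ge0// ltW.
- move=> t t0; rewrite /slope (big_rem l0)//=; apply: ltr_pwDl.
    by rewrite mulr_gt0// divr_gt0// mulr_gt0// exprn_gt0// mulr_gt0.
  rewrite big_seq; apply: sumr_ge0 => l /mem_rem /ls0 l1.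
  by rewrite mulr_ge0// divr_ge0 ?mulr_ge0 ?sqr_ge0// ltW.
Qed.

End weighted_chi_square_median.

(** * A lower bound from the fourth moment *)

Section fourth_moment.
Context {R : realType}.

(** The quartic is [z * (2 - z) * (z + 1) ^ 2 / 3], nonpositive for [z <= 0]; its maximum
    [(3 + 2 * sqrt 3) / 4] is reached at [z = (1 + sqrt 3) / 2]. *)
Lemma quartic_le_indic (z : R) :
  4 / (3 + 2 * Num.sqrt 3) * (2 / 3 * z + z ^+ 2 - z ^+ 4 / 3) <=
  if 0 < z then 1 else 0.
Proof.
set c := Num.sqrt 3.
have cc : c ^+ 2 = 3 by rewrite sqr_sqrtr.
have c1 : 1 < c.
  by rewrite -[ltLHS]sqrtr1 ltr_sqrt// ltr1n.
have M0 : 0 < 3 + 2 * c by lra.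
case: ltP => z0.
  rewrite mulrAC ler_pdivrMr// mul1r -subr_ge0.
  have -> : 3 + 2 * c - 4 * (2 / 3 * z + z ^+ 2 - z ^+ 4 / 3) =
      4 / 3 * (z - (1 + c) / 2) ^+ 2 * ((z + (1 + c) / 2) ^+ 2 + (c - 1)).
    have -> : (z - (1 + c) / 2) ^+ 2 = z ^+ 2 - (1 + c) * z + (2 + c) / 2 by lra.
    have -> : (z + (1 + c) / 2) ^+ 2 = z ^+ 2 + (1 + c) * z + (2 + c) / 2 by lra.
    have cz : c ^+ 2 * z = 3 * z by rewrite cc.
    have czz : c ^+ 2 * z ^+ 2 = 3 * z ^+ 2 by rewrite cc.
    by lra.
  apply: mulr_ge0; first by apply: mulr_ge0 => //; exact: sqr_ge0.
  by apply: addr_ge0; [exact: sqr_ge0|lra].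
rewrite mulr_ge0_le0 ?divr_ge0 ?(ltW M0)//.
have -> : 2 / 3 * z + z ^+ 2 - z ^+ 4 / 3 = z * ((2 - z) / 3 * (z + 1) ^+ 2) by field.
apply: mulr_le0_ge0 => //; apply: mulr_ge0; last exact: sqr_ge0.
by apply: divr_ge0 => //; lra.
Qed.

(** The quartic bound is integrated at [Y / r], where [r ^ 2 = 10 v]. *)
Lemma fourth_moment_lower_bound d (T : measurableType d) (P : probability T R)
    (Y : T -> R) (v : R) : measurable_fun [set: T] Y ->
  P.-integrable [set: T] (EFin \o (fun w => Y w ^+ 4)) ->
  0 < v -> \int[P]_w Y w = 0 -> \int[P]_w Y w ^+ 2 = v ->
  \int[P]_w Y w ^+ 4 <= 15 * v ^+ 2 ->
  (((2 * Num.sqrt 3 - 3) / 15)%:E <= P [set w | (0 < Y w)%R])%E.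
Proof.
move=> mY i4 v0 e1 e2 e4.
have mA : measurable [set w | 0 < Y w].
  rewrite (_ : [set w | _] = Y @^-1` `]0, +oo[%classic); last first.
    by apply/seteqP; split => w /=; rewrite in_itv/= andbT.
  by rewrite -[X in measurable X]setTI; exact: mY.
rewrite -(fineK (fin_num_measure P _ mA)) lee_fin.
have -> : fine (P [set w | 0 < Y w]) = \int[P]_w (\1_[set w | 0 < Y w] w).
  by rewrite /Rintegral integral_indic// setIT.
(* scale at which the quartic bound is optimal when E Y^4 = 15 (E Y^2)^2 *)
pose r := Num.sqrt (10 * v).
have r0 : 0 < r by rewrite sqrtr_gt0 mulr_gt0.
have rr : r ^+ 2 = 10 * v by rewrite sqr_sqrtr// mulr_ge0// ltW.
set c := Num.sqrt 3.
have cc : c ^+ 2 = 3 by rewrite sqr_sqrtr.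
have c1 : 1 < c by rewrite -[ltLHS]sqrtr1 ltr_sqrt// ltr1n.
pose b := 4 / (3 + 2 * c).
have i1 := integrable_lower_power (isT : (1 <= 4)%N) mY i4.
have i2 := integrable_lower_power (isT : (2 <= 4)%N) mY i4.
have j1 := integrableRZl (b * (2 / 3) / r) i1.
have j2 := integrableRZl (b / r ^+ 2) i2.
have j4 := integrableRZl (- (b / 3 / r ^+ 4)) i4.
have j12 := integrableRD j1 j2.
have j := integrableRD j12 j4.
apply: (@le_trans _ _ (\int[P]_w (b * (2 / 3) / r * Y w ^+ 1 + b / r ^+ 2 * Y w ^+ 2
   + - (b / 3 / r ^+ 4) * Y w ^+ 4))); last first.
  apply: le_Rintegral => //.
    apply: (@bounded_integrable _ _ _ _ _ 1); first exact: measurable_indic.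
    by move=> w; rewrite indicE; case: (_ \in _); rewrite ?normr1 ?normr0.
  move=> w _; have := quartic_le_indic (Y w / r).
  rewrite -/c -/b pmulr_lgt0 ?invr_gt0// indicE.
  have -> : b * (2 / 3 * (Y w / r) + (Y w / r) ^+ 2 - (Y w / r) ^+ 4 / 3) =
      b * (2 / 3) / r * Y w ^+ 1 + b / r ^+ 2 * Y w ^+ 2 + - (b / 3 / r ^+ 4) * Y w ^+ 4.
    by field; rewrite gt_eqF.
  by case: ifPn => h; [rewrite mem_set|rewrite memNset//; exact/negP].
rewrite RintegralD// RintegralD// !RintegralZl//.
have -> : \int[P]_w Y w ^+ 1 = 0 by under eq_Rintegral do rewrite expr1.
rewrite e2 mulr0 add0r.
have r4 : r ^+ 4 = 100 * v ^+ 2.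
  by rewrite -[4%N]/(2 * 2)%N exprM rr; ring.
rewrite r4 rr.
have b0 : 0 < b by rewrite divr_gt0//; lra.
have -> : (2 * c - 3) / 15 = b / 20.
  rewrite /b; have h : 3 + 2 * c != 0 by rewrite gt_eqF//; lra.
  have -> : 4 / (3 + 2 * c) = 4 * (2 * c - 3) / 3.
    apply: (mulIf h); rewrite divfK//; lra.
  by lra.
apply: (@le_trans _ _ (b / (10 * v) * v - b / 3 / (100 * v ^+ 2) * (15 * v ^+ 2))).
  rewrite le_eqVlt; apply/orP; left; apply/eqP; field; rewrite !gt_eqF//; lra.
have v20 : 0 <= 100 * v ^+ 2 by rewrite mulr_ge0// sqr_ge0.
rewrite mulNr lerD2l lerN2 ler_wpM2l//.
by apply: divr_ge0 => //; apply: divr_ge0 => //; exact: ltW.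
Qed.

End fourth_moment.

(** * Orthogonal diagonalisation of real symmetric matrices *)

Section real_spectral.
Context {R : realType}.

Definition dotr n (u v : 'rV[R]_n) : R := (u *m v^T) 0 0.

Lemma dotrE n (u v : 'rV[R]_n) : dotr u v = \sum_i u 0 i * v 0 i.
Proof. by rewrite /dotr mxE; apply: eq_bigr => i _; rewrite mxE. Qed.

Lemma dotrC n (u v : 'rV[R]_n) : dotr u v = dotr v u.
Proof. by rewrite !dotrE; apply: eq_bigr => i _; rewrite mulrC. Qed.

Lemma dotrD n (u v w : 'rV[R]_n) : dotr (u + v) w = dotr u w + dotr v w.
Proof. by rewrite /dotr mulmxDl mxE. Qed.

Lemma dotrZ n a (u w : 'rV[R]_n) : dotr (a *: u) w = a * dotr u w.
Proof. by rewrite /dotr -scalemxAl mxE. Qed.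

Lemma dotr_ge0 n (u : 'rV[R]_n) : 0 <= dotr u u.
Proof. by rewrite dotrE; apply: sumr_ge0 => i _; rewrite -expr2 sqr_ge0. Qed.

Lemma dotr_eq0 n (u : 'rV[R]_n) : (dotr u u == 0) = (u == 0).
Proof.
rewrite dotrE psumr_eq0; last by move=> i _; rewrite -expr2 sqr_ge0.
apply/allP/eqP => [h|-> i _]; last by rewrite mxE mulr0 eqxx.
apply/rowP => i; rewrite mxE; apply/eqP.
by have := h i (mem_index_enum i); rewrite mulf_eq0 orbb.
Qed.

Lemma cvg_sumr (I : Type) (r : seq I) (T : Type) (F : set_system T)
    {FF : Filter F} (f : I -> T -> R) (l : I -> R) :
  (forall i, f i x @[x --> F] --> l i) ->
  \sum_(i <- r) f i x @[x --> F] --> \sum_(i <- r) l i.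
Proof.
move=> fl; elim: r => [|i r IH].
  by under eq_fun do rewrite big_nil; rewrite big_nil; exact: cvg_cst.
under eq_fun do rewrite big_cons; rewrite big_cons.
exact: cvgD.
Qed.

Lemma dotr_continuous n (A B : 'M[R]_n) :
  continuous (fun v : 'rV[R]_n => dotr (v *m A) (v *m B)).
Proof.
move=> v; rewrite /continuous_at.
under eq_fun do rewrite dotrE.
rewrite dotrE; apply: (@cvg_sumr _ _ _ (nbhs v) _) => i.
have lin (M : 'M[R]_n) : (fun v : 'rV[R]_n => (v *m M) 0 i) @ v --> (v *m M) 0 i.
  under eq_fun do rewrite mxE.
  rewrite mxE; apply: (@cvg_sumr _ _ _ (nbhs v) _) => j; apply: cvgM; last exact: cvg_cst.
  exact: coord_continuous.
by apply: cvgM; exact: lin.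
Qed.

(** The maximum of the quadratic form on the unit sphere of the orthogonal
    complement of eigenvectors already found is attained at a new eigenvector. *)
Lemma symmetric_eigenvector_ortho n k (C : 'M[R]_n) (U : 'M[R]_(k, n)) (D : 'rV[R]_k) :
  C^T = C -> (k < n)%N -> U *m C = diag_mx D *m U ->
  exists v : 'rV[R]_n, exists l : R,
    [/\ dotr v v = 1, v *m U^T = 0 & v *m C = l *: v].
Proof.
move=> Csym kn UC.
pose W := [set v : 'rV[R]_n | v *m U^T = 0].
pose S := [set v : 'rV[R]_n | v *m U^T = 0 /\ dotr v v = 1].
have S0 : S !=set0.
  have : kermx U^T != 0.
    by rewrite kermx_eq0 /row_free neq_ltn (leq_ltn_trans (rank_leq_col _)).
  move=> /rowV0Pn[u /sub_kermxP uU u0].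
  have uu : 0 < dotr u u by rewrite lt_neqAle dotr_ge0 eq_sym dotr_eq0 u0.
  exists ((Num.sqrt (dotr u u))^-1 *: u); split; first by rewrite -scalemxAl uU scaler0.
  rewrite dotrZ dotrC dotrZ mulrA -expr2 exprVn sqr_sqrtr ?dotr_ge0// mulVf//.
  by rewrite gt_eqF.
have cS : compact S.
  pose I := [set v : 'rV[R]_n | forall i, `[(-1 : R), 1]%classic (v ord0 i)].
  have cI : compact I by apply: (@rV_compact _ _ (fun=> `[(-1 : R), 1]%classic)) => _; exact: segment_compact.
  apply: (subclosed_compact _ cI).
    rewrite (_ : S = (fun v => dotr (v *m (U^T *m U)) (v *m 1%:M)) @^-1` [set 0] `&`
      (fun v => dotr (v *m 1%:M) (v *m 1%:M)) @^-1` [set 1]).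
      have c1 (x : R) : closed [set x] by exact: closed_eq.
      by apply: closedI; apply: preimage_closed => // v _; exact: dotr_continuous.
    apply/seteqP; split => v /=; rewrite !mulmx1.
      by move=> [vU v1]; split=> //; rewrite mulmxA vU mul0mx /dotr mul0mx mxE.
    move=> [h v1]; split=> //; apply/eqP; rewrite -dotr_eq0; apply/eqP; rewrite -[RHS]h.
    by rewrite /dotr trmx_mul trmxK !mulmxA.
  move=> v [_ v1] i /=; rewrite in_itv/= -ler_norml -[leRHS]sqrtr1.
  rewrite -sqrtr_sqr ler_wsqrtr// -v1 dotrE (bigD1 i)//= -expr2 lerDl.
  by apply: sumr_ge0 => j _; rewrite -expr2 sqr_ge0.
have cf : continuous (fun v : 'rV[R]_n => dotr (v *m C) (v *m 1%:M)).
  exact: dotr_continuous.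
have [v vS vmax] := compact_EVT_max S0 cS (continuous_subspaceT cf).
have {vS}[vU v1] : S v by rewrite inE in vS.
pose l := dotr (v *m C) v.
pose p (x y : 'rV[R]_n) := l * dotr x y - dotr (x *m C) y.
have CE x y : dotr (x *m C) y = dotr x (y *m C).
  by rewrite /dotr trmx_mul Csym mulmxA.
have p_ge0 x : W x -> 0 <= p x x.
  move=> Wx; have [->|x0] := eqVneq x 0.
    by rewrite /p /dotr !mul0mx mxE mulr0 subrr.
  have xx : 0 < dotr x x by rewrite lt_neqAle dotr_ge0 eq_sym dotr_eq0 x0.
  pose a := (Num.sqrt (dotr x x))^-1.
  have aa : a ^+ 2 * dotr x x = 1.
    by rewrite exprVn sqr_sqrtr ?dotr_ge0// mulVf// gt_eqF.
  have : S (a *: x).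
    split; first by rewrite -scalemxAl (Wx : x *m _ = 0) scaler0.
    by rewrite dotrZ dotrC dotrZ mulrA -expr2.
  move=> /mem_set /vmax; rewrite !mulmx1 -scalemxAl dotrZ dotrC dotrZ mulrA -expr2 -/l.
  rewrite dotrC => h.
  rewrite /p subr_ge0 -(ler_pM2l (_ : 0 < a ^+ 2)); last first.
    by rewrite exprn_gt0// invr_gt0 sqrtr_gt0.
  by rewrite mulrCA aa mulr1.
have pv : p v v = 0 by rewrite /p v1 mulr1 subrr.
(* [p] is nonnegative on [W] and vanishes at [v], so that its first variation at [v]
   vanishes too. *)
have pvh h : W h -> p v h = 0.
  move=> Wh.
  have key e : 0 <= 2 * e * p v h + e ^+ 2 * p h h.
    have : 0 <= p (v + e *: h) (v + e *: h).
      apply: p_ge0; rewrite /W/= mulmxDl vU -scalemxAl (Wh : h *m _ = 0).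
      by rewrite scaler0 addr0.
    suff -> : p (v + e *: h) (v + e *: h) = p v v + 2 * e * p v h + e ^+ 2 * p h h.
      by rewrite pv add0r.
    have Dr x y z : dotr x (y + z) = dotr x y + dotr x z.
      by rewrite dotrC dotrD !(dotrC x).
    have Zr a x y : dotr x (a *: y) = a * dotr x y by rewrite dotrC dotrZ dotrC.
    rewrite /p mulmxDl -scalemxAl !(dotrD, dotrZ, Dr, Zr) (dotrC h v).
    rewrite (CE h v) (dotrC h (v *m C)); ring.
  apply/eqP/negPn/negP => a0.
  pose b := `|p h h| + 1; have b0 : 0 < b by rewrite ltr_wpDl.
  have := key (- p v h / b).
  have -> : 2 * (- p v h / b) * p v h + (- p v h / b) ^+ 2 * p h h =
      (p v h / b) ^+ 2 * (p h h - 2 * b) by field; rewrite gt_eqF.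
  rewrite pmulr_rge0; last by rewrite exprn_even_gt0//= mulf_neq0// invr_eq0 gt_eqF.
  by have := ler_norm (p h h); have := normr_ge0 (p h h); rewrite /b; lra.
have vCW : W (v *m C).
  rewrite /W/= -mulmxA.
  have : (U *m C)^T = (diag_mx D *m U)^T by rewrite UC.
  by rewrite !trmx_mul Csym tr_diag_mx => ->; rewrite mulmxA vU mul0mx.
exists v, l; split=> //; apply/esym/eqP; rewrite -subr_eq0 -dotr_eq0.
set w := l *: v - v *m C.
have Ww : W w by rewrite /W/= mulmxBl -scalemxAl vU scaler0 (vCW : _ *m _ = 0) subrr.
rewrite -(pvh _ Ww) /p; apply/eqP.
by rewrite {1}/w dotrD dotrZ -scaleN1r dotrZ mulN1r.
Qed.

Lemma symmetric_diagonalisation n (C : 'M[R]_n) : C^T = C ->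
  exists U : 'M[R]_n, exists D : 'rV[R]_n,
    U *m U^T = 1%:M /\ U *m C *m U^T = diag_mx D.
Proof.
move=> Csym.
suff H k : (k <= n)%N -> exists U : 'M[R]_(k, n), exists D : 'rV[R]_k,
    U *m U^T = 1%:M /\ U *m C = diag_mx D *m U.
  have [U [D [UU UC]]] := H n (leqnn n).
  by exists U, D; split=> //; rewrite UC -mulmxA UU mulmx1.
elim: k => [|k IH] kn.
  exists 0, 0; split; first by apply/matrixP => -[].
  by apply/matrixP => -[].
have [U [D [UU UC]]] := IH (ltnW kn).
have [v [l [v1 vU vC]]] := symmetric_eigenvector_ortho Csym kn UC.
have vv : v *m v^T = 1%:M.
  by apply/matrixP => i j; rewrite !ord1 [RHS]mxE eqxx.
have Uv : U *m v^T = 0 by rewrite -[LHS]trmxK trmx_mul trmxK vU trmx0.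
suff : exists U : 'M[R]_(1 + k, n), exists D : 'rV[R]_(1 + k),
    U *m U^T = 1%:M /\ U *m C = diag_mx D *m U by [].
exists (col_mx v U), (row_mx (const_mx l) D); split.
  rewrite tr_col_mx mul_col_row vv vU Uv UU.
  by rewrite [RHS]scalar_mx_block.
rewrite mul_col_mx vC UC diag_mx_row mul_block_col !mul0mx addr0 add0r.
by rewrite diag_const_mx mul_scalar_mx.
Qed.

End real_spectral.

(** * The squared length of a Gaussian vector *)

Section gaussian_vector.
Context {R : realType} d (T : measurableType d) (P : probability T R).

Lemma weighted_chi_square_same_law (ls : seq R) d' (T' : measurableType d')
    (P' : probability T' R) (X' : T' -> R) (X : T -> R) :
  measurable_fun [set: T] X -> (forall w, 0 <= X w) ->
  weighted_chi_square ls P' X' -> same_law P' X' P X ->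
  weighted_chi_square ls P X.
Proof.
move=> mX X0 [mX' X'0 lap cosE sinE i4 e1 e2 e4] XX.
pose m := wcs_mean ls.
have mm : measurable_fun [set: R] (fun x : R => x - m) by exact: measurable_funB.
have mk k : measurable_fun [set: R] (fun x : R => (x - m) ^+ k).
  exact: measurable_funX.
have ik k : (k <= 4)%N -> P'.-integrable [set: T'] (EFin \o (fun w => (X' w - m) ^+ k)).
  by move=> k4; apply: integrable_lower_power => //; exact: measurable_funB.
have tr f := same_law_Rintegral mX' mX (f := f) XX.
have trk k k4 := tr (fun x => (x - m) ^+ k) (mk k) (ik k k4).
split=> //.
- move=> c c0; rewrite -lap//; apply/esym.
  have mc : measurable_fun [set: R] (fun x : R => expR (- (c * x))).
    by apply: measurableT_comp => //; apply: measurableT_comp => //; exact: measurable_funM.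
  apply: (tr (fun x => expR (- (c * x))) mc _).2.
  apply: (@bounded_integrable _ _ _ _ _ 1); first exact: measurableT_comp.
  move=> x /=; rewrite ger0_norm ?expR_ge0// -expR0 ler_expR oppr_le0.
  by rewrite mulr_ge0.
- move=> t; rewrite -cosE; apply/esym.
  have mc : measurable_fun [set: R] (fun x => cos (t * (x - m))).
    by apply: measurableT_comp; [exact: measurable_cosR|exact: measurable_funM].
  apply: (tr (fun x => cos (t * (x - m))) mc _).2.
  apply: (@bounded_integrable _ _ _ _ _ 1); first exact: measurableT_comp.
  by move=> x; exact: cos_norm_le1.
- move=> t; rewrite -sinE; apply/esym.
  have mc : measurable_fun [set: R] (fun x => sin (t * (x - m))).
    by apply: measurableT_comp; [exact: measurable_sinR|exact: measurable_funM].
  apply: (tr (fun x => sin (t * (x - m))) mc _).2.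
  apply: (@bounded_integrable _ _ _ _ _ 1); first exact: measurableT_comp.
  by move=> x; exact: sin_norm_le1.
- exact: (trk 4%N isT).1.
- by rewrite -e1; apply/esym; exact: (trk 1%N isT).2.
- by rewrite -e2; apply/esym; exact: (trk 2%N isT).2.
- by have [_ <-] := trk 4%N isT.
Qed.

Lemma centered_gaussian_cos (Y : T -> R) : centered_gaussian P Y ->
  [/\ measurable_fun [set: T] Y,
      P.-integrable [set: T] (EFin \o (fun w => Y w ^+ 2)) &
      \int[P]_w cos (Y w) = expR (- (\int[P]_w Y w ^+ 2 / 2))].
Proof.
move=> [mY [Y0|[s s0 Ys]]].
- have Yl : same_law P (fun=> 0) P Y.
    move=> A mA; rewrite -[RHS]/(pushforward P Y A) Y0// preimage_cst diracE.
    by case: (_ \in _); rewrite ?probability_setT ?measure0.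
  have tr f := same_law_Rintegral (@measurable_cst _ _ _ _ _ _) mY (f := f) Yl.
  have mc k : P.-integrable [set: T] (EFin \o (fun=> k : R)).
    exact: (@bounded_integrable _ _ _ _ _ `|k|).
  have [i2 e2] := tr (fun x => x ^+ 2) (measurable_funX 2 (@measurable_id _ _ _)) (mc (0 ^+ 2)).
  have [_ ec] := tr cos measurable_cosR (mc (cos 0)).
  split=> //.
  have -> : \int[P]_w Y w ^+ 2 = 0 ^+ 2 by rewrite -e2; exact: (Rintegral_cstT P (0 ^+ 2)).
  have -> : \int[P]_w cos (Y w) = cos 0 by rewrite -ec; exact: (Rintegral_cstT P (cos 0)).
  by rewrite cos0 expr0n/= mul0r oppr0 expR0.
- have Yl : same_law (normal_prob (0 : R) s) (fun x => x) P Y.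
    by move=> A mA; rewrite -[RHS]/(pushforward P Y A) Ys.
  have mid : measurable_fun [set: measurableTypeR R] (fun x : measurableTypeR R => x : R).
    by move=> _ A mA; rewrite setTI.
  have tr f := same_law_Rintegral mid mY (f := f) Yl.
  have m2 : measurable_fun [set: R] (fun x : R => x ^+ 2) by exact: measurable_funX.
  have iN : (normal_prob (0 : R) s).-integrable [set: R] (EFin \o (fun x : R => x ^+ 2)).
    by apply: integrable_poly_growth => //; exact: poly_growthX.
  have [i2 e2] := tr (fun x => x ^+ 2) m2 iN.
  have ic : (normal_prob (0 : R) s).-integrable [set: R] (EFin \o cos).
    apply: (@bounded_integrable _ _ _ _ _ 1); first exact: measurable_cosR.
    by move=> x; exact: cos_norm_le1.
  have [_ ec] := tr cos measurable_cosR ic.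
  split=> //; rewrite -e2 -ec.
  have -> : \int[normal_prob (0 : R) s]_x x ^+ 2 = s ^+ 2.
    under eq_Rintegral do rewrite expr2.
    rewrite (_ : s ^+ 2 = s ^+ 2 * \int[normal_prob (0 : R) s]_x 1).
      apply: stein_identity => //.
      - by move=> x; exact: cvg_cst.
      - exact: (poly_growthX 1).
      - exact: (poly_growthX 0).
    by rewrite Rintegral_cstT mulr1.
  have := Rintegral_normal_cos 1 s0; rewrite expr1n mulr1 => <-.
  by apply: eq_Rintegral => x _; rewrite mul1r.
Qed.

(** Uncorrelated coordinates of a Gaussian vector contribute independent factors. A
    squared coordinate [Z j] enters the exponent by averaging [cos (u * Z j)] over a
    Gaussian [u] of variance [2 s]. *)
Lemma laplace_sum_squares (I : finType) (Z : I -> T -> R) (l : I -> R) (s : R) :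
  0 < s -> (forall i, measurable_fun [set: T] (Z i)) -> (forall i, 0 <= l i) ->
  (forall c : I -> R, \int[P]_w cos (\sum_i c i * Z i w) =
    expR (- (\sum_i c i ^+ 2 * l i) / 2)) ->
  \int[P]_w expR (- (s * \sum_i Z i w ^+ 2)) =
  \prod_i (Num.sqrt (1 + 2 * s * l i))^-1.
Proof.
move=> s0 mZ l0 cosZ.
have key (r : seq I) (c : I -> R) : uniq r -> (forall i, i \in r -> c i = 0) ->
    \int[P]_w (expR (- (s * \sum_(i <- r) Z i w ^+ 2)) * cos (\sum_i c i * Z i w)) =
    \prod_(i <- r) (Num.sqrt (1 + 2 * s * l i))^-1 *
      expR (- (\sum_i c i ^+ 2 * l i) / 2).
  elim: r c => [|j r IH] c.
    move=> _ _; rewrite big_nil mul1r -cosZ; apply: eq_Rintegral => w _.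
    by rewrite big_nil mulr0 oppr0 expR0 mul1r.
  move=> /= /andP[jr ur] c0.
  have cj : c j = 0 by rewrite c0// mem_head.
  pose A w := \sum_i c i * Z i w.
  pose e w := expR (- (s * \sum_(i <- r) Z i w ^+ 2)).
  pose Q := \prod_(i <- r) (Num.sqrt (1 + 2 * s * l i))^-1.
  pose q := expR (- (\sum_i c i ^+ 2 * l i) / 2).
  have mA : measurable_fun [set: T] A.
    by apply: measurable_sum => i; exact: measurable_funM.
  have me : measurable_fun [set: T] e.
    apply: measurableT_comp => //; apply: measurableT_comp => //.
    apply: measurable_funM => //; apply: measurable_sum => i; exact: measurable_funX.
  have e01 w : 0 <= e w <= 1.
    rewrite expR_ge0/= -[leRHS]expR0 ler_expR oppr_le0 mulr_ge0 ?(ltW s0)//.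
    by apply: sumr_ge0 => i _; exact: sqr_ge0.
  have mZj u : measurable_fun [set: T] (fun w => u * Z j w) by exact: measurable_funM.
  have step u : \int[P]_w (e w * cos (A w) * cos (u * Z j w)) =
      Q * q * expR (- (l j / 2 * u ^+ 2)).
    have shift v : \int[P]_w (e w * cos (A w + v * Z j w)) =
        Q * q * expR (- (l j / 2 * v ^+ 2)).
      pose cv i := c i + (if i == j then v else 0).
      have cv0 i : i \in r -> cv i = 0.
        move=> ir; rewrite /cv; case: eqVneq => [ij|_]; first by rewrite -ij ir in jr.
        by rewrite c0 ?addr0// inE ir orbT.
      have := IH cv ur cv0.
      have -> : \sum_i cv i ^+ 2 * l i = \sum_i c i ^+ 2 * l i + v ^+ 2 * l j.
        rewrite (bigD1 j)//= [in RHS](bigD1 j)//= /cv eqxx cj add0r expr0n mul0r add0r.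
        rewrite addrC; congr (_ + _); apply: eq_bigr => i /negPf ij.
        by rewrite ij addr0.
      rewrite (_ : - (_ + _) / 2 = - (\sum_i c i ^+ 2 * l i) / 2 + - (l j / 2 * v ^+ 2));
        last by field.
      rewrite expRD mulrA -/Q -/q.
      move=> <-; apply: eq_Rintegral => w _; congr (_ * cos _).
      rewrite /A (bigD1 j)//= [in RHS](bigD1 j)//= /cv eqxx cj add0r mul0r add0r.
      rewrite addrC; congr (_ + _); apply: eq_bigr => i /negPf ij.
      by rewrite ij addr0.
    have i1 v : P.-integrable [set: T] (EFin \o (fun w => e w * cos (A w + v * Z j w))).
      apply: (@bounded_integrable _ _ _ _ _ 1).
        apply: measurable_funM => //; apply: measurableT_comp; first exact: measurable_cosR.
        exact: measurable_funD.
      move=> w; have /andP[e0 e1] := e01 w.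
      by rewrite normrM mulr_ile1 ?cos_norm_le1// ger0_norm.
    have E w : e w * cos (A w) * cos (u * Z j w) =
        (1 / 2) * (e w * cos (A w + u * Z j w)) + (1 / 2) * (e w * cos (A w + - u * Z j w)).
      by rewrite mulNr cosB cosD; field.
    under eq_Rintegral do rewrite E.
    rewrite RintegralD//; [|exact: integrableRZl|exact: integrableRZl].
    by rewrite !RintegralZl// !shift sqrrN; field.
  pose g := Num.sqrt (2 * s).
  have g0 : 0 < g by rewrite sqrtr_gt0 mulr_gt0.
  have gg : g ^+ 2 = 2 * s by rewrite sqr_sqrtr// mulr_ge0// ltW.
  pose N := normal_prob (0 : R) g.
  have mf : measurable_fun [set: T * R] (fun z => e z.1 * cos (A z.1) * cos (z.2 * Z j z.1)).
    apply: measurable_funM.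
      apply: measurable_funM; first exact: measurableT_comp.
      apply: measurableT_comp; first exact: measurable_cosR.
      exact: measurableT_comp.
    apply: measurableT_comp; first exact: measurable_cosR.
    by apply: measurable_funM => //; exact: measurableT_comp.
  have bf z : `|e z.1 * cos (A z.1) * cos (z.2 * Z j z.1)| <= 1.
    have /andP[e0 e1] := e01 z.1.
    rewrite !normrM mulr_ile1 ?cos_norm_le1 ?mulr_ge0//.
    by rewrite mulr_ile1 ?cos_norm_le1// ger0_norm.
  have inner w : \int[N]_u (e w * cos (A w) * cos (u * Z j w)) =
      expR (- (2 * s * Z j w ^+ 2 / 2)) * (e w * cos (A w)).
    rewrite RintegralZl//; last first.
      apply: (@bounded_integrable _ _ _ _ _ 1); last by move=> x; exact: cos_norm_le1.
      by apply: measurableT_comp; [exact: measurable_cosR|exact: measurable_funM].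
    under eq_Rintegral do rewrite mulrC.
    by rewrite Rintegral_normal_cos// gg mulrC.
  have := Rintegral_exchange P N mf bf.
  under [in RHS]eq_Rintegral do rewrite /= step.
  rewrite RintegralZl//; last first.
    apply: (@bounded_integrable _ _ _ _ _ 1).
      apply: measurableT_comp => //; apply: measurableT_comp => //.
      by apply: measurable_funM => //; exact: measurable_funX.
    move=> x; rewrite ger0_norm ?expR_ge0// -expR0 ler_expR oppr_le0.
    by rewrite mulr_ge0 ?sqr_ge0// divr_ge0.
  rewrite Rintegral_normal_expR_sqr ?divr_ge0//.
  under eq_Rintegral do rewrite /= inner.
  move=> Ex; rewrite big_cons -/Q -/q.
  transitivity (\int[P]_w (expR (- (2 * s * Z j w ^+ 2 / 2)) * (e w * cos (A w)))).
    apply: eq_Rintegral => w _; rewrite big_cons mulrDr opprD expRD -/(e w) -/(A w) mulrA.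
    by congr (expR _ * _ * _); field.
  rewrite Ex gg.
  have -> : 1 + 2 * (l j / 2) * (2 * s) = 1 + 2 * s * l j by field.
  by ring.
have := key (index_enum I) (fun=> 0) (index_enum_uniq I) (fun _ _ => erefl).
have -> : \sum_i (0 : R) ^+ 2 * l i = 0 by rewrite big1// => i _; rewrite expr0n mul0r.
rewrite oppr0 mul0r expR0 mulr1 => <-; apply: eq_Rintegral => w _.
by rewrite [X in cos X]big1 ?cos0 ?mulr1// => i _; rewrite mul0r.
Qed.

(** A Gaussian vector becomes uncorrelated in an orthonormal basis of eigenvectors of its
    covariance matrix, which does not change its length. *)
Lemma gaussian_square_sum_law n (X : 'I_n -> T -> R) :
  (forall c : 'I_n -> R, centered_gaussian P (fun w => \sum_i c i * X i w)) ->
  exists ls : seq R, [/\ forall l, l \in ls -> 0 <= l,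
    weighted_chi_square ls P (fun w => \sum_i X i w ^+ 2) &
    forall i, 2 * (\int[P]_w X i w ^+ 2) ^+ 2 <= wcs_var ls].
Proof.
move=> gX.
have gX1 i : centered_gaussian P (X i).
  rewrite (_ : X i = fun w => \sum_j (j == i)%:R * X j w); first exact: gX.
  apply/funext => w; rewrite (bigD1 i)//= eqxx mul1r big1 ?addr0// => j /negPf ->.
  by rewrite mul0r.
have mX i : measurable_fun [set: T] (X i) by have [] := centered_gaussian_cos (gX1 i).
have iX i : P.-integrable [set: T] (EFin \o (fun w => X i w ^+ 2)).
  by have [] := centered_gaussian_cos (gX1 i).
have iXX i j : P.-integrable [set: T] (EFin \o (fun w => X i w * X j w)).
  apply: (@dominated_integrableR _ _ _ _ _ (fun w => X i w ^+ 2 + X j w ^+ 2)).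
  - exact: measurable_funM.
  - exact: integrableRD.
  - move=> w; rewrite normrM -(real_normK (num_real (X i w))).
    rewrite -(real_normK (num_real (X j w))).
    by have := sqr_ge0 (`|X i w| - `|X j w|); have := sqr_ge0 (`|X i w| + `|X j w|); nra.
pose C : 'M[R]_n := \matrix_(i, j) \int[P]_w (X i w * X j w).
have Csym : C^T = C.
  by apply/matrixP => i j; rewrite !mxE; apply: eq_Rintegral => w _; rewrite mulrC.
pose row w : 'rV[R]_n := \row_i X i w.
have sumsq (a : 'rV[R]_n) : \int[P]_w (\sum_i a 0 i * X i w) ^+ 2 = dotr (a *m C) a.
  have E w : (\sum_i a 0 i * X i w) ^+ 2 =
      \sum_i \sum_j (a 0 i * a 0 j) * (X i w * X j w).
    rewrite expr2 big_distrl/=; apply: eq_bigr => i _.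
    by rewrite big_distrr/=; apply: eq_bigr => j _; rewrite mulrACA.
  under eq_Rintegral do rewrite E.
  rewrite Rintegral_sum; last by move=> i; apply: integrable_sumR => j; exact: integrableRZl.
  rewrite dotrE; under [RHS]eq_bigr do rewrite mxE big_distrl/=.
  rewrite [RHS]exchange_big/=; apply: eq_bigr => i _.
  rewrite Rintegral_sum; last by move=> j; exact: integrableRZl.
  by apply: eq_bigr => j _; rewrite RintegralZl// mxE mulrAC.
have [U [D [UU UCU]]] := symmetric_diagonalisation Csym.
have UU' : U^T *m U = 1%:M by apply: mulmx1C.
pose Z i w := \sum_j U i j * X j w.
have ZE w i : (row w *m U^T) 0 i = Z i w.
  by rewrite mxE; apply: eq_bigr => j _; rewrite !mxE mulrC.
have sqE w : \sum_i Z i w ^+ 2 = \sum_i X i w ^+ 2.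
  transitivity (dotr (row w *m U^T) (row w *m U^T)).
    by rewrite dotrE; apply: eq_bigr => i _; rewrite ZE expr2.
  rewrite /dotr trmx_mul trmxK mulmxA -(mulmxA (row w)) UU' mulmx1 -/(dotr _ _) dotrE.
  by apply: eq_bigr => i _; rewrite !mxE expr2.
have mZ i : measurable_fun [set: T] (Z i).
  by apply: measurable_sum => j; exact: measurable_funM.
have comb (c : 'I_n -> R) w : \sum_i c i * Z i w =
    \sum_j ((\row_i c i) *m U) 0 j * X j w.
  under eq_bigr do rewrite big_distrr/=.
  rewrite exchange_big/=; apply: eq_bigr => j _; rewrite !mxE big_distrl/=.
  by apply: eq_bigr => i _; rewrite mxE mulrA.
have varZ (c : 'I_n -> R) : \int[P]_w (\sum_i c i * Z i w) ^+ 2 =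
    \sum_i c i ^+ 2 * D 0 i.
  under eq_Rintegral do rewrite comb.
  rewrite sumsq; set a := \row_i c i.
  have -> : dotr (a *m U *m C) (a *m U) = dotr (a *m diag_mx D) a.
    by rewrite -UCU /dotr trmx_mul !mulmxA.
  rewrite dotrE; apply: eq_bigr => i _.
  by rewrite mul_mx_diag !mxE mulrAC expr2.
have D0 i : 0 <= D 0 i.
  have := varZ (fun j => (j == i)%:R).
  rewrite (bigD1 i)//= eqxx expr1n mul1r big1 ?addr0; last first.
    by move=> j /negPf ->; rewrite expr0n mul0r.
  by move=> <-; apply: Rintegral_ge0 => w _; exact: sqr_ge0.
exists [seq D 0 i | i <- index_enum 'I_n]; split.
- by move=> l /mapP[i _ ->].
- have [d' [T' [P' [X' X'E]]]] : exists d' (T' : measurableType d')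
      (P' : probability T' R) (X' : T' -> R),
      weighted_chi_square [seq D 0 i | i <- index_enum 'I_n] P' X'.
    by apply: weighted_chi_square_exists => l /mapP[i _ ->].
  have mS : measurable_fun [set: T] (fun w => \sum_i X i w ^+ 2).
    by apply: measurable_sum => i; exact: measurable_funX.
  have S0 w : 0 <= \sum_i X i w ^+ 2 by apply: sumr_ge0 => i _; exact: sqr_ge0.
  apply: (weighted_chi_square_same_law mS S0 X'E).
  apply: laplace_same_law => //; [exact: wcs_measurable X'E|exact: wcs_ge0 X'E|].
  move=> [|k].
    under eq_Rintegral do rewrite mul0r oppr0 expR0.
    under [in RHS]eq_Rintegral do rewrite mul0r oppr0 expR0.
    by rewrite !Rintegral_cstT.
  rewrite (wcs_laplaceE X'E)// /wcs_laplace big_map.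
  under [in RHS]eq_Rintegral do rewrite -sqE.
  rewrite (@laplace_sum_squares _ Z (fun i => D 0 i))// => c.
  have gZ : centered_gaussian P (fun w => \sum_i c i * Z i w).
    by under eq_fun do rewrite comb; exact: gX.
  by have [_ _ ->] := centered_gaussian_cos gZ; rewrite varZ mulNr.
- move=> i; rewrite /wcs_var big_map ler_pM2l//.
  have -> : \int[P]_w X i w ^+ 2 = C i i.
    by rewrite mxE; apply: eq_Rintegral => w _; rewrite expr2.
  have CE : C i i = \sum_k D 0 k * U k i ^+ 2.
    have -> : C = U^T *m diag_mx D *m U.
      by rewrite -UCU !mulmxA UU' mul1mx -mulmxA UU' mulmx1.
    by rewrite mul_mx_diag mxE; apply: eq_bigr => k _; rewrite !mxE expr2; ring.
  have U1 : \sum_k U k i ^+ 2 = 1.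
    transitivity ((U^T *m U) i i); last by rewrite UU' mxE eqxx.
    by rewrite mxE; apply: eq_bigr => k _; rewrite mxE expr2.
  have Uk k : U k i ^+ 2 <= 1.
    rewrite -U1 (bigD1 k)//= lerDl; apply: sumr_ge0 => j _; exact: sqr_ge0.
  (* The variance [C i i] is the mean of the eigenvalues [D 0 k] under the weights
     [U k i ^ 2], so that its square is at most the mean of their squares. *)
  have h : 0 <= \sum_k (D 0 k - C i i) ^+ 2 * U k i ^+ 2.
    by apply: sumr_ge0 => k _; rewrite mulr_ge0 ?sqr_ge0.
  have E : \sum_k (D 0 k - C i i) ^+ 2 * U k i ^+ 2 =
      \sum_k D 0 k ^+ 2 * U k i ^+ 2 - C i i ^+ 2.
    transitivity (\sum_k (D 0 k ^+ 2 * U k i ^+ 2 +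
      ((- 2 * C i i) * (D 0 k * U k i ^+ 2) + C i i ^+ 2 * U k i ^+ 2))).
      by apply: eq_bigr => k _; ring.
    by rewrite !big_split/= -!mulr_sumr -CE U1; ring.
  rewrite E subr_ge0 in h; apply: (le_trans h); apply: ler_sum => k _.
  by rewrite ler_piMr ?sqr_ge0.
Qed.

End gaussian_vector.

(** * Parseval's identity in a separable inner product space *)

Section parseval.
Context {R : realType} {H : normedModType R} (ip : H -> H -> R).
Hypothesis ipC : forall x y, ip x y = ip y x.
Hypothesis ipD : forall x y z, ip (x + y) z = ip x z + ip y z.
Hypothesis ipZ : forall a x z, ip (a *: x) z = a * ip x z.
Hypothesis ip_norm : forall x, ip x x = `|x| ^+ 2.

Let ip0 z : ip 0 z = 0.
Proof. by rewrite -(scale0r 0) ipZ mul0r. Qed.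

Let ipB x y z : ip (x - y) z = ip x z - ip y z.
Proof. by rewrite ipD -scaleN1r ipZ mulN1r. Qed.

Lemma ip_sumr (I : Type) (r : seq I) (c : I -> R) (e : I -> H) z :
  ip z (\sum_(i <- r) c i *: e i) = \sum_(i <- r) c i * ip z (e i).
Proof.
elim: r => [|i r IH]; first by rewrite !big_nil ipC ip0.
by rewrite !big_cons -IH ipC ipD ipZ (ipC (e i)) (ipC _ z).
Qed.

Let proj (l : seq H) z : H := \sum_(u <- l) ip z u *: u.

Let projB l x y : proj l (x - y) = proj l x - proj l y.
Proof. by rewrite /proj -sumrB; apply: eq_bigr => u _; rewrite ipB scalerBl. Qed.

(* [proj l] is the orthogonal projection on the span of [l], as it is when the nonzero
   members of [l] are orthonormal. *)
Let is_proj l := forall z u, u \in l -> ip (z - proj l z) u = 0.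

Let residual_norm l z : is_proj l ->
  `|z - proj l z| ^+ 2 = `|z| ^+ 2 - \sum_(u <- l) ip z u ^+ 2.
Proof.
move=> pl; rewrite -!ip_norm.
have -> : ip (z - proj l z) (z - proj l z) = ip (z - proj l z) z.
  rewrite [LHS]ipB (ipC z (z - _)) -[RHS]subr0; congr (_ - _).
  rewrite ipC ip_sumr big_seq big1// => u ul.
  by rewrite pl// mulr0.
rewrite ipB; congr (_ - _); rewrite ipC ip_sumr.
by apply: eq_bigr => u _; rewrite expr2.
Qed.

Variable x : nat -> H.

(** A vector that depends linearly on its predecessors yields [0], as [|0|^-1 *: 0] is
    [0]; it is kept, so that the indices are those of [x]. *)
Fixpoint gram_schmidt n : seq H :=
  if n is m.+1 then
    rcons (gram_schmidt m)
      (let r := x m - \sum_(u <- gram_schmidt m) ip (x m) u *: u in `|r|^-1 *: r)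
  else [::].

Definition orthonormalized n : H :=
  let r := x n - \sum_(u <- gram_schmidt n) ip (x n) u *: u in `|r|^-1 *: r.

Let gramS n : gram_schmidt n.+1 = rcons (gram_schmidt n) (orthonormalized n).
Proof. by []. Qed.

Let gramE n : gram_schmidt n = [seq orthonormalized i | i <- iota 0 n].
Proof.
elim: n => // n IH; rewrite gramS IH -cats1 -[in RHS]addn1 iotaD map_cat.
by [].
Qed.

Let proj_rcons l v z : proj (rcons l v) z = proj l z + ip z v *: v.
Proof. by rewrite /proj -cats1 big_cat big_seq1. Qed.

Let gram_spec n : is_proj (gram_schmidt n) /\
  forall k, (k < n)%N -> x k - proj (gram_schmidt n) (x k) = 0.
Proof.
elim: n => [|n [pn xn]]; first by split=> //.
rewrite gramS; set l := gram_schmidt n in pn xn *; set v := orthonormalized n.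
pose r := x n - proj l (x n); have vE : v = `|r|^-1 *: r by [].
have vl u : u \in l -> ip v u = 0 by move=> ul; rewrite vE ipZ pn// mulr0.
have projv z : ip (proj l z) v = 0.
  rewrite ipC ip_sumr big_seq big1// => u ul.
  by rewrite vl// mulr0.
have vv : v = 0 \/ ip v v = 1.
  have [r0|r0] := eqVneq r 0; first by left; rewrite vE r0 scaler0.
  right; rewrite ip_norm vE normrZ normfV normr_id mulVf ?expr1n//.
  by rewrite normr_eq0.
split=> [z u|k].
  rewrite mem_rcons inE proj_rcons opprD addrA ipB ipZ => /predU1P[->|ul].
    rewrite ipB projv subr0; case: vv => [->|->]; last by rewrite mulr1 subrr.
    by rewrite ipC ip0 mul0r subrr.
  by rewrite pn// vl// mulr0 subrr.
rewrite ltnS leq_eqVlt => /predU1P[->|kn]; rewrite proj_rcons opprD addrA.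
  rewrite -/r; have -> : ip (x n) v = ip r v by rewrite /r ipB projv subr0.
  rewrite vE (ipC r) ipZ ip_norm scalerA.
  have [->|r0] := eqVneq r 0; first by rewrite scaler0 subrr.
  have nr : `|r| != 0 by rewrite normr_eq0.
  rewrite (_ : _ * _ = 1) ?scale1r ?subrr//; by field.
rewrite xn// sub0r; have -> : x k = proj l (x k) by apply/eqP; rewrite -subr_eq0 xn.
by rewrite projv scale0r oppr0.
Qed.

(** The partial sums fall short of [|z| ^ 2] by the squared distance from [z] to the
    span of the first vectors, which is at most the squared distance to any [x k]
    among them. *)
Lemma parseval : (forall z (e : R), 0 < e -> exists k, `|z - x k| < e) ->
  forall z, \sum_(0 <= k < n) ip z (orthonormalized k) ^+ 2 @[n --> \oo] --> `|z| ^+ 2.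
Proof.
move=> xdense z.
have SE n : \sum_(0 <= k < n) ip z (orthonormalized k) ^+ 2 =
    \sum_(u <- gram_schmidt n) ip z u ^+ 2.
  by rewrite gramE big_map /index_iota subn0.
apply/cvgrPdist_le => e e0.
have [k zk] := xdense z (Num.sqrt e) (eq_ind_r is_true e0 (sqrtr_gt0 e)).
near=> n; rewrite SE; have [pn xn] := gram_spec n.
rewrite -residual_norm// ger0_norm ?sqr_ge0//.
have kn : (k < n)%N by near: n; exact: nbhs_infty_gt.
have -> : z - proj (gram_schmidt n) z = (z - x k) - proj (gram_schmidt n) (z - x k).
  have pxk : proj (gram_schmidt n) (x k) = x k.
    by apply/esym/eqP; rewrite -subr_eq0 xn.
  by rewrite projB pxk opprB addrA subrK.
rewrite residual_norm// lerBlDr (@le_trans _ _ e)//.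
  rewrite -[leRHS]sqr_sqrtr ?(ltW e0)// lerXn2r// ?nnegrE ?sqrtr_ge0//.
  exact: ltW.
by rewrite lerDl sumr_ge0// => u _; rewrite sqr_ge0.
Unshelve. all: by end_near. Qed.

End parseval.

Lemma separable_dense_sequence {R : realType} {H : normedModType R} :
  separable H -> exists x : nat -> H, forall z (e : R), 0 < e -> exists k, `|z - x k| < e.
Proof.
move=> [D /countable_injP[f finj] Ddense].
exists (fun n => xget 0 [set h | D h /\ f h = n]) => z e e0.
have [h [zh Dh]] : ball z e `&` D !=set0.
  apply: Ddense; [by exists z; exact: ballxx|exact: ball_open].
exists (f h); case: xgetP => [h' _ [Dh' /finj hh']|/(_ h)].
  rewrite hh' ?inE//.
  by move: zh; rewrite -ball_normE.
by case.
Qed.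

(** * Passage to infinitely many coordinates *)

Lemma expr4D_le {R : realDomainType} (a b : R) :
  (a + b) ^+ 4 <= 8 * (a ^+ 4 + b ^+ 4).
Proof.
rewrite -[4%N]/(2 * 2)%N !exprM; have := sqr_ge0 (a - b); have := sqr_ge0 (a + b).
have : (a + b) ^+ 2 + (a - b) ^+ 2 = 2 * (a ^+ 2 + b ^+ 2) by ring.
have := sqr_ge0 (a ^+ 2 - b ^+ 2).
move: (a ^+ 2) (b ^+ 2) ((a + b) ^+ 2) ((a - b) ^+ 2) => x y p q; nra.
Qed.

Lemma sum_sqr_le {R : realDomainType} (ls : seq R) : (forall l, l \in ls -> 0 <= l) ->
  \sum_(l <- ls) l ^+ 2 <= (\sum_(l <- ls) l) ^+ 2.
Proof.
elim: ls => [|l ls IH] ls0; first by rewrite !big_nil expr0n.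
have l0 : 0 <= l by apply: ls0; rewrite mem_head.
have lsn x : x \in ls -> 0 <= x by move=> xls; apply: ls0; rewrite inE xls orbT.
have s0 : 0 <= \sum_(l <- ls) l by rewrite big_seq; apply: sumr_ge0.
by rewrite !big_cons; have := IH lsn; nra.
Qed.

Section square_series.
Context {R : realType} d (T : measurableType d) (P : probability T R).
Variables (Z : nat -> T -> R) (X : T -> R).
Hypothesis gZ : forall n (c : 'I_n -> R),
  centered_gaussian P (fun w => \sum_(i < n) c i * Z i w).

Let S n w : R := \sum_(0 <= k < n) Z k w ^+ 2.
Hypothesis SX : forall w, (fun n => S n w) @ \oo --> X w.
Hypothesis X_nonzero : ~ {ae P, forall w, X w = 0}.

Let nd_S w : {homo S ^~ w : m n / (m <= n)%N >-> m <= n}.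
Proof.
apply/nondecreasing_seqP => n; rewrite /S big_nat_recr//= lerDl.
exact: sqr_ge0.
Qed.

Let S_ge0 n w : 0 <= S n w.
Proof. by apply: sumr_ge0 => k _; exact: sqr_ge0. Qed.

Let S_le n w : S n w <= X w.
Proof.
have Sw := @SX w.
rewrite -(cvg_lim (@Rhausdorff R) Sw).
by apply: nondecreasing_cvgn_le; [exact: nd_S|exact: (cvgP _ Sw)].
Qed.

Let X_ge0 w : 0 <= X w.
Proof. exact: le_trans (S_ge0 0 w) (S_le 0 w). Qed.

Let mZ k : measurable_fun [set: T] (Z k).
Proof.
have [mk _ _] := centered_gaussian_cos (@gZ k.+1 (fun i => (i == ord_max)%:R)).
rewrite (_ : Z k = fun w => \sum_(i < k.+1) (i == ord_max)%:R * Z i w)//.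
apply/funext => w; rewrite (bigD1 ord_max)//= eqxx mul1r big1 ?addr0//.
by move=> i /negPf ->; rewrite mul0r.
Qed.

Let mS n : measurable_fun [set: T] (S n).
Proof. by apply: measurable_sum => k; exact: measurable_funX. Qed.

Let mX : measurable_fun [set: T] X.
Proof. by apply: (measurable_fun_cvg mS) => w _; exact: SX. Qed.

Let law n : exists ls : seq R, [/\ forall l, l \in ls -> 0 <= l,
  weighted_chi_square ls P (S n) &
  forall k, (k < n)%N -> 2 * (\int[P]_w Z k w ^+ 2) ^+ 2 <= wcs_var ls].
Proof.
have [ls [ls0 lsE lsv]] := gaussian_square_sum_law (@gZ n).
exists ls; split=> //.
  by rewrite (_ : S n = fun w => \sum_(i < n) Z i w ^+ 2)//; apply/funext => w; rewrite /S big_mkord.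
by move=> k kn; exact: (lsv (Ordinal kn)).
Qed.

Let ls n : seq R := sval (cid (law n)).
Let ls_ge0 n : forall l, l \in ls n -> 0 <= l.
Proof. by rewrite /ls; case: cid => r []. Qed.
Let lsE n : weighted_chi_square (ls n) P (S n).
Proof. by rewrite /ls; case: cid => r []. Qed.
Let lsv n k : (k < n)%N -> 2 * (\int[P]_w Z k w ^+ 2) ^+ 2 <= wcs_var (ls n).
Proof. by rewrite /ls; case: cid => r [? ? +]; apply. Qed.

Let m n : R := wcs_mean (ls n).
Let v n : R := wcs_var (ls n).

Let iS n : P.-integrable [set: T] (EFin \o S n).
Proof.
have mY : measurable_fun [set: T] (fun w => S n w - m n) by exact: measurable_funB.
have := integrable_lower_power (isT : (1 <= 4)%N) mY (wcs_integrable4 (lsE n)).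
move=> i1; have ic : P.-integrable [set: T] (EFin \o (fun=> m n)).
  exact: (@bounded_integrable _ _ _ _ _ `|m n|).
have := integrableRD i1 ic.
by under eq_fun do rewrite expr1 subrK.
Qed.

Let mE n : m n = \int[P]_w S n w.
Proof.
have ic : P.-integrable [set: T] (EFin \o (fun=> m n)).
  exact: (@bounded_integrable _ _ _ _ _ `|m n|).
have := wcs_moment1 (lsE n); rewrite RintegralB//.
by rewrite Rintegral_cstT => /eqP; rewrite subr_eq0 => /eqP.
Qed.

Let m_ge0 n : 0 <= m n.
Proof. by rewrite mE; apply: Rintegral_ge0 => w _; exact: S_ge0. Qed.

Let nd_m : nondecreasing_seq m.
Proof.
by move=> i j ij; rewrite !mE; apply: le_Rintegral => // w _; exact: nd_S.
Qed.

(* The variance of a nondegenerate coordinate bounds that of [S n] from below for all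
   large [n]. *)
Let nondegenerate : exists k, 0 < \int[P]_w Z k w ^+ 2.
Proof.
apply: contrapT => /forallNP Z0; apply: X_nonzero.
have iZ k : P.-integrable [set: T] (EFin \o (fun w => Z k w ^+ 2)).
  apply: (@dominated_integrableR _ _ _ _ _ (S k.+1)) => //.
    exact: measurable_funX.
  move=> w; rewrite ger0_norm ?sqr_ge0// /S big_nat_recr//= lerDr.
  exact: S_ge0.
have Zk0 k : {ae P, forall w, Z k w = 0}.
  have z0 : \int[P]_w Z k w ^+ 2 = 0.
    apply/eqP; rewrite eq_le leNgt; apply/andP; split; first exact/negP/Z0.
    by apply: Rintegral_ge0 => w _; exact: sqr_ge0.
  have : (\int[P]_w `|(Z k w ^+ 2)%:E| = 0)%E.
    under eq_integral do rewrite gee0_abs ?lee_fin ?sqr_ge0//.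
    by rewrite -EFin_Rintegral// z0.
  move/(ae_eq_integral_abs P measurableT (measurable_int P (iZ k))).
  apply: filterS => w /= /(_ I) [] /eqP.
  by rewrite sqrf_eq0 => /eqP.
have : {ae P, forall w, forall k, Z k w = 0} by apply/ae_foralln.
apply: filterS => w Zw.
have h0 : (fun n => S n w) @ \oo --> (0 : R).
  rewrite (_ : (fun n => S n w) = fun=> 0); first exact: cvg_cst.
  by apply/funext => n; rewrite /S big1// => k _; rewrite Zw expr0n.
exact: (cvg_unique _ (@SX w) h0).
Qed.

Let c0 : R := (2 * Num.sqrt 3 - 3) / 15.

Let c0_gt0 : 0 < c0.
Proof.
have h : 0 <= (3 : R) by [].
rewrite divr_gt0// subr_gt0 -ltr_pdivrMl// -[ltLHS]ger0_norm ?divr_ge0//.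
rewrite -sqrtr_sqr ltr_sqrt//; lra.
Qed.

Let v_gt0 : exists2 a : R, 0 < a & \forall n \near \oo, a <= v n.
Proof.
have [k k0] := nondegenerate.
exists (2 * (\int[P]_w Z k w ^+ 2) ^+ 2); first by rewrite mulr_gt0// exprn_gt0.
by near=> n; apply: lsv; near: n; exact: nbhs_infty_gt.
Unshelve. all: by end_near. Qed.

(* Each [S n], hence [X], exceeds [m n] with probability at least [c0]. Were the means
   unbounded, [X] would be infinite with probability at least [c0]. *)
Let m_bounded : exists M : R, forall n, m n <= M.
Proof.
apply: contrapT => /forallNP unb.
pose F j := [set w | j%:R < X w].
have mF j : measurable (F j).
  rewrite (_ : F j = X @^-1` `]j%:R, +oo[%classic); last first.
    by apply/seteqP; split => w /=; rewrite in_itv/= andbT.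
  by rewrite -[X in measurable X]setTI; exact: mX.
have cF j : (c0%:E <= P (F j))%E.
  have [a a0 va] := v_gt0.
  have [N _ vN] := va.
  have /existsNP[n0 /negP] := unb j%:R; rewrite -ltNge => mj.
  pose n := maxn n0 N.
  have mn : j%:R < m n by apply: (lt_le_trans mj); apply: nd_m; exact: leq_maxl.
  have vn : 0 < v n by apply: (lt_le_trans a0); apply: vN; exact: leq_maxr.
  have mY : measurable_fun [set: T] (fun w => S n w - m n) by exact: measurable_funB.
  have := fourth_moment_lower_bound mY (wcs_integrable4 (lsE n)) vn
    (wcs_moment1 (lsE n)) (wcs_moment2 (lsE n)) (wcs_moment4 (lsE n)).
  move=> /le_trans; apply; apply: le_measure; rewrite ?inE//.
    rewrite (_ : [set w | _] = (fun w => S n w - m n) @^-1` `]0, +oo[%classic); last first.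
      by apply/seteqP; split => w /=; rewrite in_itv/= andbT.
    by rewrite -[X in measurable X]setTI; exact: mY.
  move=> w /=; rewrite subr_gt0 => mS'; apply: (lt_trans mn).
  exact: lt_le_trans mS' (S_le n w).
have nF : P (\bigcap_j F j) = 0%E.
  rewrite (_ : \bigcap_j F j = set0) ?measure0//.
  apply/seteqP; split => // w /(_ (Num.truncn (X w)).+1 I) /=.
  by rewrite /F /= ltNge => /negP; apply; rewrite ltW// truncnS_gt.
have cvF : P \o F @ \oo --> P (\bigcap_j F j).
  apply: nonincreasing_cvg_mu => //.
  - by rewrite (le_lt_trans (probability_le1 _ _)) ?ltry.
  - exact: bigcapT_measurable.
  - apply/nonincreasing_seqP => j; apply/subsetPset => w /=.
    by apply: lt_trans; rewrite ltr_nat.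
have : (c0%:E <= P (\bigcap_j F j))%E.
  by apply: (cvge_to_ge cvF); apply: nearW.
by rewrite nF lee_fin leNgt c0_gt0.
Qed.

Let S4_bounded : exists B : R, forall n, \int[P]_w S n w ^+ 4 <= B.
Proof.
have [M mM] := m_bounded.
exists (8 * (15 * (2 * M ^+ 2) ^+ 2 + M ^+ 4)) => n.
have M0 : 0 <= M := le_trans (m_ge0 0) (mM 0).
have mS4 : measurable_fun [set: T] (fun w => S n w ^+ 4) by exact: measurable_funX.
have i4 := wcs_integrable4 (lsE n).
have ic : P.-integrable [set: T] (EFin \o (fun=> m n ^+ 4)).
  exact: (@bounded_integrable _ _ _ _ _ `|m n ^+ 4|).
have ib := integrableRZl 8 (integrableRD i4 ic).
have pw w : S n w ^+ 4 <= 8 * ((S n w - m n) ^+ 4 + m n ^+ 4).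
  by rewrite -[in leLHS](subrK (m n) (S n w)) expr4D_le.
apply: (@le_trans _ _ (\int[P]_w (8 * ((S n w - m n) ^+ 4 + m n ^+ 4)))).
  apply: le_Rintegral => //.
  apply: (dominated_integrableR mS4 ib) => w.
  by rewrite ger0_norm ?exprn_ge0.
rewrite RintegralZl//; last exact: integrableRD.
rewrite RintegralD// Rintegral_cstT; apply: ler_wpM2l => //.
apply: lerD; last by rewrite lerXn2r// nnegrE.
apply: (le_trans (wcs_moment4 (lsE n))); apply: ler_wpM2l => //.
have v0 : 0 <= wcs_var (ls n).
  by rewrite mulr_ge0// sumr_ge0// => x _; exact: sqr_ge0.
have M20 : 0 <= 2 * M ^+ 2 by rewrite mulr_ge0// sqr_ge0.
rewrite lerXn2r ?nnegrE//; apply: ler_wpM2l => //.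
apply: (le_trans (sum_sqr_le (@ls_ge0 n))).
by rewrite -/(wcs_mean _) -/(m n) lerXn2r// nnegrE.
Qed.

Let iX4 : P.-integrable [set: T] (EFin \o (fun w => X w ^+ 4)).
Proof.
have [B SB] := S4_bounded.
have iS4 n : P.-integrable [set: T] (EFin \o (fun w => S n w ^+ 4)).
  have ic : P.-integrable [set: T] (EFin \o (fun=> m n ^+ 4)).
    exact: (@bounded_integrable _ _ _ _ _ `|m n ^+ 4|).
  have ib := integrableRZl 8 (integrableRD (wcs_integrable4 (lsE n)) ic).
  apply: (dominated_integrableR _ ib); first exact: measurable_funX.
  move=> w; rewrite ger0_norm ?exprn_ge0//.
  by rewrite -[in leLHS](subrK (m n) (S n w)) expr4D_le.
apply/integrableP; split; first by apply/measurable_EFinP; exact: measurable_funX.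
have -> : (\int[P]_w `|(EFin \o (fun w => (X w ^+ 4)%R)) w| =
    \int[P]_w limn (fun n => (S n w ^+ 4)%:E))%E.
  apply: eq_integral => w _; rewrite /= ger0_norm ?exprn_ge0//; apply/esym/cvg_lim => //.
  apply: cvg_EFin; first exact: nearW.
  by apply: (continuous_cvg _ (@exprn_continuous _ 4 (X w))); exact: SX.
rewrite (@monotone_convergence _ _ _ P _ measurableT (fun n w => (S n w ^+ 4)%:E)).
- apply: (@le_lt_trans _ _ B%:E); last exact: ltry.
  apply: lime_le.
    apply: ereal_nondecreasing_is_cvgn => i j ij; apply: ge0_le_integral => //.
    + by move=> w _; rewrite lee_fin exprn_ge0.
    + by apply/measurable_EFinP; exact: measurable_funX.
    + by apply/measurable_EFinP; exact: measurable_funX.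
    + by move=> w _; rewrite lee_fin lerXn2r ?nnegrE// nd_S.
  apply: nearW => n.
  by rewrite -(EFin_Rintegral (iS4 n)) lee_fin.
- by move=> n; apply/measurable_EFinP; exact: measurable_funX.
- by move=> n w _; rewrite lee_fin exprn_ge0.
- by move=> w _ i j ij; rewrite lee_fin lerXn2r ?nnegrE// nd_S.
Qed.

Lemma integrable_square_series : P.-integrable [set: T] (EFin \o X).
Proof. exact: (integrable_lower_power (isT : (1 <= 4)%N) mX iX4). Qed.

Let EX := \int[P]_w X w.

Let m_le n : m n <= EX.
Proof.
by rewrite mE; apply: le_Rintegral => //; exact: integrable_square_series.
Qed.

Let m_cvg : m @ \oo --> EX.
Proof.
rewrite (_ : m = fun n => \int[P]_w S n w); last exact/funext.
apply: (Rintegral_dct _ mX integrable_square_series) => //.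
by move=> n w; rewrite ger0_norm.
Qed.

Let EX0 : 0 <= EX.
Proof. exact: le_trans (m_ge0 0) (m_le 0). Qed.

Let Yn n w := S n w - m n.
Let Y w := X w - EX.

Let mYn n : measurable_fun [set: T] (Yn n).
Proof. exact: measurable_funB. Qed.

Let mY : measurable_fun [set: T] Y.
Proof. exact: measurable_funB. Qed.

Let Yn_cvg w : (fun n => Yn n w) @ \oo --> Y w.
Proof. by apply: cvgB; [exact: SX|exact: m_cvg]. Qed.

Let Yn_le n w : `|Yn n w| <= X w + EX.
Proof.
rewrite (le_trans (ler_normB _ _))// !ger0_norm// lerD//; exact: m_le.
Qed.

Let iXE4 : P.-integrable [set: T] (EFin \o (fun w => (X w + EX) ^+ 4)).
Proof.
have ic : P.-integrable [set: T] (EFin \o (fun=> EX ^+ 4)).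
  exact: (@bounded_integrable _ _ _ _ _ `|EX ^+ 4|).
apply: (dominated_integrableR _ (integrableRZl 8 (integrableRD iX4 ic))).
  by apply: measurable_funX; exact: measurable_funD.
move=> w; rewrite ger0_norm ?expr4D_le// exprn_ge0// addr_ge0//.
Qed.

Let moments_cvg k : (k <= 4)%N ->
  (fun n => \int[P]_w Yn n w ^+ k) @ \oo --> \int[P]_w Y w ^+ k.
Proof.
move=> k4.
have mXE : measurable_fun [set: T] (fun w => X w + EX) by exact: measurable_funD.
have ik := integrable_lower_power k4 mXE iXE4.
apply: (Rintegral_dct _ _ ik).
- by move=> n; exact: measurable_funX.
- exact: measurable_funX.
- move=> n w; rewrite normrX lerXn2r ?nnegrE ?Yn_le//.
  by rewrite addr_ge0.
- by move=> w; apply: (continuous_cvg _ (@exprn_continuous _ k (Y w))); exact: Yn_cvg.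
Qed.

Let v_cvg : v @ \oo --> \int[P]_w Y w ^+ 2.
Proof.
rewrite (_ : v = fun n => \int[P]_w Yn n w ^+ 2); first exact: moments_cvg.
by apply/funext => n; rewrite (wcs_moment2 (lsE n)).
Qed.

(** The bound on the fourth moment passes to the limit, by dominated convergence. *)
Lemma square_series_lower_bound :
  (((2 * Num.sqrt 3 - 3) / 15)%:E <= P [set w | (EX < X w)%R])%E.
Proof.
rewrite (_ : [set w | _] = [set w | 0 < Y w]); last first.
  by apply/seteqP; split => w /=; rewrite subr_gt0.
apply: (@fourth_moment_lower_bound _ _ _ P Y (\int[P]_w Y w ^+ 2)) => //.
- apply: (dominated_integrableR _ iXE4); first exact: measurable_funX.
  move=> w; rewrite normrX lerXn2r ?nnegrE ?addr_ge0//.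
  by rewrite (le_trans (ler_normB _ _))// !ger0_norm.
- have [a a0 va] := v_gt0.
  by apply: (lt_le_trans a0); apply: (cvgr_to_ge v_cvg va).
- have c1 := @moments_cvg 1 isT.
  have : (fun n => \int[P]_w Yn n w ^+ 1) @ \oo --> (0 : R).
    rewrite (_ : (fun n => _) = fun=> 0); first exact: cvg_cst.
    by apply/funext => n; exact: (wcs_moment1 (lsE n)).
  by move=> c1'; exact: (cvg_unique _ c1 c1').
- have c4 := @moments_cvg 4 isT.
  have c2 : (fun n => 15 * v n ^+ 2) @ \oo --> 15 * (\int[P]_w Y w ^+ 2) ^+ 2.
    apply: cvgM; first exact: cvg_cst.
    by apply: (continuous_cvg _ (@exprn_continuous _ 2 _)); exact: v_cvg.
  by apply: (ler_cvg_to c4 c2); apply: nearW => n; exact: (wcs_moment4 (lsE n)).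
Qed.

(** Rather than the probabilities, whose limit would require that the law of [X] has no
    atom at its mean, the means of the bounded continuous function
    [y / (s ^ 2 + y ^ 2)] pass to the limit. *)
Lemma square_series_upper_bound : (P [set w | (EX < X w)%R] <= (1 / 2 : R)%:E)%E.
Proof.
rewrite (_ : [set w | _] = [set w | 0 < Y w]); last first.
  by apply/seteqP; split => w /=; rewrite subr_gt0.
apply: probability_gt0_le_half => // s s0.
pose f (y : R) := y / (s ^+ 2 + y ^+ 2).
have q0 y : 0 < s ^+ 2 + y ^+ 2 by rewrite ltr_pwDl ?sqr_ge0// exprn_gt0.
have cf : continuous f.
  move=> y; apply: cvgM; first exact: cvg_id.
  apply: cvgV; first by rewrite gt_eqF.
  by apply: cvgD; [exact: cvg_cst|exact: exprn_continuous].
have mf : measurable_fun [set: R] f by exact: continuous_measurable_fun.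
have fb y : `|f y| <= s^-1.
  rewrite /f normrM normfV (gtr0_norm (q0 y)).
  rewrite ler_pdivrMr// ler_pdivlMl// -(real_normK (num_real y)).
  by have := sqr_ge0 (s - `|y|); have := normr_ge0 y; nra.
have cvI : (fun n => \int[P]_w f (Yn n w)) @ \oo --> \int[P]_w f (Y w).
  apply: (@Rintegral_dct _ _ _ _ _ _ (fun=> s^-1)) => //.
  - by move=> n; exact: measurableT_comp.
  - exact: measurableT_comp.
  - exact: (@bounded_integrable _ _ _ _ _ `|s^-1|).
  - by move=> w; apply: (continuous_cvg _ (cf (Y w))); exact: Yn_cvg.
apply: (cvgr_to_le cvI).
have [a a0 va] := v_gt0.
apply: filterS va => n van.
apply: (weighted_chi_square_Poisson_le0 (@ls_ge0 n) _ (lsE n) s0).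
apply: contrapT => nol.
have : v n = 0.
  rewrite /v /wcs_var big_seq big1 ?mulr0// => l lls.
  have [l0|l0] := ltP 0 l; first by exfalso; apply: nol; exists l.
  have -> : l = 0 by apply/eqP; rewrite eq_le l0 (ls_ge0 lls).
  by rewrite expr0n.
by move=> v0; move: (lt_le_trans a0 van); rewrite v0 ltxx.
Qed.

End square_series.

Theorem proposition3p5 (R : realType)
    (H : completeNormedModType R) (ip : {dot H for idfun})
    (ip_norm : forall x : H, ip x x = `|x| ^+ 2)
    (H_separable : separable H)
    (d : measure_display) (Omega : measurableType d)
    (P : probability Omega R) (G : Omega -> H)
    (G_meas : measurable_fun [set: Omega] (G : Omega -> borel H))
    (G_gauss : hilbert_centered_gaussian P ip G)
    (G_nonzero : ~ {ae P, forall w, G w = 0}) :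
  (((2 * Num.sqrt 3 - 3) / 15)%:E
     <= P [set w | poweR 'E_P[fun w' => (`|G w'| ^+ 2)%R] (2^-1)%R < (`|G w|%R)%:E]
     <= (1 / 2)%:E)%E.
Proof.
have ipC x y : ip x y = ip y x by rewrite hermitian_subproof expr0 mul1r.
have ipD x y z : ip (x + y) z = ip x z + ip y z by rewrite linearDl.
have ipZ a x z : ip (a *: x) z = a * ip x z by rewrite linearZl_LR.
have [x xdense] := separable_dense_sequence H_separable.
pose e := orthonormalized ip x.
pose Z k w := ip (G w) (e k).
have gZ n (c : 'I_n -> R) : centered_gaussian P (fun w => \sum_(i < n) c i * Z i w).
  have := G_gauss (\sum_(i < n) c i *: e i).
  by under eq_fun do rewrite ip_sumr//.
have SX w : (fun n => \sum_(0 <= k < n) Z k w ^+ 2) @ \oo --> `|G w| ^+ 2.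
  exact: parseval.
have X_nonzero : ~ {ae P, forall w, `|G w| ^+ 2 = 0}.
  apply: contra_not G_nonzero; apply: filterS => w /eqP.
  by rewrite sqrf_eq0 normr_eq0 => /eqP.
have iX := integrable_square_series gZ SX X_nonzero.
have lo := square_series_lower_bound gZ SX X_nonzero.
have up := square_series_upper_bound gZ SX X_nonzero.
have -> : [set w | (poweR 'E_P[fun w' => (`|G w'| ^+ 2)%R] (2^-1)%R < (`|G w|%R)%:E)%E]
    = [set w | \int[P]_w' `|G w'| ^+ 2 < `|G w| ^+ 2].
  have -> : 'E_P[fun w' => (`|G w'| ^+ 2)%R]%E = (\int[P]_w' `|G w'| ^+ 2)%:E.
    by rewrite unlock EFin_Rintegral.
  have EX0 : 0 <= \int[P]_w' `|G w'| ^+ 2.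
    by apply: Rintegral_ge0 => w _; exact: sqr_ge0.
  have sqrtE w : (Num.sqrt (\int[P]_w' `|G w'| ^+ 2) < `|G w|) =
      (\int[P]_w' `|G w'| ^+ 2 < `|G w| ^+ 2).
    by rewrite -[in RHS](sqr_sqrtr EX0) ltr_pXn2r ?nnegrE ?sqrtr_ge0.
  by rewrite poweR_EFin powR12_sqrt//; apply/seteqP; split => w /=; rewrite lte_fin sqrtE.
by rewrite lo up.
Qed.
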